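(* Let $p>1$, $n\ge 2$, $N\ge 1$, $\mu\in[0,1]$, and let $\Omega\subset\mathbb{R}^n$ be an open bounded set. Let $\mathbf{F}\in L^p(\Omega;\mathbb{C}^{N\times n})$ and let $\mathfrak{a}:\Omega\to\mathbb{C}$ be a bounded measurable function for which there are constants $\gamma_0,\gamma_1,\gamma_2\in(0,\infty)$ such that, for a.e. $x\in\Omega$, $$\gamma_1\le|\mathfrak{a}(x)|\le\gamma_2,\qquad \mathrm{Re}(\mathfrak{a}(x))-c_0|\mathrm{Im}(\mathfrak{a}(x))|>\gamma_0,\qquad c_0:=\sqrt{(c_2/c_1)^2-1},$$ where $c_1,c_2$ are the constants fixed in the context. Then the system $$-\mathrm{div}\big(\mathfrak{a}(x)\mathbb{V}_p^\mu(\mathrm{D}\mathbf{u})\big)=-\mathrm{div}\big(|\mathbf{F}|^{p-2}\mathbf{F}\big)\ \text{ in }\Omega,\qquad \mathbf{u}=\mathbf{0}\ \text{ on }\partial\Omega,$$ admits a unique weak solution $\mathbf{u}\in W^{1,p}_0(\Omega;\mathbb{C}^N)$.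
   Context: For $\eta\in\mathbb{C}^{N\times n}$ (and likewise for $\eta\in\mathbb{R}^{2N\times n}$), $\mathbb{V}_p^\mu(\eta):=(\mu^2+|\eta|^2)^{\frac{p-2}{2}}\eta$, where $|\cdot|$ is the Euclidean (Frobenius) norm; $\mathbb{V}_p^\mu(0)=0$ and $|\mathbf{F}|^{p-2}\mathbf{F}=0$ where $\mathbf{F}=0$. $\langle\mathbf{Y},\mathbf{Z}\rangle:=\sum_{k,j}Y_{kj}\overline{Z_{kj}}$ is the Hermitian inner product on $\mathbb{C}^{N\times n}$. $\mathbf{D}:\mathbf{E}$ denotes the canonical inner product on $\mathbb{R}^{2N\times n}$. Constants $c_1,c_2$: fixed positive constants, depending on $p,N,n$, such that for every $y,z\in\mathbb{R}^{2N\times n}$ $$c_1(\mu^2+|y|^2+|z|^2)^{\frac{p-2}{2}}|y-z|^2\le(\mathbb{V}_p^\mu(y)-\mathbb{V}_p^\mu(z)):(y-z)\le c_2(\mu^2+|y|^2+|z|^2)^{\frac{p-2}{2}}|y-z|^2$$ (all terms being $0$ when $y=z=0$). Weak solution: $\mathbf{u}\in W^{1,p}_0(\Omega;\mathbb{C}^N)$ is a weak solution if $$\int_\Omega\mathfrak{a}(x)\langle\mathbb{V}_p^\mu(\mathrm{D}\mathbf{u}),\mathrm{D}\varphi\rangle\,dx=\int_\Omega\langle|\mathbf{F}|^{p-2}\mathbf{F},\mathrm{D}\varphi\rangle\,dx\quad\text{for all }\varphi\in W^{1,p}_0(\Omega;\mathbb{C}^N),$$ where $\mathrm{D}\mathbf{u}$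 is the $N\times n$ weak Jacobian matrix, and $W^{1,p}_0$ is the closure of $C_0^\infty(\Omega;\mathbb{C}^N)$ in $W^{1,p}(\Omega;\mathbb{C}^N)$. *)

(* Defs.v *)
From HB Require Import structures.
From mathcomp Require Import all_boot all_order all_algebra.
From mathcomp Require Import all_classical all_reals all_analysis.
From mathcomp Require Import complex.
Import Order.TTheory GRing.Theory Num.Theory.
Import numFieldNormedType.Exports.

Set Implicit Arguments.
Unset Strict Implicit.
Unset Printing Implicit Defensive.

Local Open Scope classical_set_scope.
Local Open Scope ring_scope.

(* 'rV[R]_n carries the sigma-algebra generated by the
   coordinates, as n.-tuple does in the library; it is the Borel one, see
   open_measurable_rV. *)
Section measurable_rV.
Context (R : realType) (n : nat).

Let coor (i : 'I_n) (x : 'rV[R]_n) : measurableTypeR R := x ord0 i.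

Let rV_set0 : g_sigma_preimage coor set0.
Proof. exact: sigma_algebra0. Qed.

Let rV_setC A : g_sigma_preimage coor A -> g_sigma_preimage coor (~` A).
Proof. exact: sigma_algebraC. Qed.

Let rV_bigcup (F : _^nat) : (forall i, g_sigma_preimage coor (F i)) ->
  g_sigma_preimage coor (\bigcup_i (F i)).
Proof. exact: sigma_algebra_bigcup. Qed.

HB.instance Definition _ :=
  @isMeasurable.Build default_measure_display
    'rV[R]_n (g_sigma_preimage coor) rV_set0 rV_setC rV_bigcup.

Lemma measurable_coor (i : 'I_n) :
  measurable_fun [set: 'rV[R]_n] (fun x => x ord0 i : measurableTypeR R).
Proof.
move=> _ Y mY; rewrite setTI; apply: sub_sigma_algebra => /=.
rewrite -bigcup_seq/=; exists i => /=; first by rewrite mem_index_enum.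
by exists Y => //; rewrite setTI.
Qed.

Lemma measurable_fun_rVP d (T : measurableType d) (f : T -> 'rV[R]_n) :
  (forall i, measurable_fun setT (fun t => f t ord0 i : measurableTypeR R)) ->
  measurable_fun setT f.
Proof.
move=> mf _ Y mY.
pose G := [set A : set 'rV[R]_n | measurable ([set: T] `&` f @^-1` A)].
suff : g_sigma_preimage coor `<=` G by exact.
apply: smallest_sub.
- split=> [|A|F] /=; rewrite /G /=.
  + by rewrite preimage_set0 setI0.
  + by rewrite !setTI setTD preimage_setC => ?; exact: measurableC.
  + move=> mF; rewrite setTI preimage_bigcup; apply: bigcup_measurable => k _.
    by have := mF k; rewrite setTI.
- rewrite -bigcup_seq => A [i _ [B mB <-]].
  by rewrite /G/= !setTI; have := mf i measurableT B mB; rewrite setTI.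
Qed.

End measurable_rV.

Lemma open_measurable_rV (R : realType) n (U : set 'rV[R]_n) :
  open U -> measurable U.
Proof.
move=> oU.
pose c (z : 'rV[rat]_n) : 'rV[R]_n := map_mx ratr z.
pose B (z : 'rV[rat]_n * nat) : set 'rV[R]_n :=
  \bigcap_(i in [set: 'I_n])
    ((fun x => x ord0 i) @^-1` ball (c z.1 ord0 i) z.2.+1%:R^-1).
have mB z : measurable (B z).
  apply: fin_bigcap_measurable => // i _.
  rewrite -[X in measurable X]setTI; apply: measurable_coor => //.
  exact: measurable_realfun.measurable_ball.
have -> : U = \bigcup_(z in [set z | B z `<=` U]) B z.
  rewrite eqEsubset; split=> [x Ux|x [z /= BU Bx]]; last exact: BU.
  have /nbhs_ballP[e /= e0 xU] : nbhs x U by exact: open_nbhs_nbhs.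
  have [k ke] : exists k : nat, k.+1%:R^-1 < e / 2.
    have := near_infty_natSinv_lt (PosNum (divr_gt0 e0 (ltr0n _ 2))).
    by move=> [k _ /(_ k (leqnn k))] /= ?; exists k.
  have [q xq] : exists q : 'rV[rat]_n,
      forall i, ball (x ord0 i) k.+1%:R^-1 (c q ord0 i).
    have /choice[f xf] : forall i : 'I_n, exists r : rat,
        ball (x ord0 i) k.+1%:R^-1 (ratr r : R).
      move=> i; have : x ord0 i - k.+1%:R^-1 < x ord0 i + k.+1%:R^-1.
        by rewrite ltrBlDr -addrA ltrDl addr_gt0 ?invr_gt0.
      by move=> /rat_in_itvoo[r]; exists r; rewrite ball_itv.
    by exists (\row_i f i) => i; rewrite /c !mxE.
  exists (q, k) => [y By|i _] /=; last by apply/ball_sym/xq.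
  apply: xU; rewrite mx_norm_ball /=.
  have : ball x e y; last by rewrite mx_norm_ball.
  split => // i j; rewrite ord1.
  apply: (@le_ball _ _ _ (k.+1%:R^-1 + k.+1%:R^-1)).
    by rewrite [leRHS]splitr lerD// ltW.
  by apply: ball_triangle (xq j) _; exact: By.
rewrite bigcup_mkcond.
apply: countable_bigcupT_measurable => [|z]; last by case: ifP.
exact: countableP.
Qed.

Section rV_cons.
Context (R : realType) (n : nat).

Definition rV_cons (z : measurableTypeR R * 'rV[R]_n) : 'rV[R]_n.+1 :=
  row_mx (z.1)%:M z.2.

Definition rV_uncons (x : 'rV[R]_n.+1) : measurableTypeR R * 'rV[R]_n :=
  (x ord0 ord0, \row_(j < n) x ord0 (lift ord0 j)).

Lemma rV_consK : cancel rV_cons rV_uncons.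
Proof.
case=> x v; rewrite /rV_uncons /rV_cons /=; congr pair.
  by rewrite mxE; case: splitP => // j _; rewrite !mxE !ord1.
apply/rowP => j; rewrite !mxE; case: splitP => [k e|k e].
  by move: e; rewrite ord1 /= /bump.
by congr (v _ _); apply: val_inj; move: e => /= [].
Qed.

Lemma rV_unconsK : cancel rV_uncons rV_cons.
Proof.
move=> x; apply/rowP => j; rewrite mxE; case: splitP => [k|k jk].
  rewrite ord1 => j0; rewrite !mxE /=; congr (x _ _); exact: val_inj.
rewrite !mxE; congr (x _ _); apply: val_inj.
by rewrite [RHS]jk.
Qed.

Lemma measurable_rV_cons : measurable_fun setT rV_cons.
Proof.
apply: measurable_fun_rVP => i.
case: (unliftP ord0 i) => [j|] ->.
  rewrite [X in measurable_fun _ X](_ :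
      _ = (fun t : measurableTypeR R * 'rV[R]_n => t.2 ord0 j)); last first.
    apply/funext => t; have /(congr1 snd)/rowP/(_ j) := rV_consK t.
    by rewrite mxE.
  by apply: (measurableT_comp (measurable_coor j)); exact: measurable_snd.
rewrite [X in measurable_fun _ X](_ : _ = fst); first exact: measurable_fst.
by apply/funext => t; have /(congr1 fst) := rV_consK t.
Qed.

Lemma measurable_rV_uncons : measurable_fun setT rV_uncons.
Proof.
apply/measurable_fun_pairP; split; first exact: measurable_coor.
apply: measurable_fun_rVP => i.
rewrite [X in measurable_fun _ X](_ :
    _ = (fun t : 'rV[R]_n.+1 => t ord0 (lift ord0 i))).
  exact: measurable_coor.
by apply/funext => t; rewrite /= mxE.
Qed.

End rV_cons.

Section lebesgue_rV.
Context (R : realType).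

Section step.
Context (n : nat) (m : {sigma_finite_measure set 'rV[R]_n -> \bar R}).

Definition lebesgue_rVS : set 'rV[R]_n.+1 -> \bar R :=
  pushforward (@lebesgue_measure R \x m)%E (@rV_cons R n).

Let lebesgue_rVS0 : lebesgue_rVS set0 = 0%E.
Proof. by rewrite /lebesgue_rVS /pushforward preimage_set0 measure0. Qed.

Let lebesgue_rVS_ge0 A : (0 <= lebesgue_rVS A)%E.
Proof. by rewrite /lebesgue_rVS /pushforward; apply: measure_ge0. Qed.

Let lebesgue_rVS_sigma_additive : semi_sigma_additive lebesgue_rVS.
Proof.
have mc (A : set 'rV[R]_n.+1) : measurable A -> measurable (@rV_cons R n @^-1` A).
  by move=> mA; rewrite -[X in measurable X]setTI; exact: measurable_rV_cons.
move=> F mF tF mUF; rewrite /lebesgue_rVS /pushforward preimage_bigcup.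
apply: measure_semi_sigma_additive.
- by move=> k; exact: mc.
- move=> i j _ _ [z [Fi Fj]]; apply: (tF i j) => //.
  by exists (rV_cons z).
- by rewrite -preimage_bigcup; exact: mc.
Qed.

HB.instance Definition _ := isMeasure.Build _ _ _ lebesgue_rVS
  lebesgue_rVS0 lebesgue_rVS_ge0 lebesgue_rVS_sigma_additive.

Let lebesgue_rVS_sigma_finite : sigma_finite setT lebesgue_rVS.
Proof.
have /sigma_finiteP[F [TF ndF Foo]] := sigma_finiteT (@lebesgue_measure R).
have /sigma_finiteP[G [TG ndG Goo]] := sigma_finiteT m.
exists (fun k => @rV_uncons R n @^-1` (F k `*` G k)).
  rewrite -preimage_bigcup (_ : \bigcup_k _ = setT) ?preimage_setT//.
  rewrite -subTset => -[x y] _.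
  have [i _ Fx] : (\bigcup_k F k) x by rewrite -TF.
  have [j _ Gy] : (\bigcup_k G k) y by rewrite -TG.
  exists (maxn i j) => //; split => /=.
  - by move: x Fx; exact/subsetPset/ndF/leq_maxl.
  - by move: y Gy; exact/subsetPset/ndG/leq_maxr.
move=> k; have [mF Fk] := Foo k; have [mG Gk] := Goo k; split.
  rewrite -[X in measurable X]setTI; apply: measurable_rV_uncons => //.
  exact: measurableX.
rewrite /lebesgue_rVS /pushforward -comp_preimage.
rewrite (_ : _ \o _ = id); last by apply/funext => z /=; rewrite rV_consK.
by rewrite product_measure1E// lte_mul_pinfty// ge0_fin_numE.
Qed.

HB.instance Definition _ := @Measure_isSigmaFinite.Build _ _ _
  lebesgue_rVS lebesgue_rVS_sigma_finite.

End step.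

(* The n-fold product of lebesgue_measure, see lebesgue_rV_box. *)
Fixpoint lebesgue_rV (n : nat) : {sigma_finite_measure set 'rV[R]_n -> \bar R} :=
  if n is m.+1 then lebesgue_rVS (lebesgue_rV m) else \d_(0 : 'rV[R]_0).

End lebesgue_rV.

Lemma lebesgue_rV_box (R : realType) n (a b : 'I_n -> R) :
  (forall i, a i <= b i) ->
  lebesgue_rV R n [set x | forall i, a i < x ord0 i <= b i] =
  (\prod_(i < n) (b i - a i))%:E.
Proof.
elim: n a b => [|n IH] a b ab /=.
  rewrite big_ord0 diracE.
  by rewrite mem_set// => -[].
have c0 x v : rV_cons (x, v) ord0 ord0 = x :> R.
  by have /(congr1 fst) := rV_consK (x, v).
have cS x v i : rV_cons (x, v) ord0 (lift ord0 i) = v ord0 i :> R.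
  by have /(congr1 snd)/rowP/(_ i) := rV_consK (x, v); rewrite /= mxE.
pose I : set (measurableTypeR R) := `]a ord0, b ord0]%classic.
pose B : set 'rV[R]_n :=
  [set x | forall i, a (lift ord0 i) < x ord0 i <= b (lift ord0 i)].
transitivity ((@lebesgue_measure R \x lebesgue_rV R n) (I `*` B))%E.
  congr product_measure1; apply/seteqP; split => -[x v] /=.
    move=> h; split; first by have := h ord0; rewrite c0 /I /= in_itv.
    by move=> i; have := h (lift ord0 i); rewrite cS.
  move=> [h0 h1] i; case: (unliftP ord0 i) => [j|] ->.
    by rewrite cS; exact: h1.
  by rewrite c0; move: h0; rewrite /I /= in_itv.
have mI : measurable I by exact: measurable_itv.
have mB : measurable B.
  rewrite (_ : B = \bigcap_(i in [set: 'I_n]) ((fun x : 'rV[R]_n =>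
      x ord0 i) @^-1` `]a (lift ord0 i), b (lift ord0 i)])).
    apply: fin_bigcap_measurable => // i _.
    by rewrite -[X in measurable X]setTI; apply: measurable_coor.
  apply/seteqP; split => x /= h i; first by move=> _ /=;
    rewrite in_itv; exact: h.
  by have := h i Logic.I; rewrite /= in_itv.
rewrite product_measure1E// IH// big_ord_recl EFinM; congr (_ * _)%E.
rewrite [LHS](lebesgue_measure_itv `]a ord0, b ord0]) /= lte_fin.
by case: ltgtP (ab ord0) => // ->; rewrite subrr.
Qed.

Section norms.
Context (R : realType) (N n : nat).

Definition frob (y : 'M[R]_(N, n)) : R :=
  Num.sqrt (\sum_(k < N) \sum_(j < n) y k j ^+ 2).

Definition frobC (Y : 'M[R[i]]_(N, n)) : R :=
  Num.sqrt (\sum_(k < N) \sum_(j < n) Normc.normc (Y k j) ^+ 2).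

Definition mxdot (y z : 'M[R]_(N, n)) : R :=
  \sum_(k < N) \sum_(j < n) y k j * z k j.

Definition mxdotC (Y Z : 'M[R[i]]_(N, n)) : R[i] :=
  \sum_(k < N) \sum_(j < n) Y k j * conjc (Z k j).

(* At eta = 0 both maps vanish whatever the value of the power is. *)
Definition Vmap (p mu : R) (eta : 'M[R]_(N, n)) : 'M[R]_(N, n) :=
  ((mu ^+ 2 + frob eta ^+ 2) `^ ((p - 2) / 2)) *: eta.

Definition VmapC (p mu : R) (eta : 'M[R[i]]_(N, n)) : 'M[R[i]]_(N, n) :=
  ((mu ^+ 2 + frobC eta ^+ 2) `^ ((p - 2) / 2))%:C%C *: eta.

Definition pmapC (p : R) (F : 'M[R[i]]_(N, n)) : 'M[R[i]]_(N, n) :=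
  (frobC F `^ (p - 2))%:C%C *: F.

End norms.

(* For y = z = 0 all three terms are 0, also when mu = 0 and p < 2, since the
   power is multiplied by |y - z|^2. *)
Definition V_bounds (R : realType) (N n : nat) (p mu c1 c2 : R) : Prop :=
  forall y z : 'M[R]_((2 * N)%N, n),
    let W := (mu ^+ 2 + frob y ^+ 2 + frob z ^+ 2) `^ ((p - 2) / 2)
             * frob (y - z) ^+ 2 in
    c1 * W <= mxdot (Vmap p mu y - Vmap p mu z) (y - z) <= c2 * W.

Section sobolev.
Context (R : realType) (n : nat) (Omega : set 'rV[R]_n).
Local Notation leb := (@lebesgue_rV R n).

(* Lebesgue measurability on Omega: equality a.e. with a Borel function. *)
Definition ae_measurable (f : 'rV[R]_n -> R) : Prop :=
  exists2 g : 'rV[R]_n -> R,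
    measurable_fun Omega g & ae_eq leb Omega f g.

Definition ae_measurableC (f : 'rV[R]_n -> R[i]) : Prop :=
  ae_measurable (fun x => complex.Re (f x)) /\
  ae_measurable (fun x => complex.Im (f x)).

Definition integralC (f : 'rV[R]_n -> R[i]) : R[i] :=
  ((\int[leb]_(x in Omega) complex.Re (f x))%R
    +i* (\int[leb]_(x in Omega) complex.Im (f x))%R)%C.

Definition LnormC (p : R) (N m : nat) (f : 'rV[R]_n -> 'M[R[i]]_(N, m)) : \bar R :=
  ('N[leb]_(p%:E)[(fun x => (frobC (f x))%:E) \_ Omega])%E.

Definition in_Lp (p : R) (N m : nat) (f : 'rV[R]_n -> 'M[R[i]]_(N, m)) : Prop :=
  (forall k j, ae_measurableC (fun x => f x k j)) /\ (LnormC p f < +oo)%E.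

Definition partial (j : 'I_n) (f : 'rV[R]_n -> R^o) : 'rV[R]_n -> R^o :=
  fun x => 'D_(delta_mx ord0 j) f x.

(* C^oo: all iterated partial derivatives exist and are continuous. *)
Definition smooth (f : 'rV[R]_n -> R^o) : Prop :=
  forall s : seq 'I_n, let g := foldr partial f s in
    continuous g /\ forall j x, derivable g x (delta_mx ord0 j).

Definition test_fun (f : 'rV[R]_n -> R^o) : Prop :=
  let supp := closure [set x | f x != 0] in
  [/\ smooth f, compact supp & supp `<=` Omega].

Definition test_funC (N : nat) (psi : 'rV[R]_n -> 'cV[R[i]]_N) : Prop :=
  forall k, test_fun (fun x => complex.Re (psi x k ord0)) /\
            test_fun (fun x => complex.Im (psi x k ord0)).

Definition jacobianC (N : nat) (psi : 'rV[R]_n -> 'cV[R[i]]_N)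
    (x : 'rV[R]_n) : 'M[R[i]]_(N, n) :=
  \matrix_(k < N, j < n)
    (partial j (fun x => complex.Re (psi x k ord0)) x
     +i* partial j (fun x => complex.Im (psi x k ord0)) x)%C.

Definition weak_jacobian (N : nat) (u : 'rV[R]_n -> 'cV[R[i]]_N)
    (Du : 'rV[R]_n -> 'M[R[i]]_(N, n)) : Prop :=
  forall (k : 'I_N) (j : 'I_n) (phi : 'rV[R]_n -> R^o), test_fun phi ->
    integralC (fun x => u x k ord0 * (partial j phi x)%:C%C) =
    - integralC (fun x => Du x k j * (phi x)%:C%C).

(* u is in W^(1,p)(Omega; C^N), with weak Jacobian Du (unique up to null
   sets).  The L^p conditions also make the integrals in weak_jacobian
   converge. *)
Definition in_W1p (p : R) (N : nat) (u : 'rV[R]_n -> 'cV[R[i]]_N)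
    (Du : 'rV[R]_n -> 'M[R[i]]_(N, n)) : Prop :=
  [/\ in_Lp p u, in_Lp p Du & weak_jacobian u Du].

Definition W1p_norm (p : R) (N : nat) (u : 'rV[R]_n -> 'cV[R[i]]_N)
    (Du : 'rV[R]_n -> 'M[R[i]]_(N, n)) : \bar R :=
  (LnormC p u + LnormC p Du)%E.

(* The closure of C_0^oo(Omega; C^N) in W^(1,p)(Omega; C^N). *)
Definition in_W1p0 (p : R) (N : nat) (u : 'rV[R]_n -> 'cV[R[i]]_N)
    (Du : 'rV[R]_n -> 'M[R[i]]_(N, n)) : Prop :=
  in_W1p p u Du /\
  forall e : R, 0 < e -> exists2 psi, test_funC psi &
    (W1p_norm p (fun x => u x - psi x)%R (fun x => Du x - jacobianC psi x)%R
      < e%:E)%E.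

Definition weak_solution (p mu : R) (N : nat) (a : 'rV[R]_n -> R[i])
    (F : 'rV[R]_n -> 'M[R[i]]_(N, n)) (u : 'rV[R]_n -> 'cV[R[i]]_N) : Prop :=
  exists2 Du, in_W1p0 p u Du &
    forall phi Dphi, in_W1p0 p phi Dphi ->
      integralC (fun x => a x * mxdotC (VmapC p mu (Du x)) (Dphi x)) =
      integralC (fun x => mxdotC (pmapC p (F x)) (Dphi x)).

End sobolev.

(* Main.v *)
Require Import Defs.
From mathcomp Require Import all_boot all_order all_algebra.
From mathcomp Require Import all_classical all_reals all_analysis.
From mathcomp Require Import measurable_realfun.
From mathcomp Require Import complex ring lra.
Import Order.TTheory GRing.Theory Num.Theory.
Import numFieldNormedType.Exports.
Local Open Scope classical_set_scope.
Local Open Scope ring_scope.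

Set Implicit Arguments.
Unset Strict Implicit.
Unset Printing Implicit Defensive.

(* The real part of [<V y - V z, y - z>] on complex matrices is affine in
   [Re <y, z>] once [|y|] and [|z|] are fixed, so the two-sided bound for real
   matrices, applied to collinear ones, gives the same lower bound on
   [Re <V y - V z, y - z>] and the Lipschitz bound [|V y - V z| <= c2 w |y - z|],
   [w] being the common weight.  Hence
   [|Im <V y - V z, y - z>| <= sqrt ((c2 / c1)^2 - 1) Re <V y - V z, y - z>], and
   the condition on [a] is exactly what makes
   [Re (a <V y - V z, y - z>) >= gamma0 c1 w |y - z|^2]: the operator is monotone
   and coercive on W^(1,p)_0, viewed as a real vector space.

   Existence is Browder-Minty without weak compactness.  Finitely many Minty
   inequalities are solved by the value of a skew-symmetric game; the sets of
   solutions in a sublevel set of the uniformly convex energy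
   [Psi u = 1/p \int (mu^2 + |Du|^2)^(p/2)] are convex and have the finite
   intersection property, and near-minimisers of [Psi] along a suitable decreasing
   sequence of them are Cauchy in L^p.  Completeness of L^p (Fatou) and the
   Poincare inequality turn this into convergence in W^(1,p)_0.  Uniqueness
   follows from strict monotonicity and the Poincare inequality. *)

(** The energy [Psi] is chosen because its differential is the pairing with coefficient 1. The
    sector estimate thus serves twice: with [a] for the operator, and with the constant 1 for the
    uniform convexity of [Psi].

    The obstacle is the weight [w]. For [p < 2] it decays as its arguments grow, so [w |y - z|^2]
    does not dominate [|y - z|^p]. It does so only up to an arbitrarily small multiple of the
    energies of [y] and [z], and therefore convexity is uniform on sublevel sets of [Psi] only. The
    pointwise inequality behind this distinguishes differences that are small against the arguments
    from comparable ones; it treats all [p > 1] together.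

    Minty's form [B y (y - x) >= 0] is affine in the unknown [x]. For finitely many [y_i] and [x] a
    convex combination of them, it is a statement about the matrix [B y_i (y_i - y_j)], whose
    symmetric part is nonnegative by monotonicity; this is where games enter.

    The coercivity bound on [Psi] is strict, so the solution found in a sublevel set does not feel
    the constraint and solves an equation. *)

Local Notation Re := complex.Re.
Local Notation Im := complex.Im.
Local Notation normc := Normc.normc.

(** * Monotone games and the Browder-Minty theorem *)

Section symmetric_game.
Context (R : realType).

Definition negpart (x : R) : R := Num.max (- x) 0.

Lemma negpart_ge0 x : 0 <= negpart x.
Proof. by rewrite /negpart le_max lexx orbT. Qed.

Lemma negpart_geN x : - negpart x <= x.
Proof. by rewrite lerNl /negpart le_max lexx. Qed.

(** Since [x >= - negpart x], the sum [x + y] is at least [- (negpart x - y)]. The bound replaces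
    the defect after a move by a quadratic expression that can be expanded. *)
Lemma negpart_shift x y : negpart (x + y) ^+ 2 <= (negpart x - y) ^+ 2.
Proof. by rewrite /negpart; case: (leP (- x) 0); case: (leP (- (x + y)) 0); nra. Qed.

Lemma negpartZ t x : 0 <= t -> negpart (t * x) = t * negpart x.
Proof.
move=> t0; rewrite /negpart -mulrN; case: (leP (- x) 0) => h.
  by rewrite max_r ?mulr0//; nra.
by rewrite max_l//; nra.
Qed.

Definition simplex (m : nat) (l : 'I_m -> R) : Prop :=
  (forall i, 0 <= l i) /\ \sum_i l i = 1.

(* Moving from [l] towards the normalised defect [r_i = (S l)_i^-] decreases
   the sum of squares of the defects, because [r^T S r = 0]. *)
Lemma symmetric_game (m : nat) (S : 'I_m.+1 -> 'I_m.+1 -> R) (e : R) :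
  (forall i j, S i j = - S j i) -> 0 < e ->
  exists2 l, simplex l & forall i, - e <= \sum_j S i j * l j.
Proof.
move=> skew e0.
pose Sl (l : 'I_m.+1 -> R) i := \sum_j S i j * l j.
pose f l := \sum_i negpart (Sl l i) ^+ 2.
pose A := [set y | exists2 l, simplex l & y = f l].
have f0 l : 0 <= f l by apply: sumr_ge0 => i _; exact: sqr_ge0.
have A0 : A !=set0.
  exists (f (fun i => (i == ord0)%:R)); exists (fun i => (i == ord0)%:R) => //.
  split; first by move=> i; rewrite ler0n.
  by rewrite -natr_sum -big_mkcond/= big_pred1_eq.
have hA : has_lbound A by exists 0 => _ [l _ ->].
suff iA : inf A < e ^+ 2.
  have [_ [l sl ->] fl] := inf_lt A0 iA.
  exists l => // i; apply: le_trans (negpart_geN _).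
  rewrite lerN2 -(@ler_pXn2r _ 2) ?nnegrE ?negpart_ge0 ?(ltW e0)//.
  apply: le_trans (ltW fl); rewrite /f [leRHS](bigD1 i)//= lerDl.
  by apply: sumr_ge0 => j _; exact: sqr_ge0.
rewrite ltNge; apply/negP => eA.
have i0 : 0 < inf A by apply: lt_le_trans eA; rewrite exprn_gt0.
(* [C] bounds the sum of squares of [S mu] for every [mu] in the simplex; the summand [inf A + 1]
   ensures [inf A < C], so that the next threshold is meaningful. *)
pose C := \sum_i (\sum_j `|S i j|) ^+ 2 + inf A + 1.
have Ci : inf A < C.
  rewrite /C -addrA addrC -addrA ltrDl ltr_wpDr//.
  by apply: sumr_ge0 => i _; exact: sqr_ge0.
(* For [F = f l] this threshold is equivalent to [F * C / (F + C) < inf A], which the improved point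
   will contradict. *)
have [_ [l [l0 l1] ->] fl] : exists2 y, A y & y < inf A * C / (C - inf A).
  by apply: inf_lt => //; rewrite ltr_pdivlMr ?subr_gt0//; nra.
set F := f l in fl.
pose r i := negpart (Sl l i).
have F0 : 0 < F by apply: lt_le_trans (i0) _; apply: ge_inf => //; exists l.
have r0 i : 0 <= r i by exact: negpart_ge0.
have rho0 : 0 < \sum_i r i.
  rewrite lt_neqAle sumr_ge0 ?andbT//; apply/eqP => /esym/eqP.
  rewrite psumr_eq0// => /allP rz; move: F0; rewrite /F /f big1 ?ltxx// => i _.
  by have /eqP := rz i (mem_index_enum _); rewrite /r => ->; rewrite expr0n.
pose mu i := r i / \sum_i r i.
have mu0 i : 0 <= mu i by rewrite divr_ge0// ltW.
have mu1 : \sum_i mu i = 1 by rewrite -mulr_suml divff// gt_eqF.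
have rSmu : \sum_i r i * Sl mu i = 0.
  have -> : \sum_i r i * Sl mu i =
      (\sum_i \sum_j r i * S i j * r j) / \sum_i r i.
    rewrite mulr_suml; apply: eq_bigr => i _; rewrite mulr_sumr mulr_suml.
    by apply: eq_bigr => j _; rewrite /mu; ring.
  set X := \sum_i \sum_j _; suff -> : X = 0 by rewrite mul0r.
  have : X = - X.
    rewrite {1}/X exchange_big/= -sumrN; apply: eq_bigr => i _.
    by rewrite -sumrN; apply: eq_bigr => j _; rewrite skew; ring.
  lra.
have SmuC : \sum_i Sl mu i ^+ 2 <= C.
  rewrite /C -addrA ler_wpDr ?addr_ge0// ?(ltW i0)//.
  apply: ler_sum => i _; rewrite -(real_normK (num_real (Sl mu i))).
  rewrite lerXn2r ?nnegrE ?sumr_ge0//.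
  apply: le_trans (ler_norm_sum _ _ _) _; apply: ler_sum => j _.
  rewrite normrM ler_piMr// ger0_norm//.
  by rewrite -mu1 (bigD1 j)//= lerDl sumr_ge0.
(* This [t] minimises [(1 - t)^2 * F + t^2 * C]; the minimum is [F * C / (F + C)]. *)
pose t := F / (F + C).
have C0 : 0 < C by apply: lt_trans Ci.
have FC0 : 0 < F + C by rewrite addr_gt0.
have t0 : 0 <= t by rewrite divr_ge0// ltW.
have t1 : 0 <= 1 - t by rewrite subr_ge0 ler_pdivrMr// mul1r lerDl ltW.
pose l' i := (1 - t) * l i + t * mu i.
have Al' : A (f l').
  exists l' => //; split; first by move=> i; rewrite addr_ge0// mulr_ge0.
  by rewrite big_split/= -!mulr_sumr l1 mu1; ring.
have Sl' i : Sl l' i = (1 - t) * Sl l i + t * Sl mu i.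
  rewrite /Sl !mulr_sumr -big_split/=; apply: eq_bigr => j _.
  by rewrite /l'; ring.
have fl' : f l' <= (1 - t) ^+ 2 * F + t ^+ 2 * C.
  apply: (@le_trans _ _ (\sum_i ((1 - t) * r i - t * Sl mu i) ^+ 2)).
    apply: ler_sum => i _; rewrite Sl'; apply: le_trans (negpart_shift _ _) _.
    by rewrite negpartZ.
  have -> : \sum_i ((1 - t) * r i - t * Sl mu i) ^+ 2 =
      (1 - t) ^+ 2 * F + t ^+ 2 * \sum_i Sl mu i ^+ 2
      - 2 * t * (1 - t) * \sum_i r i * Sl mu i.
    rewrite /F /f !mulr_sumr -sumrN -!big_split/=; apply: eq_bigr => i _.
    by rewrite /r; ring.
  by rewrite rSmu mulr0 subr0 lerD2l ler_wpM2l ?sqr_ge0.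
have : inf A <= F * C / (F + C).
  have -> : F * C / (F + C) = (1 - t) ^+ 2 * F + t ^+ 2 * C.
    by rewrite /t; field; rewrite gt_eqF.
  by apply: le_trans fl'; exact: ge_inf.
move: fl; rewrite ltr_pdivlMr ?subr_gt0// ler_pdivlMr//; nra.
Qed.

(** Entrywise [M i j] dominates [(M i j - M j i) / 2], and weights are nonnegative, so a nearly
    optimal strategy for the skew part also works for [M]. *)
Lemma monotone_game (m : nat) (M : 'I_m.+1 -> 'I_m.+1 -> R) (e : R) :
  (forall i j, 0 <= M i j + M j i) -> 0 < e ->
  exists2 l, simplex l & forall i, - e <= \sum_j M i j * l j.
Proof.
move=> M0 e0.
have [|l sl Sl] := @symmetric_game m (fun i j => (M i j - M j i) / 2) e _ e0.
  by move=> i j; rewrite -mulNr opprB.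
exists l => // i; apply: le_trans (Sl i) _; apply: ler_sum => j _.
by rewrite ler_wpM2r ?(sl.1)//; have := M0 i j; lra.
Qed.

End symmetric_game.

(** * Real-linear functionals on a complex vector space *)

Section real_scaling.
Context (R : realType) (E : lmodType R[i]).

(** The functionals of the abstract theorem are real parts, hence only real-linear, while the space
    of functions is a module over [R[i]]. *)
Definition rscale (t : R) (x : E) : E := t%:C%C *: x.
Local Notation "t *r x" := (rscale t x) (at level 40).

Lemma rscaleDr t x y : t *r (x + y) = t *r x + t *r y.
Proof. exact: scalerDr. Qed.

Lemma rscaleDl s t x : (s + t) *r x = s *r x + t *r x.
Proof. by rewrite /rscale rmorphD scalerDl. Qed.

Lemma rscaleA s t x : s *r (t *r x) = (s * t) *r x.
Proof. by rewrite /rscale scalerA rmorphM. Qed.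

Lemma rscale1 x : 1 *r x = x.
Proof. by rewrite /rscale rmorph1 scale1r. Qed.

Lemma rscale0 x : 0 *r x = 0.
Proof. by rewrite /rscale rmorph0 scale0r. Qed.

Lemma rscaleN1 x : (-1) *r x = - x.
Proof. by rewrite /rscale rmorphN rmorph1 scaleN1r. Qed.

Lemma rscaleN t x : t *r (- x) = - (t *r x).
Proof. exact: scalerN. Qed.

Lemma rscaleNl t x : (- t) *r x = - (t *r x).
Proof. by rewrite /rscale rmorphN scaleNr. Qed.

Lemma rscale_nat (n : nat) x : n%:R *r x = x *+ n.
Proof. by rewrite /rscale rmorph_nat scaler_nat. Qed.

End real_scaling.
Notation "t *r x" := (rscale t x) (at level 40).

Section real_linear_on.
Context (R : realType) (E : lmodType R[i]).

Definition real_subspace (X : set E) : Prop :=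
  [/\ X 0, forall x y, X x -> X y -> X (x + y) &
      forall t x, X x -> X (t *r x)].

(** Linearity is relative to [X] because [E] will consist of arbitrary functions, and integrals are
    additive only on the integrable ones. *)
Definition linear_on (X : set E) (f : E -> R) : Prop :=
  (forall x y, X x -> X y -> f (x + y) = f x + f y) /\
  (forall t x, X x -> f (t *r x) = t * f x).

Definition continuous_at0 (X : set E) (rho f : E -> R) : Prop :=
  forall e, 0 < e ->
    exists2 d, 0 < d & forall z, X z -> rho z < d -> `|f z| < e.

Context (X : set E) (sX : real_subspace X).

Lemma subspace0 : X 0. Proof. by case: sX. Qed.
Lemma subspaceD x y : X x -> X y -> X (x + y).
Proof. by case: sX => _ + _; apply. Qed.
Lemma subspaceZ t x : X x -> X (t *r x).
Proof. by case: sX => _ _; apply. Qed.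
Lemma subspaceN x : X x -> X (- x).
Proof. by rewrite -rscaleN1; exact: subspaceZ. Qed.
Lemma subspaceB x y : X x -> X y -> X (x - y).
Proof. by move=> Xx Xy; apply/subspaceD => //; exact: subspaceN. Qed.
Lemma subspace_sum (I : Type) (s : seq I) (x : I -> E) :
  (forall i, X (x i)) -> X (\sum_(i <- s) x i).
Proof. by move=> Xx; elim/big_ind: _ => //; [exact: subspace0|exact: subspaceD]. Qed.

Context (f : E -> R) (lf : linear_on X f).

Lemma linear_on0 : f 0 = 0.
Proof. by rewrite -(rscale0 (0 : E)) (lf.2 _ _ subspace0) mul0r. Qed.
Lemma linear_onN x : X x -> f (- x) = - f x.
Proof. by move=> Xx; rewrite -rscaleN1 lf.2// mulN1r. Qed.
Lemma linear_onB x y : X x -> X y -> f (x - y) = f x - f y.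
Proof. by move=> Xx Xy; rewrite lf.1 ?linear_onN//; exact: subspaceN. Qed.
Lemma linear_on_sum (I : Type) (s : seq I) (x : I -> E) :
  (forall i, X (x i)) -> f (\sum_(i <- s) x i) = \sum_(i <- s) f (x i).
Proof.
move=> Xx; elim: s => [|i s IH]; first by rewrite !big_nil linear_on0.
by rewrite !big_cons lf.1 ?IH//; exact: subspace_sum.
Qed.

End real_linear_on.

(* [rho] stands for the p-th power of a norm, [G x] for the differential at [x] of
   the convex function [Psi], and [eps] for a rate fast enough that sequences
   which are [rho]-Cauchy at this rate converge. *)
Section browder_minty.
Context (R : realType) (E : lmodType R[i]) (X : set E) (B G : E -> E -> R).
Context (rho Psi : E -> R) (eps : nat -> R).

Hypothesis sX : real_subspace X.
Hypothesis Blin : forall x, X x -> linear_on X (B x).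
Hypothesis Bcont : forall x, X x -> continuous_at0 X rho (B x).
Hypothesis Bmono : forall x y, X x -> X y -> 0 <= B x (x - y) - B y (x - y).
Hypothesis Bhemi : forall x z, X x -> X z -> forall e, 0 < e ->
  exists2 d, 0 < d & forall t, 0 < t -> t < d ->
    `|B (x + t *r z) z - B x z| < e.
Hypothesis Bcoercive :
  exists M0, forall x, X x -> B x x <= 0 -> Psi x < M0.
Hypothesis Psi_ge0 : forall x, X x -> 0 <= Psi x.
Hypothesis Glin : forall x, X x -> linear_on X (G x).
Hypothesis Gcont : forall x, X x -> continuous_at0 X rho (G x).
Hypothesis Ggrad : forall x y, X x -> X y -> Psi x + G x (y - x) <= Psi y.
Hypothesis Gmono : forall M e, 0 < e -> exists2 d, 0 < d &
  forall x y, X x -> X y -> Psi x <= M -> Psi y <= M ->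
    G x (x - y) - G y (x - y) < d -> rho (2 *r (x - y)) < e.
Hypothesis eps_gt0 : forall k, 0 < eps k.
Hypothesis eps_cvg0 : forall e, 0 < e ->
  exists k0, forall k, (k0 <= k)%N -> eps k < e.
Hypothesis complete : forall x_ : nat -> E, (forall k, X (x_ k)) ->
  (forall k m, (k <= m)%N -> rho (x_ k - x_ m) < eps k) ->
  exists2 x, X x & forall e, 0 < e ->
    exists k0, forall k, (k0 <= k)%N -> rho (x_ k - x) < e.

(** Average the tangent inequalities at the barycentre [y]: the first-order terms cancel because the
    weighted sum of [x i - y] is 0. *)
Lemma psi_jensen (m : nat) (l : 'I_m -> R) (x : 'I_m -> E) :
  simplex l -> (forall i, X (x i)) ->
  Psi (\sum_i l i *r x i) <= \sum_i l i * Psi (x i).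
Proof.
move=> [l0 l1] Xx; set y := \sum_i _.
have Xlx i : X (l i *r x i) by exact: subspaceZ.
have Xy : X y by exact: subspace_sum.
rewrite -[Psi y]addr0 -[X in _ + X](_ : \sum_i l i * G y (x i - y) = 0).
  rewrite -[Psi y]mul1r -l1 mulr_suml -big_split/=; apply: ler_sum => i _.
  by rewrite -mulrDr ler_wpM2l// Ggrad.
transitivity (G y (\sum_i l i *r (x i - y))).
  rewrite (linear_on_sum sX (Glin Xy)); last first.
    by move=> i; apply: subspaceZ => //; exact: subspaceB.
  by apply: eq_bigr => i _; rewrite (Glin Xy).2//; exact: subspaceB.
rewrite (_ : \sum_i _ = 0); first exact: (linear_on0 sX (Glin Xy)).
under eq_bigr do rewrite rscaleDr rscaleN.
rewrite big_split/= sumrN -/y.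
suff -> : \sum_i l i *r y = y by rewrite subrr.
by rewrite /rscale -scaler_suml -(rmorph_sum (real_complex R)) l1/= scale1r.
Qed.

Lemma psi_convex t x y : 0 <= t <= 1 -> X x -> X y ->
  Psi ((1 - t) *r x + t *r y) <= (1 - t) * Psi x + t * Psi y.
Proof.
move=> /andP[t0 t1] Xx Xy.
have := @psi_jensen 2 (fun i => if i == ord0 then 1 - t else t)
  (fun i => if i == ord0 then x else y).
rewrite !big_ord_recl !big_ord0/= !addr0; apply; last by move=> i; case: ifP.
split; last by rewrite !big_ord_recl big_ord0/=; ring.
by move=> i; case: ifP; rewrite ?subr_ge0.
Qed.

(* Convexity at the quarter points of [x, y] bounds the monotonicity gap of the
   gradient [G] by the midpoint convexity gap of [Psi]. *)
Lemma psi_uniformly_convex M e : 0 < e -> exists2 d, 0 < d &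
  forall x y, X x -> X y -> Psi x <= M -> Psi y <= M ->
    Psi x + Psi y - 2 * Psi (2^-1 *r x + 2^-1 *r y) < d -> rho (x - y) < e.
Proof.
move=> /(Gmono M)[d d0 Gd]; exists (d / 2); first by rewrite divr_gt0.
move=> x y Xx Xy Mx My gap.
pose k := 4^-1 *r (x - y).
have Xk : X k by apply: subspaceZ => //; exact: subspaceB.
have k4 : x = y + k *+ 4.
  by rewrite -rscale_nat rscaleA divff// rscale1 addrC subrK.
pose w := x - k; pose w' := y + k; pose m := y + k *+ 2.
have Xw : X w by exact: subspaceB.
have Xw' : X w' by exact: subspaceD.
have Xm : X m by apply: subspaceD; rewrite // -rscale_nat; exact: subspaceZ.
have wm : w = m + k by rewrite /w k4 /m mulrSr addrA addrK mulrSr addrA.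
have w'm : w' = m - k by rewrite /m mulrSr mulr1n addrA addrK.
have ww : w - w' = k *+ 2.
  by rewrite wm w'm opprB [k - m]addrC addrACA subrr add0r mulr2n.
have mE : 2^-1 *r x + 2^-1 *r y = m.
  rewrite k4 rscaleDr addrAC -rscaleDl.
  rewrite [X in X *r y](_ : _ = 1); last by lra.
  by rewrite rscale1 -rscale_nat rscaleA [X in X *r k](_ : _ = 2) ?rscale_nat//; lra.
(* In the sum of [h1] to [h4] the values at [w] and [w'] and the terms [G m k] cancel, so the
   midpoint gap bounds [G w k - G w' k]. As [w - w'] is [2 k], a gap below [d / 2] puts the
   monotonicity gap below [d]. *)
have h1 := Ggrad Xw Xx; rewrite (_ : x - w = k) in h1; last first.
  by rewrite /w opprB addrC subrK.
have h2 := Ggrad Xm Xw; rewrite (_ : w - m = k) in h2; last first.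
  by rewrite wm addrAC subrr add0r.
have h3 := Ggrad Xw' Xy; rewrite (_ : y - w' = - k) in h3; last first.
  by rewrite /w' opprD addrA subrr add0r.
have h4 := Ggrad Xm Xw'; rewrite (_ : w' - m = - k) in h4; last first.
  by rewrite w'm addrAC subrr add0r.
rewrite (linear_onN (Glin Xw')) // in h3.
rewrite (linear_onN (Glin Xm)) // in h4.
rewrite mE in gap.
have -> : x - y = 2 *r (w - w').
  by rewrite ww rscale_nat -mulrnA k4 addrAC subrr add0r.
apply: Gd => //.
- have -> : w = (1 - 4^-1) *r x + 4^-1 *r y.
    by rewrite /w /k rscaleDl rscale1 rscaleNl rscaleDr rscaleN opprD opprK addrA.
  apply: le_trans (psi_convex _ _ _) _ => //; lra.
- have -> : w' = (1 - 4^-1) *r y + 4^-1 *r x.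
    rewrite /w' /k rscaleDl rscale1 rscaleNl rscaleDr rscaleN -[RHS]addrA.
    by congr (y + _); rewrite addrC.
  apply: le_trans (psi_convex _ _ _) _ => //; lra.
rewrite ww -rscale_nat (Glin Xw).2// (Glin Xw').2//; lra.
Qed.

Section bounded_level.
Context (M0 : R).
Hypothesis Bcoercive_M0 : forall x, X x -> B x x <= 0 -> Psi x < M0.

Let K x := X x /\ Psi x <= M0.

Let K0 : K 0.
Proof.
have X0 := subspace0 sX; split => //; apply/ltW/Bcoercive_M0 => //.
by rewrite (linear_on0 sX (Blin X0)).
Qed.

(** Finitely many Minty inequalities, relaxed by [1 / (n + 1)] because the game is solved only up to
    a positive error. *)
Let KS (n : nat) (S : seq E) x :=
  K x /\ forall y, y \in S -> - n.+1%:R^-1 <= B y (y - x).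

(** The solution is the barycentre of the points of [S] under a nearly optimal strategy for the
    payoff [B x_i (x_i - x_j)]. Adjoining 0 keeps the family nonempty, and convexity of [Psi] keeps
    the barycentre in the sublevel set. *)
Let KS_nonempty n S : {in S, forall y, K y} -> exists x, KS n S x.
Proof.
move=> SK; pose x i := nth 0 (0 :: S) i.
have Kx (i : 'I_(size S).+1) : K (x i).
  have : x i \in 0 :: S by apply: mem_nth.
  by rewrite inE => /orP[/eqP ->|/SK].
have Xx (i : 'I_(size S).+1) : X (x i) by case: (Kx i).
have [i j||l sl Ml] := @monotone_game R (size S)
    (fun i j => B (x i) (x i - x j)) n.+1%:R^-1.
- have := Bmono (Xx i) (Xx j); rewrite -[x j - x i]opprB.
  by rewrite (linear_onN (Blin (Xx j)))//; exact: subspaceB.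
- by rewrite invr_gt0.
pose z := \sum_(i < (size S).+1) l i *r x i.
have Xz : X z by apply: subspace_sum => // i; exact: subspaceZ.
exists z; split.
  split=> //; apply: le_trans (psi_jensen sl Xx) _.
  rewrite -[leRHS]mul1r -sl.2 mulr_suml; apply: ler_sum => i _.
  by rewrite ler_wpM2l ?sl.1//; case: (Kx i).
move=> y yS.
have [i yi] : exists i : 'I_(size S).+1, y = x i.
  have iS : ((index y S).+1 < (size S).+1)%N by rewrite ltnS index_mem.
  by exists (Ordinal iS); rewrite /x /= nth_index.
rewrite yi; apply: le_trans (Ml i) _; rewrite le_eqVlt; apply/orP; left.
have Xd (j : 'I_(size S).+1) : X (x i - x j) by exact: subspaceB.
rewrite -[X in _ == B _ X](_ : \sum_(j < (size S).+1) l j *r (x i - x j) = x i - z).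
  rewrite (linear_on_sum sX (Blin (Xx i))); last first.
    by move=> j; exact: subspaceZ.
  by apply/eqP/eq_bigr => j _; rewrite (Blin (Xx i)).2// mulrC.
under eq_bigr do rewrite rscaleDr rscaleN.
rewrite big_split/= sumrN; congr (_ - _).
by rewrite /rscale -scaler_suml -(rmorph_sum (real_complex R)) sl.2/= scale1r.
Qed.

(** For a fixed [z] the expression [B z (z - x)] is affine in [x]; the form [B x (z - x)] would not
    give a convex set. *)
Let KS_convex n S x y : {in S, forall y, K y} -> KS n S x -> KS n S y ->
  KS n S (2^-1 *r x + 2^-1 *r y).
Proof.
move=> SK [[Xx Mx] Sx] [[Xy My] Sy].
have h : 2^-1 *r x + 2^-1 *r y = (1 - 2^-1) *r x + 2^-1 *r y.
  by congr (_ *r _ + _); lra.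
split; first split.
- by apply: subspaceD => //; apply: subspaceZ.
- by rewrite h; apply: le_trans (psi_convex _ _ _) _ => //; lra.
move=> z zS; have [Xz _] := SK _ zS.
rewrite [X in B _ X](_ : _ = 2^-1 *r (z - x) + 2^-1 *r (z - y)); last first.
  rewrite !rscaleDr !rscaleN opprD addrACA; congr (_ + _).
  by rewrite -rscaleDl (_ : _ + _ = 1 :> R) ?rscale1//; lra.
have Xzx : X (z - x) by exact: subspaceB.
have Xzy : X (z - y) by exact: subspaceB.
rewrite (Blin Xz).1 ?(Blin Xz).2//; [|exact: subspaceZ..].
have := Sx _ zS; have := Sy _ zS; set c := n.+1%:R^-1; lra.
Qed.

(* The sets [KS n S] are convex with the finite intersection property; the
   near-minimisers of [Psi] along an increasing sequence of them are Cauchy by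
   uniform convexity. *)
Lemma minty_variational_solution :
  exists2 x, K x & forall y, K y -> 0 <= B y (y - x).
Proof.
(* [sup D] is the supremum, over all finite relaxed systems, of the infimum of [Psi] on their
   solutions; [nS k] below is a system that attains it up to [dl k / 4]. *)
pose D := [set d | exists n S, {in S, forall y, K y} /\
                   forall x, KS n S x -> d <= Psi x].
have D0 : D !=set0.
  by exists 0, 0%N, [::]; split => // x [[Xx _] _]; exact: Psi_ge0.
have bD : has_ubound D.
  exists M0 => d [n [S [SK dS]]]; have [x Sx] := KS_nonempty n SK.
  by apply: le_trans (dS _ Sx) _; case: Sx => -[].
have /choice[dl dlP] : forall k, exists d, 0 < d /\
    forall x y, X x -> X y -> Psi x <= M0 -> Psi y <= M0 ->
    Psi x + Psi y - 2 * Psi (2^-1 *r x + 2^-1 *r y) < d -> rho (x - y) < eps k.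
  move=> k; have [d d0 Hd] := psi_uniformly_convex M0 (eps_gt0 k).
  by exists d.
have /choice[nS nSP] : forall k, exists nS : nat * seq E,
    {in nS.2, forall y, K y} /\
    forall x, KS nS.1 nS.2 x -> sup D - dl k / 4 < Psi x.
  move=> k; have [dl0 _] := dlP k.
  have [d [n [S [SK dS]]] hd] : exists2 d, D d & sup D - dl k / 4 < d.
    by apply: sup_adherent; [rewrite divr_gt0|split].
  by exists (n, S); split => // x /dS; apply: lt_le_trans.
have near n S e : 0 < e -> {in S, forall y, K y} ->
    exists x, KS n S x /\ Psi x < sup D + e.
  move=> e0 SK; apply: contrapT => /forallNP H.
  suff : sup D + e <= sup D by rewrite gerDl leNgt e0.
  apply: ub_le_sup => //; exists n, S; split => // x Sx.
  by rewrite leNgt; apply/negP => xd; apply: (H x).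
(* The systems up to index [k] are accumulated, so that the solution sets decrease with [k]; [em k]
   is the smallest of their tolerances. *)
pose T k := flatten [seq (nS j).2 | j <- iota 0 k.+1].
pose M k := (\max_(j < k.+1) (nS j).1)%N.
pose em k := \big[Order.min/1]_(j < k.+1) (dl j / 4).
have em0 k : 0 < em k.
  by apply/lt_bigmin => // i _; rewrite divr_gt0//; case: (dlP i).
have em_le k m : (k <= m)%N -> em m <= dl k / 4.
  move=> km.
  exact: (bigmin_le 1 (Ordinal (km : (k < m.+1)%N)) (fun j : 'I_m.+1 => dl j / 4)).
have TK k : {in T k, forall y, K y}.
  by move=> y /flattenP[s /mapP[j _ ->]]; exact: (nSP j).1.
have KSsub n S n' S' x : (n' <= n)%N -> {subset S' <= S} -> KS n S x ->
    KS n' S' x.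
  move=> nn SS [Kx Sx]; split => // y /SS/Sx; apply: le_trans.
  by rewrite lerN2 lef_pV2 ?posrE// ler_nat.
have KST n S k m x : (k <= m)%N -> (M m <= n)%N -> {subset T m <= S} ->
    KS n S x -> KS (nS k).1 (nS k).2 x.
  move=> km Mn TS; apply: KSsub.
    by apply: leq_trans Mn; exact: (@leq_bigmax _ (fun j : 'I_m.+1 => (nS j).1)
      (Ordinal (km : (k < m.+1)%N))).
  move=> y yS; apply: TS; apply/flattenP; exists (nS k).2 => //.
  by apply/mapP; exists k => //; rewrite mem_iota.
(* Both points solve the system [nS k], hence so does their midpoint, where [Psi] exceeds
   [sup D - dl k / 4]. Both values are below [sup D + dl k / 4], so the convexity gap is less than
   [dl k]: this is the origin of the quarters. *)
have close n S m k x x' : (k <= m)%N -> (M m <= n)%N -> {subset T m <= S} ->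
    KS n S x' -> Psi x' < sup D + em m ->
    KS (M k) (T k) x -> Psi x < sup D + em k -> rho (x - x') < eps k.
  move=> km Mn TS Sx' px' Sx px; have [dl0 Hd] := dlP k.
  have em1 := em_le _ _ km; have em2 := em_le _ _ (leqnn k).
  case: (Sx) => -[Xx Mx] _; case: (Sx') => -[Xx' Mx'] _; apply: Hd => //.
  have kx : KS (nS k).1 (nS k).2 x by apply: (KST (M k) (T k) k k).
  have kx' := KST n S k m x' km Mn TS Sx'.
  have := (nSP k).2 _ (KS_convex (nSP k).1 kx kx'); lra.
have /choice[x_ x_P] k := near (M k) (T k) _ (em0 k) (TK k).
have Xx_ k : X (x_ k) by case: (x_P k) => -[[]].
have [k m km|x Xx xcvg] := complete Xx_.
  case: (x_P k) => Sk pk; case: (x_P m) => Sm pm.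
  exact: (close (M m) (T m) m k).
(* The tangent inequality at [x], with [G x] continuous at 0, gives the lower semicontinuity of
   [Psi] along the sequence. *)
have Kx : K x.
  split => //; apply/ler_addgt0Pr => e e0.
  have [d d0 Hd] := Gcont Xx e0; have [k0 xk0] := xcvg _ d0.
  have Xd : X (x_ k0 - x) by exact: subspaceB.
  have := Ggrad Xx (Xx_ k0); have := Hd _ Xd (xk0 _ (leqnn _)).
  have : Psi (x_ k0) <= M0 by case: (x_P k0) => -[[]].
  by rewrite ltr_norml => ? /andP[? ?]; lra.
exists x => // y Ky; have Xy := Ky.1.
apply/ler_addgt0Pr => e e0.
pose e' := e / 3; have e'0 : 0 < e' by rewrite divr_gt0.
have [n ne] : exists n : nat, n.+1%:R^-1 < e'.
  have := near_infty_natSinv_lt (PosNum e'0).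
  by move=> [k _ /(_ k (leqnn k))] /= ?; exists k.
have [d d0 Hd] := Bcont Xy e'0.
have [k1 Hk1] := xcvg _ d0; have [k2 Hk2] := eps_cvg0 d0.
pose k := maxn k1 k2.
(* An arbitrary [y] need not occur in any [T k]. Adding it to the system yields a near-minimiser
   [x'] that satisfies the inequality for [y] and lies close to [x_ k], so the inequality passes to
   [x]. *)
have [x' [Sx' px']] := near (maxn n (M k)) (y :: T k) _ (em0 k)
  (ltac:(by move=> z; rewrite inE => /orP[/eqP ->|/TK])).
have Xx' : X x' by case: Sx' => -[].
case: (x_P k) => Sk pk.
have c : rho (x_ k - x') < d.
  apply: lt_trans (Hk2 k _); last exact: leq_maxr.
  apply: (close (maxn n (M k)) (y :: T k) k k) => //; first exact: leq_maxr.
  by move=> z zT; rewrite inE zT orbT.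
have h1 := Hd _ (subspaceB sX (Xx_ k) Xx') c.
have h2 := Hd _ (subspaceB sX (Xx_ k) Xx) (Hk1 _ (leq_maxl _ _)).
have h3 : - n.+1%:R^-1 <= B y (y - x').
  apply: le_trans (Sx'.2 y (mem_head _ _)).
  by rewrite lerN2 lef_pV2 ?posrE// ler_nat ltnS leq_maxl.
move: h1 h2 h3; rewrite !(linear_onB sX (Blin Xy))// !ltr_norml.
move: ne; rewrite /e'; set c' := n.+1%:R^-1.
by move=> ? /andP[? ?] /andP[? ?] ?; lra.
Qed.

End bounded_level.

Lemma browder_minty : exists2 x, X x & forall z, X z -> B x z = 0.
Proof.
have [M0 coer] := Bcoercive.
have [x [Xx Mx] minty] := @minty_variational_solution M0 coer.
have X0 := subspace0 sX.
(* Minty's trick: test with [x + t (y - x)], which stays in the sublevel set by convexity, divide by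
   [t] and let [t] tend to 0. *)
have var y : X y -> Psi y <= M0 -> 0 <= B x (y - x).
  move=> Xy My; apply/ler_addgt0Pr => e e0.
  have Xyx : X (y - x) by exact: subspaceB.
  have [d d0 Hd] := Bhemi Xx Xyx e0.
  pose t := Num.min (d / 2) 1.
  have t0 : 0 < t by rewrite lt_min divr_gt0//=.
  have t1 : t <= 1 by rewrite ge_min lexx orbT.
  have td : t < d.
    by apply: (@le_lt_trans _ _ (d / 2)); [rewrite ge_min lexx|lra].
  have Xt : X (x + t *r (y - x)).
    by apply: subspaceD => //; exact: subspaceZ.
  have Mt : Psi (x + t *r (y - x)) <= M0.
    have -> : x + t *r (y - x) = (1 - t) *r x + t *r y.
      by rewrite rscaleDl rscale1 rscaleNl rscaleDr rscaleN -addrA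
        [X in _ = _ + X]addrC.
    apply: le_trans (psi_convex _ _ _) _ => //; first by rewrite (ltW t0).
    by nra.
  have := minty _ (conj Xt Mt); rewrite addrAC subrr add0r (Blin Xt).2//.
  rewrite pmulr_rge0//; have := Hd t t0 td; rewrite ltr_norml => /andP[_].
  by lra.
(* Testing with 0 gives [B x x <= 0], and coercivity turns this into the strict inequality. *)
have Px : Psi x < M0.
  apply: (coer x Xx); have := var 0 X0 _; rewrite add0r.
  rewrite (linear_onN (Blin Xx))// oppr_ge0; apply.
  by apply/ltW/coer => //; rewrite (linear_on0 sX (Blin X0)).
have ge0 z : X z -> 0 <= B x z.
  move=> Xz; have Xxz : X (x + z) by exact: subspaceD.
  have P0 := Psi_ge0 Xxz.
  (* By convexity [Psi (x + t z) <= Psi x + t * Psi (x + z)]; a step of at most [s] uses no more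
     than the slack [M0 - Psi x]. Adding 1 keeps the denominator positive. *)
  pose s := (M0 - Psi x) / (Psi (x + z) + 1).
  have s0 : 0 < s by rewrite divr_gt0// ?subr_gt0// ltr_wpDl.
  pose t := Num.min s 1.
  have t0 : 0 < t by rewrite lt_min s0/=.
  have t1 : t <= 1 by rewrite ge_min lexx orbT.
  have ts : t * (Psi (x + z) + 1) <= M0 - Psi x.
    by rewrite -ler_pdivlMr ?ltr_wpDl// ge_min lexx.
  have Xtz : X (t *r z) by exact: subspaceZ.
  have := var (x + t *r z) (subspaceD sX Xx Xtz).
  rewrite addrAC subrr add0r (Blin Xx).2// pmulr_rge0//; apply.
  have -> : x + t *r z = (1 - t) *r x + t *r (x + z).
    by rewrite rscaleDl rscale1 rscaleNl rscaleDr addrA subrK.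
  apply: le_trans (psi_convex _ _ _) _ => //; first by rewrite (ltW t0).
  by have := Psi_ge0 Xx; nra.
exists x => // z Xz; apply/eqP; rewrite eq_le ge0// andbT.
by rewrite -oppr_ge0 -(linear_onN (Blin Xx))//; apply: ge0; exact: subspaceN.
Qed.

End browder_minty.

(** * Complex matrices and the nonlinearity *)

Section complex_parts.
Context (R : realType).
Implicit Types z w : R[i].

Lemma Re_add z w : Re (z + w) = Re z + Re w. Proof. by case: z w => [? ?] []. Qed.
Lemma Im_add z w : Im (z + w) = Im z + Im w. Proof. by case: z w => [? ?] []. Qed.
Lemma Re_opp z : Re (- z) = - Re z. Proof. by case: z. Qed.
Lemma Im_opp z : Im (- z) = - Im z. Proof. by case: z. Qed.
Lemma Re_sub z w : Re (z - w) = Re z - Re w. Proof. by rewrite Re_add Re_opp. Qed.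
Lemma Im_sub z w : Im (z - w) = Im z - Im w. Proof. by rewrite Im_add Im_opp. Qed.
Lemma Re_mul z w : Re (z * w) = Re z * Re w - Im z * Im w.
Proof. by case: z w => [? ?] []. Qed.
Lemma Im_mul z w : Im (z * w) = Re z * Im w + Im z * Re w.
Proof. by case: z w => [? ?] [] *; rewrite /= addrC. Qed.
Lemma Re_conjc z : Re z^*%C = Re z. Proof. by case: z. Qed.
Lemma Im_conjc z : Im z^*%C = - Im z. Proof. by case: z. Qed.
Lemma Re_sum (I : Type) (s : seq I) (f : I -> R[i]) :
  Re (\sum_(i <- s) f i) = \sum_(i <- s) Re (f i).
Proof. by elim: s => [|i s IH]; rewrite ?big_nil// !big_cons Re_add IH. Qed.
Lemma Im_sum (I : Type) (s : seq I) (f : I -> R[i]) :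
  Im (\sum_(i <- s) f i) = \sum_(i <- s) Im (f i).
Proof. by elim: s => [|i s IH]; rewrite ?big_nil// !big_cons Im_add IH. Qed.
Lemma normc_sqr z : normc z ^+ 2 = Re z ^+ 2 + Im z ^+ 2.
Proof. by case: z => a b /=; rewrite sqr_sqrtr// addr_ge0// sqr_ge0. Qed.
Lemma normc_ge0 z : 0 <= normc z.
Proof. by case: z => a b /=; exact: sqrtr_ge0. Qed.
Lemma Re_le_normc z : `|Re z| <= normc z.
Proof.
rewrite -(@ler_pXn2r _ 2) ?nnegrE ?normc_ge0// normc_sqr.
by rewrite real_normK ?num_real// lerDl sqr_ge0.
Qed.
Lemma Im_le_normc z : `|Im z| <= normc z.
Proof.
rewrite -(@ler_pXn2r _ 2) ?nnegrE ?normc_ge0// normc_sqr.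
by rewrite real_normK ?num_real// lerDr sqr_ge0.
Qed.
Lemma normc_real (x : R) : normc x%:C%C = `|x|.
Proof. by rewrite /= expr0n/= addr0 sqrtr_sqr. Qed.

End complex_parts.

Section complex_matrices.
Context (R : realType) (N n : nat).
Implicit Types Y Z : 'M[R[i]]_(N, n).

Lemma frobC_ge0 Y : 0 <= frobC Y. Proof. exact: sqrtr_ge0. Qed.

Lemma frobC_sqr Y :
  frobC Y ^+ 2 = \sum_(k < N) \sum_(j < n) normc (Y k j) ^+ 2.
Proof.
by rewrite sqr_sqrtr// sumr_ge0// => k _; rewrite sumr_ge0// => j _; exact: sqr_ge0.
Qed.

Lemma mxdotC_self Y : mxdotC Y Y = (frobC Y ^+ 2)%:C%C.
Proof.
rewrite frobC_sqr rmorph_sum; apply: eq_bigr => k _.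
rewrite rmorph_sum; apply: eq_bigr => j _.
case: (Y k j) => a b /=.
rewrite sqr_sqrtr ?addr_ge0 ?sqr_ge0//; apply/eqP; rewrite eq_complex /=.
by apply/andP; split; apply/eqP; ring.
Qed.

Lemma mxdotCDl Y Y' Z : mxdotC (Y + Y') Z = mxdotC Y Z + mxdotC Y' Z.
Proof.
rewrite -big_split; apply: eq_bigr => k _; rewrite -big_split.
by apply: eq_bigr => j _; rewrite mxE mulrDl.
Qed.

Lemma mxdotCZl c Y Z : mxdotC (c *: Y) Z = c * mxdotC Y Z.
Proof.
rewrite mulr_sumr; apply: eq_bigr => k _; rewrite mulr_sumr.
by apply: eq_bigr => j _; rewrite mxE mulrA.
Qed.

Lemma mxdotC_conj Y Z : mxdotC Z Y = (mxdotC Y Z)^*%C.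
Proof.
rewrite rmorph_sum; apply: eq_bigr => k _; rewrite rmorph_sum.
by apply: eq_bigr => j _; rewrite rmorphM /= conjcK mulrC.
Qed.

Lemma mxdotCDr Y Z Z' : mxdotC Y (Z + Z') = mxdotC Y Z + mxdotC Y Z'.
Proof. by rewrite mxdotC_conj mxdotCDl rmorphD /= -!mxdotC_conj. Qed.

Lemma mxdotCZr c Y Z : mxdotC Y (c *: Z) = c^*%C * mxdotC Y Z.
Proof. by rewrite mxdotC_conj mxdotCZl rmorphM /= -!mxdotC_conj. Qed.

Lemma mxdotCNl Y Z : mxdotC (- Y) Z = - mxdotC Y Z.
Proof. by rewrite -scaleN1r mxdotCZl mulN1r. Qed.

Lemma mxdotCNr Y Z : mxdotC Y (- Z) = - mxdotC Y Z.
Proof. by rewrite -scaleN1r mxdotCZr rmorphN rmorph1 mulN1r. Qed.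

Lemma frobCZ c Y : frobC (c *: Y) = normc c * frobC Y.
Proof.
rewrite /frobC -[normc c]ger0_norm ?normc_ge0// -sqrtr_sqr -sqrtrM ?sqr_ge0//.
congr Num.sqrt; rewrite mulr_sumr; apply: eq_bigr => k _; rewrite mulr_sumr.
by apply: eq_bigr => j _; rewrite mxE Normc.normcM exprMn.
Qed.

Lemma frobCN Y : frobC (- Y) = frobC Y.
Proof.
by rewrite -scaleN1r frobCZ (_ : normc (-1) = 1) ?mul1r// normcN Normc.normc1.
Qed.

Lemma frobC0 : frobC (0 : 'M[R[i]]_(N, n)) = 0.
Proof. by rewrite -(scale0r 0) frobCZ Normc.normc0 mul0r. Qed.

Lemma frobC_eq0 Y : frobC Y = 0 -> Y = 0.
Proof.
move=> Y0; have /eqP := frobC_sqr Y; rewrite Y0 expr0n/= eq_sym psumr_eq0; last first.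
  by move=> k _; rewrite sumr_ge0// => j _; exact: sqr_ge0.
move=> /allP Yk; apply/matrixP => k j; rewrite mxE.
have := Yk k (mem_index_enum _); rewrite /= psumr_eq0; last first.
  by move=> i _; exact: sqr_ge0.
move=> /allP/(_ j (mem_index_enum _)); rewrite /= sqrf_eq0 => /eqP.
exact: Normc.eq0_normc.
Qed.

Lemma frobCB_sqr Y Z :
  frobC (Y - Z) ^+ 2 = frobC Y ^+ 2 + frobC Z ^+ 2 - 2 * Re (mxdotC Y Z).
Proof.
have := congr1 (@Re R) (mxdotC_self (Y - Z)).
rewrite mxdotCDl !mxdotCDr !mxdotCNl !mxdotCNr !mxdotC_self [mxdotC Z Y]mxdotC_conj.
by rewrite !(Re_add, Re_opp) Re_conjc /= => <-; ring.
Qed.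

Lemma mxdotC_le Y Z : normc (mxdotC Y Z) <= frobC Y * frobC Z.
Proof.
rewrite -(@ler_pXn2r _ 2) ?nnegrE ?mulr_ge0 ?normc_ge0 ?frobC_ge0//.
have [Z0|Z0] := eqVneq (frobC Z) 0.
  rewrite (frobC_eq0 Z0) frobC0 mulr0 (_ : mxdotC Y 0 = 0) ?Normc.normc0//.
  by rewrite -(scale0r 0) mxdotCZr rmorph0 mul0r.
have Zp : 0 < frobC Z ^+ 2 by rewrite exprn_gt0// lt_neqAle eq_sym Z0 frobC_ge0.
have := sqr_ge0 (frobC ((frobC Z ^+ 2)%:C%C *: Y - mxdotC Y Z *: Z)).
rewrite frobCB_sqr !frobCZ mxdotCZl mxdotCZr !exprMn normc_real real_normK ?num_real//.
have -> : Re ((frobC Z ^+ 2)%:C%C * ((mxdotC Y Z)^*%C * mxdotC Y Z)) =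
   frobC Z ^+ 2 * normc (mxdotC Y Z) ^+ 2.
  by rewrite normc_sqr; case: (mxdotC Y Z) => a b /=; ring.
set A := frobC Z ^+ 2 in Zp *; set q := normc _ ^+ 2; set B := frobC Y ^+ 2.
nra.
Qed.

Lemma frobC_triangle Y Z : frobC (Y + Z) <= frobC Y + frobC Z.
Proof.
rewrite -(@ler_pXn2r _ 2) ?nnegrE ?addr_ge0 ?frobC_ge0//.
have := mxdotC_le Y (- Z); rewrite frobCN => h.
have := le_trans (Re_le_normc _) h; rewrite ler_norml => /andP[h1 _].
by rewrite -{1}[Z]opprK frobCB_sqr frobCN; nra.
Qed.

Lemma Re_mulmxdotC_le a Y Z :
  `|Re (a * mxdotC Y Z)| <= normc a * (frobC Y * frobC Z).
Proof.
apply: le_trans (Re_le_normc _) _; rewrite Normc.normcM.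
by rewrite ler_wpM2l ?normc_ge0// mxdotC_le.
Qed.

Lemma normc_le_frobC Y k j : normc (Y k j) <= frobC Y.
Proof.
rewrite -(@ler_pXn2r _ 2) ?nnegrE ?normc_ge0 ?frobC_ge0// frobC_sqr.
rewrite (bigD1 k)//= (bigD1 j)//= -addrA lerDl addr_ge0//.
  by apply: sumr_ge0 => i _; exact: sqr_ge0.
by apply: sumr_ge0 => i _; apply: sumr_ge0 => l _; exact: sqr_ge0.
Qed.

Lemma frobC_le_sum Y :
  frobC Y <= \sum_(k < N) \sum_(j < n) (`|Re (Y k j)| + `|Im (Y k j)|).
Proof.
have H (I : Type) (s : seq I) (g h : I -> R) : (forall i, 0 <= g i) ->
    (forall i, 0 <= h i) -> (forall i, g i <= h i ^+ 2) ->
    \sum_(i <- s) g i <= (\sum_(i <- s) h i) ^+ 2.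
  move=> g0 h0 gh; elim: s => [|i s IH]; first by rewrite !big_nil expr0n.
  rewrite !big_cons; have := gh i; have := h0 i.
  have : 0 <= \sum_(i <- s) h i by apply: sumr_ge0.
  nra.
have S0 k : 0 <= \sum_(j < n) (`|Re (Y k j)| + `|Im (Y k j)|).
  by apply: sumr_ge0 => j _; rewrite addr_ge0.
rewrite -(@ler_pXn2r _ 2) ?nnegrE ?frobC_ge0 ?sumr_ge0// frobC_sqr.
apply: (H) => // k; first by apply: sumr_ge0 => j _; exact: sqr_ge0.
apply: H => j; [exact: sqr_ge0|by rewrite addr_ge0|].
rewrite normc_sqr -(real_normK (num_real (Re _))) -(real_normK (num_real (Im _))).
by have := normr_ge0 (Re (Y k j)); have := normr_ge0 (Im (Y k j)); nra.
Qed.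

End complex_matrices.

(** * Pointwise inequalities for real powers *)

Section powers.
Context (R : realType) (p : R).
Hypothesis p1 : 1 < p.

Let p0 : 0 < p. Proof. exact: lt_trans p1. Qed.

Lemma powR_le (q x y : R) : 0 <= q -> 0 <= x -> x <= y -> x `^ q <= y `^ q.
Proof.
by move=> q0 x0 xy; apply: ge0_ler_powR; rewrite ?nnegrE//; exact: le_trans xy.
Qed.

Lemma powR_sub1M (x : R) : 0 <= x -> x `^ (p - 1) * x = x `^ p.
Proof. by move=> x0; rewrite mulrC mulr_powRB1. Qed.

Lemma powR_sub2M (x : R) : 0 <= x -> x `^ (p - 2) * x = x `^ (p - 1).
Proof.
move=> x0; rewrite mulrC (_ : p - 2 = (p - 1) - 1); last by ring.
by rewrite mulr_powRB1// subr_gt0.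
Qed.

Lemma powR_sub2MM (x : R) : 0 <= x -> x `^ (p - 2) * x ^+ 2 = x `^ p.
Proof. by move=> x0; rewrite expr2 mulrA powR_sub2M// powR_sub1M. Qed.

Lemma powR_add_le (a b : R) : 0 <= a -> 0 <= b ->
  (a + b) `^ p <= 2 `^ p * (a `^ p + b `^ p).
Proof.
wlog ab : a b / a <= b => [H a0 b0|a0 b0].
  have [/H|/ltW/H] := leP a b; first exact.
  by rewrite addrC [_ `^ p + _]addrC; exact.
apply: (@le_trans _ _ ((2 * b) `^ p)).
  by apply: powR_le; [exact: ltW|exact: addr_ge0|lra].
by rewrite powRM// ler_wpM2l ?powR_ge0// lerDr powR_ge0.
Qed.

Lemma powR_sum_le (I : Type) (s : seq I) : exists2 C, 0 <= C &
  forall a : I -> R, (forall i, 0 <= a i) ->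
    (\sum_(i <- s) a i) `^ p <= C * \sum_(i <- s) a i `^ p.
Proof.
elim: s => [|i s [C C0 IH]].
  by exists 0 => // a _; rewrite !big_nil mul0r powR0// gt_eqF.
have B0 := powR_ge0 2 p.
exists (2 `^ p * (1 + C)) => [|a a0]; first by rewrite mulr_ge0// addr_ge0.
have S0 : 0 <= \sum_(j <- s) a j by exact: sumr_ge0.
have Sp0 : 0 <= \sum_(j <- s) a j `^ p by apply: sumr_ge0 => *; exact: powR_ge0.
have A0 := powR_ge0 (a i) p; have := IH a a0.
rewrite !big_cons => h; apply: le_trans (powR_add_le _ _) _ => //.
rewrite -mulrA ler_wpM2l// mulrDl mul1r mulrDr -addrA lerD2l.
by apply: ler_wpDl => //; apply: ler_wpDl => //; exact: mulr_ge0.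
Qed.

(** The power is monotone in one direction or the other according to the sign of [q]; the sum of the
    endpoint values covers both, so [q = p - 2] needs no case distinction later. *)
Lemma powR_between (q a b x : R) : 0 < a -> a <= x -> x <= b ->
  x `^ q <= a `^ q + b `^ q.
Proof.
move=> a0 ax xb; have x0 := lt_le_trans a0 ax; have b0 := lt_le_trans x0 xb.
have [q0|q0] := leP 0 q.
  by apply: (le_trans (powR_le q0 (ltW x0) xb)); rewrite lerDr powR_ge0.
rewrite -[q]opprK !(powRN _ (- q)); apply: (@le_trans _ _ (a `^ (- q))^-1).
  rewrite lef_pV2 ?posrE ?powR_gt0//; apply: powR_le => //; last exact: ltW.
  by rewrite oppr_ge0 ltW.
by rewrite lerDl invr_ge0 powR_ge0.
Qed.

(** The quotient [h / s] lies in [[d, 2]] and [s / h] in [[1/2, 1/d]], away from 0, so their powers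
    of any sign are bounded. *)
Lemma powR_comparable (d : R) : 0 < d -> exists2 C, 0 < C &
  forall s h : R, 0 < s -> d * s <= h -> h <= 2 * s ->
    h `^ (p - 2) <= C * s `^ (p - 2) /\ s `^ (p - 2) <= C * h `^ (p - 2).
Proof.
move=> d0; pose q := p - 2.
exists (d `^ q + 2 `^ q + (2^-1 `^ q + d^-1 `^ q)).
  by rewrite !addr_gt0// powR_gt0// invr_gt0.
move=> s h s0 dh hs.
have h0 : 0 < h by apply: lt_le_trans dh; rewrite mulr_gt0.
split.
- rewrite -{1}[h](divfK (lt0r_neq0 s0)) powRM ?divr_ge0 ?(ltW s0) ?(ltW h0)//.
  rewrite ler_wpM2r ?powR_ge0//; apply: le_trans (powR_between q d0 _ _) _.
  + by rewrite ler_pdivlMr.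
  + by rewrite ler_pdivrMr//; exact: hs.
  + by rewrite lerDl addr_ge0 ?powR_ge0.
- rewrite -{1}[s](divfK (lt0r_neq0 h0)) powRM ?divr_ge0 ?(ltW s0) ?(ltW h0)//.
  rewrite ler_wpM2r ?powR_ge0//.
  apply: le_trans (@powR_between q 2^-1 d^-1 _ _ _ _) _.
  + by rewrite invr_gt0.
  + by rewrite ler_pdivlMr//; lra.
  + by rewrite ler_pdivrMr// mulrC ler_pdivlMr// mulrC.
  + by rewrite lerDr addr_ge0 ?powR_ge0.
Qed.

(** This makes up for the decay of the weight [s ^ (p - 2)] when [p < 2]. Either [h <= d^(1/p) * s],
    and the first term suffices, or [h] and [s] are comparable and so are their powers. *)
Lemma powR_split (d : R) : 0 < d -> exists2 C, 0 < C &
  forall s h : R, 0 <= s -> 0 <= h -> h <= 2 * s ->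
    h `^ p <= d * s `^ p + C * (s `^ (p - 2) * h ^+ 2).
Proof.
move=> d0; pose d' := d `^ p^-1.
have d'0 : 0 < d' by rewrite powR_gt0.
have [C C0 HC] := powR_comparable d'0; exists C => // s h s0 h0 hs.
have W0 : 0 <= C * (s `^ (p - 2) * h ^+ 2).
  by apply: mulr_ge0; rewrite ?(ltW C0)// mulr_ge0 ?powR_ge0 ?sqr_ge0.
have [hd|dh] := leP h (d' * s).
  apply: ler_wpDr => //; apply: le_trans (powR_le (ltW p0) h0 hd) _.
  by rewrite powRM ?(ltW d'0)// /d' -powRrM mulVf ?gt_eqF// powRr1// ltW.
have sp : 0 < s.
  by rewrite lt_neqAle s0 andbT; apply/eqP => s0'; move: dh hs; rewrite -s0'; nra.
apply: ler_wpDl; first by apply: mulr_ge0; rewrite ?powR_ge0// ltW.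
rewrite -powR_sub2MM// [leRHS]mulrA ler_wpM2r ?sqr_ge0//.
by have [] := HC s h sp (ltW dh) hs.
Qed.

(** Splitting at [b = e * a] proves this form of Young's inequality without conjugate exponents; the
    small factor falls on the fixed function, for continuity in the test function. *)
Lemma powR_young (e : R) : 0 < e -> exists2 C, 0 < C &
  forall a b : R, 0 <= a -> 0 <= b -> a `^ (p - 1) * b <= e * a `^ p + C * b `^ p.
Proof.
move=> e0; exists (e^-1 `^ (p - 1)); first by rewrite powR_gt0// invr_gt0.
move=> a b a0 b0; have [h|h] := leP b (e * a).
  apply: ler_wpDr; first by rewrite mulr_ge0 ?powR_ge0.
  by rewrite -powR_sub1M// mulrCA ler_wpM2l ?powR_ge0.
apply: ler_wpDl; first by apply: mulr_ge0; rewrite ?powR_ge0// ltW.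
rewrite -(powR_sub1M b0) mulrA ler_wpM2r// -powRM ?invr_ge0 ?(ltW e0)//.
apply: powR_le => //; first by rewrite subr_ge0 ltW.
by rewrite mulrC ltW// ltr_pdivlMr// mulrC.
Qed.

(** Here the small factor falls on [b], so that coercivity can absorb that term. *)
Lemma powR_young' (e : R) : 0 < e -> exists2 C, 0 < C &
  forall a b : R, 0 <= a -> 0 <= b -> a `^ (p - 1) * b <= C * a `^ p + e * b `^ p.
Proof.
move=> e0; have q0 : 0 < p - 1 by rewrite subr_gt0.
pose d := e `^ (p - 1)^-1; have d0 : 0 < d by rewrite powR_gt0.
exists d^-1; first by rewrite invr_gt0.
move=> a b a0 b0; have [h|h] := leP a (d * b).
  apply: ler_wpDl; first by apply: mulr_ge0; rewrite ?powR_ge0// invr_ge0 ltW.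
  rewrite -(powR_sub1M b0) mulrA ler_wpM2r//.
  apply: le_trans (powR_le (ltW q0) a0 h) _.
  by rewrite powRM ?(ltW d0)// /d -powRrM mulVf ?gt_eqF// powRr1// ltW.
apply: ler_wpDr; first by apply: mulr_ge0; rewrite ?powR_ge0// ltW.
rewrite -(powR_sub1M a0) mulrCA ler_wpM2l ?powR_ge0//.
by rewrite mulrC ltW// ltr_pdivlMr// mulrC.
Qed.

(** Integrated over a set of finite measure, this controls the L^1 norm by the L^p norm and takes
    the place of Hoelder's inequality. *)
Lemma powR_linear (d a : R) : 0 < d -> 0 <= a ->
  a <= d + d^-1 `^ (p - 1) * a `^ p.
Proof.
move=> d0 a0; have [h|h] := leP a d.
  by apply: ler_wpDr => //; rewrite mulr_ge0 ?powR_ge0.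
apply: ler_wpDl; first exact: ltW.
rewrite -(powR_sub1M a0) mulrA -powRM ?invr_ge0 ?(ltW d0)// ler_peMl//.
rewrite -[leLHS](_ : 1 `^ (p - 1) = 1); last by rewrite powR1.
apply: powR_le => //.
  by rewrite subr_ge0 ltW.
by rewrite mulrC ler_pdivlMr// mul1r ltW.
Qed.

(** If [h <= d * s], the left side is at most [d * s^(p-1) * z]; otherwise [s] and [h] are
    comparable and [s^(p-2)] may be replaced by [h^(p-2)]. It is applied with [h = t * z]. *)
Lemma powR_hemi (d : R) : 0 < d -> exists2 C, 0 < C &
  forall s h z : R, 0 <= s -> 0 <= h -> 0 <= z -> h <= 2 * s ->
    s `^ (p - 2) * h * z <= d * (s `^ p + z `^ p) + C * (h `^ (p - 1) * z).
Proof.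
move=> d0; have [C C0 HC] := powR_comparable d0; exists C => // s h z s0 h0 z0 hs.
have [hd|dh] := leP h (d * s).
  apply: ler_wpDr; first by rewrite !mulr_ge0 ?powR_ge0// ltW.
  apply: (@le_trans _ _ (d * (s `^ (p - 1) * z))).
    rewrite -(powR_sub2M s0) !mulrA ler_wpM2r//.
    by rewrite [d * _]mulrC -mulrA ler_wpM2l ?powR_ge0.
  rewrite ler_wpM2l ?(ltW d0)//.
  have q0 : 0 <= p - 1 by rewrite subr_ge0 ltW.
  have [sz|/ltW zs] := leP s z.
    apply: ler_wpDl; first exact: powR_ge0.
    by rewrite -(powR_sub1M z0) ler_wpM2r// powR_le.
  apply: ler_wpDr; first exact: powR_ge0.
  by rewrite -(powR_sub1M s0) ler_wpM2l// powR_ge0.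
have sp : 0 < s.
  by rewrite lt_neqAle s0 andbT; apply/eqP => s0'; move: dh hs; rewrite -s0'; nra.
apply: ler_wpDl; first by apply: mulr_ge0; rewrite ?addr_ge0 ?powR_ge0// ltW.
rewrite mulrA ler_wpM2r// -(powR_sub2M h0) mulrA ler_wpM2r//.
by have [] := HC s h sp (ltW dh) hs.
Qed.

(** Young's inequality for [a^(p-1)] and [b], with exponents [p/(p-1)] and [p]. The linear term is
    written with the weight [a^(p-2)], which is the weight of the nonlinearity. *)
Lemma powR_tangent (a b : R) : 0 <= a -> 0 <= b ->
  a `^ p / p + a `^ (p - 2) * (a * b - a ^+ 2) <= b `^ p / p.
Proof.
move=> a0 b0; have q0 : 0 < p - 1 by rewrite subr_gt0.
have pn : p != 0 by rewrite gt_eqF.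
have qn : p - 1 != 0 by rewrite gt_eqF.
have := @conjugate_powR R (a `^ (p - 1)) b (p / (p - 1)) p (powR_ge0 _ _) b0.
rewrite divr_gt0// => /(_ isT p0); rewrite -powRrM mulrCA divff// mulr1.
rewrite (_ : (p / (p - 1))^-1 + p^-1 = 1); last by field; rewrite pn qn.
move=> /(_ erefl) young.
rewrite mulrBr mulrA powR_sub2M// powR_sub2MM//.
have e : a `^ p / (p / (p - 1)) = a `^ p - a `^ p / p by field; rewrite pn qn.
rewrite e in young.
lra.
Qed.

End powers.

(** * From collinear real matrices to the sector estimate *)

Section collinear.
Context (R : realType) (N n : nat) (p mu c1 c2 : R).
Hypothesis N0 : (0 < N)%N.
Hypothesis n0 : (0 < n)%N.
Hypothesis Vb : V_bounds N n p mu c1 c2.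

Definition wgt (r : R) : R := (mu ^+ 2 + r ^+ 2) `^ ((p - 2) / 2).
Definition wgt2 (r s : R) : R :=
  (mu ^+ 2 + r ^+ 2 + s ^+ 2) `^ ((p - 2) / 2).

(** Apply the two-sided bound to the multiples [r e] and [s e] of one matrix unit [e], which exists
    because [2 * N] and [n] are positive. Negative [s] is allowed and gives the antiparallel
    case. *)
Lemma V_bounds_collinear (r s : R) :
  c1 * wgt2 r s * (r - s) ^+ 2 <= (wgt r * r - wgt s * s) * (r - s) /\
  (wgt r * r - wgt s * s) * (r - s) <= c2 * wgt2 r s * (r - s) ^+ 2.
Proof.
have N2 : (0 < 2 * N)%N by rewrite muln_gt0.
pose e : 'M[R]_((2 * N)%N, n) := delta_mx (Ordinal N2) (Ordinal n0).
have dotE a b : mxdot (a *: e) (b *: e) = a * b.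
  rewrite /mxdot (bigD1 (Ordinal N2))//= [X in _ + X]big1 ?addr0; last first.
    by move=> k /negbTE kN; apply: big1 => j _; rewrite !mxE kN/= !mulr0.
  rewrite (bigD1 (Ordinal n0))//= [X in _ + X]big1 ?addr0; last first.
    by move=> j /negbTE jN; rewrite !mxE jN !andbF !mulr0.
  by rewrite !mxE !eqxx/= !mulr1.
have frobE a : frob (a *: e) ^+ 2 = a ^+ 2.
  rewrite /frob sqr_sqrtr; last first.
    by apply: sumr_ge0 => k _; apply: sumr_ge0 => j _; exact: sqr_ge0.
  rewrite -[RHS]dotE /mxdot; apply: eq_bigr => k _; apply: eq_bigr => j _.
  by rewrite expr2.
have := Vb (r *: e) (s *: e); rewrite /Vmap -scalerBl !frobE !scalerA -scalerBl.
by rewrite dotE -!mulrA => /andP.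
Qed.

Lemma wgt2_ge0 r s : 0 <= wgt2 r s. Proof. exact: powR_ge0. Qed.
Lemma wgtN r : wgt (- r) = wgt r. Proof. by rewrite /wgt sqrrN. Qed.
Lemma wgt2N r s : wgt2 r (- s) = wgt2 r s. Proof. by rewrite /wgt2 sqrrN. Qed.

(* A function that is affine in [t] is nonnegative on [-m, m] as soon as it is
   at the endpoints, which correspond to collinear vectors. *)
Lemma affine_ge0 (A B m t : R) :
  `|t| <= m -> 0 <= A - B * m -> 0 <= A + B * m -> 0 <= A - B * t.
Proof. by rewrite ler_norml => /andP[? ?] ? ?; have [?|?] := leP 0 B; nra. Qed.

Hypothesis c1_gt0 : 0 < c1.
Hypothesis c2_gt0 : 0 < c2.

Section two_matrices.
Context (m1 m2 : nat) (Y Z : 'M[R[i]]_(m1, m2)).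
Let r := frobC Y.
Let s := frobC Z.
Let t := Re (mxdotC Y Z).
Let V (X : 'M[R[i]]_(m1, m2)) := VmapC p mu X.

Let r_ge0 : 0 <= r. Proof. exact: frobC_ge0. Qed.
Let s_ge0 : 0 <= s. Proof. exact: frobC_ge0. Qed.
Let t_le : `|t| <= r * s.
Proof. exact: le_trans (Re_le_normc _) (mxdotC_le _ _). Qed.
Let VE (X : 'M[R[i]]_(m1, m2)) : V X = (wgt (frobC X))%:C%C *: X.
Proof. by []. Qed.

Let dotVE : Re (mxdotC (V Y - V Z) (Y - Z)) =
  wgt r * r ^+ 2 + wgt s * s ^+ 2 - (wgt r + wgt s) * t.
Proof.
rewrite mxdotCDl !mxdotCDr !mxdotCNl !mxdotCNr !VE !mxdotCZl !mxdotC_self.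
rewrite [mxdotC Z Y]mxdotC_conj !(Re_add, Re_opp) !Re_mul Re_conjc /= -/r -/s -/t.
by ring.
Qed.

Let distVE : frobC (V Y - V Z) ^+ 2 =
  wgt r ^+ 2 * r ^+ 2 + wgt s ^+ 2 * s ^+ 2 - 2 * (wgt r * wgt s) * t.
Proof.
rewrite frobCB_sqr !VE !frobCZ !normc_real !exprMn !real_normK ?num_real//.
rewrite mxdotCZl mxdotCZr conjc_real !Re_mul /= -/r -/s -/t; ring.
Qed.

Let distE : frobC (Y - Z) ^+ 2 = r ^+ 2 + s ^+ 2 - 2 * t.
Proof. exact: frobCB_sqr. Qed.

Lemma VmapC_monotone :
  c1 * wgt2 r s * frobC (Y - Z) ^+ 2 <= Re (mxdotC (V Y - V Z) (Y - Z)).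
Proof.
rewrite dotVE distE -subr_ge0; set w := c1 * _.
have -> : wgt r * r ^+ 2 + wgt s * s ^+ 2 - (wgt r + wgt s) * t -
    w * (r ^+ 2 + s ^+ 2 - 2 * t) =
  wgt r * r ^+ 2 + wgt s * s ^+ 2 - w * (r ^+ 2 + s ^+ 2) -
    (wgt r + wgt s - 2 * w) * t by ring.
have [h1 _] := V_bounds_collinear r s.
have [h2 _] := V_bounds_collinear r (- s).
move: h1 h2; rewrite wgtN wgt2N -/w => h1 h2.
by apply: affine_ge0 t_le _ _; nra.
Qed.

(** The squares of both sides are affine in [t], so collinear vectors suffice. There the upper bound
    can be divided by the difference, and the lower bound supplies the sign that permits
    squaring. *)
Lemma VmapC_lipschitz : frobC (V Y - V Z) <= c2 * wgt2 r s * frobC (Y - Z).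
Proof.
have sq (x y w v : R) : 0 <= w -> (y = 0 -> x = 0) -> v * y ^+ 2 <= x * y ->
    0 <= v -> x * y <= w * y ^+ 2 -> x ^+ 2 <= w ^+ 2 * y ^+ 2.
  move=> w0 yx vy v0 xw; have [y0|yn] := eqVneq y 0.
    by rewrite y0 yx// expr0n/= mulr0.
  have yy : 0 < y ^+ 2 by rewrite lt_neqAle sqr_ge0 eq_sym sqrf_eq0 yn.
  rewrite -(ler_pM2r yy) -exprMn.
  rewrite (_ : w ^+ 2 * _ * _ = (w * y ^+ 2) ^+ 2); last by ring.
  by rewrite lerXn2r ?nnegrE//; [apply: le_trans vy|]; rewrite mulr_ge0 ?(ltW yy).
have w0 : 0 <= c2 * wgt2 r s by rewrite mulr_ge0 ?wgt2_ge0 ?ltW.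
rewrite -(@ler_pXn2r _ 2) ?nnegrE ?mulr_ge0 ?frobC_ge0 ?wgt2_ge0 ?(ltW c2_gt0)//.
have v0 : 0 <= c1 * wgt2 r s by rewrite mulr_ge0 ?wgt2_ge0 ?ltW.
rewrite exprMn distVE distE -subr_ge0; set w := c2 * _ in w0 *.
have [h1 h1'] := V_bounds_collinear r s.
have [h2 h2'] := V_bounds_collinear r (- s).
move: h1 h1' h2 h2'; rewrite wgtN wgt2N -/w => h1 h1' h2 h2'.
have q1 : (wgt r * r - wgt s * s) ^+ 2 <= w ^+ 2 * (r - s) ^+ 2.
  apply: (sq _ _ _ _ w0 _ h1 v0 h1') => /eqP; rewrite subr_eq0 => /eqP ->.
  by rewrite subrr.
have q2 : (wgt r * r - wgt s * - s) ^+ 2 <= w ^+ 2 * (r - - s) ^+ 2.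
  apply: (sq _ _ _ _ w0 _ h2 v0 h2') => /eqP.
  rewrite opprK paddr_eq0// => /andP[/eqP -> /eqP ->].
  by rewrite oppr0 !mulr0 subr0.
have -> : w ^+ 2 * (r ^+ 2 + s ^+ 2 - 2 * t) -
   (wgt r ^+ 2 * r ^+ 2 + wgt s ^+ 2 * s ^+ 2 - 2 * (wgt r * wgt s) * t) =
   w ^+ 2 * (r ^+ 2 + s ^+ 2) - wgt r ^+ 2 * r ^+ 2 - wgt s ^+ 2 * s ^+ 2 -
   (2 * w ^+ 2 - 2 * (wgt r * wgt s)) * t by ring.
by apply: affine_ge0 t_le _ _; nra.
Qed.

(** Cauchy-Schwarz and the two bounds give [|z| <= (c2 / c1) Re z]. So [z] lies in the sector around
    the positive axis whose half-angle has cosine [c1 / c2]; the square root is the tangent of that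
    angle. *)
Let VmapC_Im_le : `|Im (mxdotC (V Y - V Z) (Y - Z))| <=
  Num.sqrt ((c2 / c1) ^+ 2 - 1) * Re (mxdotC (V Y - V Z) (Y - Z)).
Proof.
set z := mxdotC _ _; pose D := frobC (Y - Z) ^+ 2; pose w := wgt2 r s.
have wD0 : 0 <= w * D by rewrite mulr_ge0 ?wgt2_ge0 ?sqr_ge0.
have z1 : c1 * (w * D) <= Re z by rewrite mulrA; exact: VmapC_monotone.
have z2 : normc z <= c2 * (w * D).
  apply: le_trans (mxdotC_le _ _) _; rewrite mulrA /D expr2 mulrA.
  by rewrite ler_wpM2r ?frobC_ge0//; exact: VmapC_lipschitz.
have Rz0 : 0 <= Re z by apply: le_trans z1; rewrite mulr_ge0// ltW.
have z3 : normc z <= c2 / c1 * Re z.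
  apply: (le_trans z2); rewrite -mulrA ler_wpM2l ?(ltW c2_gt0)//.
  by rewrite [leRHS]mulrC ler_pdivlMr// mulrC.
have : Im z ^+ 2 <= Re z ^+ 2 * ((c2 / c1) ^+ 2 - 1).
  have : normc z ^+ 2 <= (c2 / c1 * Re z) ^+ 2.
    by rewrite lerXn2r ?nnegrE ?normc_ge0// mulr_ge0// divr_ge0// ltW.
  by rewrite normc_sqr exprMn; set c := _ ^+ 2; lra.
by move/ler_wsqrtr; rewrite sqrtr_sqr sqrtrM ?sqr_ge0// sqrtr_sqr (ger0_norm Rz0) mulrC.
Qed.

(* The sector condition on [a] compensates the rotation of
   [<V Y - V Z, Y - Z>] away from the real axis. *)
Lemma VmapC_sector (a : R[i]) (gamma0 : R) : 0 < gamma0 ->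
  gamma0 < Re a - Num.sqrt ((c2 / c1) ^+ 2 - 1) * `|Im a| ->
  gamma0 * c1 * (wgt2 r s * frobC (Y - Z) ^+ 2) <=
    Re (a * mxdotC (V Y - V Z) (Y - Z)).
Proof.
move=> g0 ga; rewrite Re_mul; have h1 := VmapC_monotone; have h2 := VmapC_Im_le.
set z := mxdotC _ _ in h1 h2 *; set c := Num.sqrt _ in ga h2 *.
have wD0 : 0 <= wgt2 r s * frobC (Y - Z) ^+ 2.
  by rewrite mulr_ge0 ?wgt2_ge0 ?sqr_ge0.
move: h1; rewrite -mulrA; set W := _ * frobC _ ^+ 2 in wD0 * => h1.
have Rz0 : 0 <= Re z by apply: le_trans h1; rewrite mulr_ge0// ltW.
have h3 : Im a * Im z <= `|Im a| * (c * Re z).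
  by apply: le_trans (ler_norm _) _; rewrite normrM ler_wpM2l.
apply: (@le_trans _ _ ((Re a - c * `|Im a|) * Re z)); last by nra.
apply: (@le_trans _ _ (gamma0 * Re z)); last by rewrite ler_wpM2r// ltW.
by rewrite -mulrA ler_wpM2l// ltW.
Qed.

End two_matrices.
End collinear.

(** * The energy density and its tangent inequality *)

Section energy_density.
Context (R : realType) (p mu : R) (m1 m2 : nat).
Hypothesis p1 : 1 < p.
Hypothesis mu01 : 0 <= mu <= 1.
Implicit Types (Y Z X : 'M[R[i]]_(m1, m2)) (r s : R).

Let p0 : 0 < p. Proof. exact: lt_trans p1. Qed.

(** In terms of these lengths the weights are powers [p - 2], to which the scalar inequalities
    apply. *)
Definition bra r : R := Num.sqrt (mu ^+ 2 + r ^+ 2).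
Definition bra2 r s : R := Num.sqrt (mu ^+ 2 + r ^+ 2 + s ^+ 2).
Definition eng Y : R := bra (frobC Y) `^ p.

Lemma bra_ge0 r : 0 <= bra r. Proof. exact: sqrtr_ge0. Qed.
Lemma bra2_ge0 r s : 0 <= bra2 r s. Proof. exact: sqrtr_ge0. Qed.
Lemma eng_ge0 Y : 0 <= eng Y. Proof. exact: powR_ge0. Qed.

Lemma bra_sqr r : bra r ^+ 2 = mu ^+ 2 + r ^+ 2.
Proof. by rewrite sqr_sqrtr// addr_ge0 ?sqr_ge0. Qed.
Lemma bra2_sqr r s : bra2 r s ^+ 2 = mu ^+ 2 + r ^+ 2 + s ^+ 2.
Proof. by rewrite sqr_sqrtr// !addr_ge0 ?sqr_ge0. Qed.

Let sqrt_powR (x q : R) : 0 <= x -> x `^ (q / 2) = Num.sqrt x `^ q.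
Proof. by move=> x0; rewrite -powR12_sqrt// -powRrM mulrC. Qed.

Lemma wgtE r : wgt p mu r = bra r `^ (p - 2).
Proof. by rewrite /wgt sqrt_powR// addr_ge0 ?sqr_ge0. Qed.
Lemma wgt2E r s : wgt2 p mu r s = bra2 r s `^ (p - 2).
Proof. by rewrite /wgt2 sqrt_powR// !addr_ge0 ?sqr_ge0. Qed.

Lemma le_bra r : 0 <= r -> r <= bra r.
Proof.
move=> r0; rewrite -(@ler_pXn2r _ 2) ?nnegrE ?bra_ge0// bra_sqr.
by rewrite lerDr sqr_ge0.
Qed.

Lemma bra_add_le r s : 0 <= r -> 0 <= s -> bra (r + s) <= bra r + s.
Proof.
move=> r0 s0; have b0 := bra_ge0 r.
rewrite -(@ler_pXn2r _ 2) ?nnegrE ?bra_ge0 ?addr_ge0// bra_sqr.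
by have := le_bra r0; have := bra_sqr r; nra.
Qed.

Lemma bra_le r s : 0 <= r -> r <= s -> bra r <= bra s.
Proof. by move=> r0 rs; apply: ler_wsqrtr; nra. Qed.

Lemma bra2_le r s : bra2 r s <= bra r + bra s.
Proof.
have a0 := bra_ge0 r; have b0 := bra_ge0 s.
rewrite -(@ler_pXn2r _ 2) ?nnegrE ?bra2_ge0 ?addr_ge0// bra2_sqr.
have := bra_sqr r; have := bra_sqr s; have := sqr_ge0 mu; nra.
Qed.

Lemma le_bra2 r s : 0 <= r -> 0 <= s -> r + s <= 2 * bra2 r s.
Proof.
move=> r0 s0; have a0 := bra2_ge0 r s.
rewrite -(@ler_pXn2r _ 2) ?nnegrE ?mulr_ge0 ?addr_ge0// exprMn bra2_sqr.
have := sqr_ge0 mu; have := sqr_ge0 (r - s); nra.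
Qed.

Lemma frobC_sub_le_bra2 Y Z : frobC (Y - Z) <= 2 * bra2 (frobC Y) (frobC Z).
Proof.
apply: le_trans (frobC_triangle _ _) _; rewrite frobCN.
by apply: le_bra2; exact: frobC_ge0.
Qed.

Lemma frobC_powR_le_eng Y : frobC Y `^ p <= eng Y.
Proof. by apply: powR_le; rewrite ?le_bra ?frobC_ge0// ltW. Qed.

Lemma eng_le Y : eng Y <= 2 `^ p * (1 + frobC Y `^ p).
Proof.
apply: (@le_trans _ _ ((1 + frobC Y) `^ p)).
  apply: powR_le; rewrite ?bra_ge0 ?(ltW p0)//.
  have h := frobC_ge0 Y; rewrite -(@ler_pXn2r _ 2) ?nnegrE ?bra_ge0 ?addr_ge0//.
  by rewrite bra_sqr; case/andP: mu01 => mu0 mu1; nra.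
by apply: le_trans (powR_add_le p1 _ _) _; rewrite ?frobC_ge0 ?powR1.
Qed.

Lemma frobC_VmapC_le Y : frobC (VmapC p mu Y) <= bra (frobC Y) `^ (p - 1).
Proof.
rewrite /VmapC -/(wgt p mu (frobC Y)) wgtE frobCZ normc_real ger0_norm ?powR_ge0//.
rewrite -(powR_sub2M p1) ?bra_ge0// ler_wpM2l ?powR_ge0//.
by apply: le_bra; exact: frobC_ge0.
Qed.

Lemma frobC_pmapC Y : frobC (pmapC p Y) = frobC Y `^ (p - 1).
Proof.
rewrite /pmapC frobCZ normc_real ger0_norm ?powR_ge0//.
by rewrite (powR_sub2M p1) ?frobC_ge0.
Qed.

Let dotV Y Z : Re (mxdotC (VmapC p mu Y) Z) = wgt p mu (frobC Y) * Re (mxdotC Y Z).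
Proof. by rewrite mxdotCZl Re_mul /= mul0r subr0. Qed.

(** The form at [Z = Y] is real up to the factor [a], so only [Re a] matters. If [mu <= |Y|], then
    [|Y|^2] is at least half of [mu^2 + |Y|^2]; otherwise [mu <= 1] bounds the density by
    [2 ^ p]. *)
Lemma VmapC_coercive Y (a : R[i]) (g : R) : 0 <= g -> g <= Re a ->
  g * (2^-1 * eng Y - 2 `^ p) <= Re (a * mxdotC (VmapC p mu Y) Y).
Proof.
move=> g0 ga; rewrite mxdotCZl mxdotC_self Re_mul /= -/(wgt p mu (frobC Y)).
rewrite !mul0r !mulr0 addr0 !subr0 wgtE.
have r0 := frobC_ge0 Y; set r := frobC Y in r0 *.
have b0 := bra_ge0 r; have w0 := powR_ge0 (bra r) (p - 2).
have wr0 : 0 <= bra r `^ (p - 2) * r ^+ 2 by rewrite mulr_ge0 ?sqr_ge0.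
suff h : 2^-1 * eng Y - 2 `^ p <= bra r `^ (p - 2) * r ^+ 2.
  apply: (@le_trans _ _ (g * (bra r `^ (p - 2) * r ^+ 2))).
    by rewrite ler_wpM2l.
  by rewrite mulr0 subr0 ler_wpM2r.
have [mr|/ltW rm] := leP mu r.
  rewrite lerBlDr; apply: ler_wpDr; first exact: powR_ge0.
  rewrite /eng -/r -(powR_sub2MM p1 b0) bra_sqr mulrCA ler_wpM2l//.
  by case/andP: mu01 => mu0 mu1; nra.
apply: le_trans wr0; rewrite subr_le0.
have : eng Y <= 2 `^ p.
  apply: powR_le; rewrite ?(ltW p0)//.
  rewrite -(@ler_pXn2r _ 2) ?nnegrE// bra_sqr -/r.
  by case/andP: mu01 => mu0 mu1; nra.
by have := eng_ge0 Y; lra.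
Qed.

(** [VmapC] is the gradient of [eng / p]. The inequality reduces to the scalar one for [bra], by
    Cauchy-Schwarz for the matrices and again for the plane vectors [(mu, |Y|)] and [(mu, |Z|)]. *)
Lemma eng_tangent Y Z :
  eng Y / p + Re (mxdotC (VmapC p mu Y) (Z - Y)) <= eng Z / p.
Proof.
rewrite dotV mxdotCDr mxdotCNr mxdotC_self Re_add Re_opp wgtE /=.
apply: le_trans (powR_tangent p1 (bra_ge0 (frobC Y)) (bra_ge0 (frobC Z))).
rewrite lerD2l ler_wpM2l ?powR_ge0//.
have h : Re (mxdotC Y Z) <= frobC Y * frobC Z.
  by apply: le_trans (ler_norm _) _; exact: le_trans (Re_le_normc _) (mxdotC_le _ _).
rewrite bra_sqr opprD addrA lerD2r.
suff : frobC Y * frobC Z + mu ^+ 2 <= bra (frobC Y) * bra (frobC Z) by lra.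
have r0 := frobC_ge0 Y; have s0 := frobC_ge0 Z.
rewrite -(@ler_pXn2r _ 2) ?nnegrE ?addr_ge0 ?sqr_ge0 ?mulr_ge0 ?bra_ge0//.
rewrite exprMn !bra_sqr.
by have := mulr_ge0 (sqr_ge0 mu) (sqr_ge0 (frobC Y - frobC Z)); nra.
Qed.

(** [powR_split] with [s = bra2] and [h = |Y - Z|]; the factor [2 ^ p] is spent on splitting
    [bra2 ^ p] into the two densities. *)
Lemma frobC_sub_powR_le (d : R) : 0 < d -> exists2 C, 0 < C & forall Y Z,
  frobC (Y - Z) `^ p <= d * (eng Y + eng Z) +
    C * (wgt2 p mu (frobC Y) (frobC Z) * frobC (Y - Z) ^+ 2).
Proof.
move=> d0; have t0 : 0 < 2 `^ p :> R by rewrite powR_gt0.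
have [C C0 H] := powR_split p1 (divr_gt0 d0 t0).
exists C => // Y Z; rewrite wgt2E.
apply: le_trans (H _ _ (bra2_ge0 _ _) (frobC_ge0 _) (frobC_sub_le_bra2 Y Z)) _.
rewrite lerD2r -mulrA ler_wpM2l ?(ltW d0)// mulrC ler_pdivrMr// mulrC.
apply: le_trans (powR_add_le p1 (bra_ge0 _) (bra_ge0 _)).
by apply: powR_le; [exact: ltW|exact: bra2_ge0|exact: bra2_le].
Qed.

End energy_density.

(** * Hemicontinuity of the nonlinearity *)

Section hemicontinuity.
Context (R : realType) (N n : nat) (p mu c1 c2 : R) (m1 m2 : nat).
Hypothesis p1 : 1 < p.
Hypothesis mu01 : 0 <= mu <= 1.
Hypothesis N0 : (0 < N)%N.
Hypothesis n0 : (0 < n)%N.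
Hypothesis Vb : V_bounds N n p mu c1 c2.
Hypothesis c1_gt0 : 0 < c1.
Hypothesis c2_gt0 : 0 < c2.
Implicit Types (Y X : 'M[R[i]]_(m1, m2)).

(** The Lipschitz bound followed by [powR_hemi]. The factor [t^(p-1)] vanishes with [t], so
    hemicontinuity of the integrated form follows from this pointwise bound without a passage to the
    limit under the integral. *)
Lemma VmapC_hemicontinuous (d : R) : 0 < d -> exists2 C, 0 < C &
  forall Y X (t : R), 0 < t -> t < 1 ->
  frobC (VmapC p mu (Y + t%:C%C *: X) - VmapC p mu Y) * frobC X <=
    d * (eng p mu Y + frobC X `^ p) + C * (t `^ (p - 1) * frobC X `^ p).
Proof.
move=> d0; have t0 : 0 < 2 `^ p :> R by rewrite powR_gt0.
(* [K] collects [c2] and the constants in [s^p <= 2^p * (2^p * eng Y + |X|^p)], so that the first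
   term ends up with the factor [d]. *)
pose K : R := c2 * (2 `^ p * (2 `^ p) + 2 `^ p + 1).
have K0 : 0 < K by rewrite mulr_gt0// !addr_gt0// mulr_gt0.
have [C C0 H] := powR_hemi p1 (divr_gt0 d0 K0).
exists (c2 * C); first by rewrite mulr_gt0.
move=> Y X t tp t1.
have z0 := frobC_ge0 X; have r0 := frobC_ge0 Y.
have hE : frobC (Y + t%:C%C *: X - Y) = t * frobC X.
  by rewrite addrAC subrr add0r frobCZ normc_real gtr0_norm.
have := VmapC_lipschitz N0 n0 Vb c1_gt0 c2_gt0 (Y + t%:C%C *: X) Y.
rewrite wgt2E; set s := bra2 _ _ _; rewrite hE => lip.
have s0 : 0 <= s by exact: bra2_ge0.
have h0 : 0 <= t * frobC X by rewrite mulr_ge0// ltW.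
have hs : t * frobC X <= 2 * s by rewrite -hE; exact: frobC_sub_le_bra2.
apply: (@le_trans _ _ (c2 * (s `^ (p - 2) * (t * frobC X) * frobC X))).
  by rewrite !mulrA ler_wpM2r// -!mulrA mulrA.
have := H _ _ _ s0 h0 z0 hs; rewrite powRM// ?(ltW tp)//.
rewrite -[X in C * X]mulrA powR_sub1M// => h.
have Xp := powR_ge0 (frobC X) p; have Ep := eng_ge0 p mu Y.
apply: (@le_trans _ _ (c2 * (d / K * (s `^ p + frobC X `^ p) +
   C * (t `^ (p - 1) * frobC X `^ p)))).
  by rewrite ler_wpM2l ?(ltW c2_gt0).
rewrite mulrDr [X in _ + X <= _]mulrA lerD2r.
have sp : s `^ p <= 2 `^ p * (2 `^ p * eng p mu Y + frobC X `^ p).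
  apply: (@le_trans _ _ ((2 * bra mu (frobC Y) + frobC X) `^ p)).
    apply: powR_le; rewrite ?(ltW (lt_trans ltr01 p1))//.
    apply: le_trans (bra2_le _ _ _) _.
    have : bra mu (frobC (Y + t%:C%C *: X)) <= bra mu (frobC Y + frobC X).
      apply: bra_le; first exact: frobC_ge0.
      apply: le_trans (frobC_triangle _ _) _.
      by rewrite lerD2l frobCZ normc_real gtr0_norm// ler_piMl// ltW.
    by have := bra_add_le mu r0 z0; lra.
  apply: le_trans (powR_add_le p1 _ _) _; rewrite ?mulr_ge0 ?bra_ge0//.
  by rewrite powRM ?bra_ge0.
apply: (@le_trans _ _ (c2 * (d / K * ((2 `^ p * (2 `^ p) + 2 `^ p + 1) *
  (eng p mu Y + frobC X `^ p))))).
  rewrite ler_wpM2l ?(ltW c2_gt0)// ler_wpM2l ?divr_ge0 ?(ltW d0) ?(ltW K0)//.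
  set A := 2 `^ p in sp t0 *.
  have AE := mulr_ge0 (ltW t0) Ep; have AX := mulr_ge0 (ltW t0) Xp.
  have AAX := mulr_ge0 (ltW t0) AX.
  apply: (@le_trans _ _ (A * (A * eng p mu Y + frobC X `^ p) + frobC X `^ p)).
    by rewrite lerD2r.
  rewrite -subr_ge0.
  rewrite (_ : _ - _ = A * eng p mu Y + A * (A * frobC X `^ p) + eng p mu Y); last by ring.
  by rewrite !addr_ge0.
rewrite le_eqVlt; apply/orP; left; apply/eqP.
by rewrite mulrCA [c2 * _]mulrA -/K mulrA divfK// gt_eqF.
Qed.

End hemicontinuity.

(** * Integration of almost everywhere measurable functions *)

(* [mu] need not be complete, so a function that is a.e. equal to a measurable
   one need not be measurable; its integral is nevertheless the expected one
   because [integral] is a supremum over simple functions. *)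
Section ae_eq_integral.
Context d (T : measurableType d) (R : realType).
Context (mu : {measure set T -> \bar R}).
Local Open Scope ereal_scope.
Import HBNNSimple.

(** A simple function below [f], set to 0 on the exceptional null set, lies below [g] everywhere and
    keeps its integral. *)
Let ge0_ae_le (f g : T -> \bar R) : (forall x, 0 <= f x) ->
  (forall x, 0 <= g x) -> ae_eq mu setT f g ->
  \int[mu]_x f x <= \int[mu]_x g x.
Proof.
move=> f0 g0 [A [mA A0 Afg]].
rewrite ge0_integralTE// [leRHS]ge0_integralTE//.
apply: ge_ereal_sup => _ [h /= hf <-].
rewrite -integralT_nnsfun (ge0_negligible_integral mA measurableT _ _ A0)//; last 2 first.
- exact/measurable_EFinP.
- by move=> x _; rewrite lee_fin.
rewrite integral_mkcond setTD.
have mCA : measurable (~` A) by exact: measurableC.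
have -> : (fun x => (h x)%:E) \_ (~` A) = EFin \o proj_nnsfun h mCA.
  by rewrite -mrestrict; apply/funext => x; rewrite /= /patch; case: ifP.
rewrite integralT_nnsfun; apply: ereal_sup_ubound.
exists (proj_nnsfun h mCA) => //= x; rewrite mindicE.
have [xA|] := boolP (x \in ~` A); last by rewrite mulr0.
rewrite mulr1; apply: le_trans (hf x) _.
rewrite le_eqVlt; apply/orP; left; apply/eqP; apply: contrapT => fg.
by move: xA; rewrite inE; apply; apply: Afg => /=; apply: contra_not fg; exact.
Qed.

Lemma integral_ae_congr (D : set T) (f g : T -> \bar R) : ae_eq mu D f g ->
  \int[mu]_(x in D) f x = \int[mu]_(x in D) g x.
Proof.
have H (u v : T -> \bar R) : (forall x, 0 <= u x) -> (forall x, 0 <= v x) ->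
    ae_eq mu D u v -> \int[mu]_(x in D) u x = \int[mu]_(x in D) v x.
  move=> u0 v0 uv; rewrite integral_mkcond [RHS]integral_mkcond.
  have uvD : ae_eq mu setT (u \_ D) (v \_ D).
    apply: filterS uv => x uvx _; rewrite !patchE; case: ifPn => // xD.
    by apply: uvx; exact/set_mem.
  have p0 (w : T -> \bar R) x : (forall x, 0 <= w x) -> 0 <= (w \_ D) x.
    by move=> w0; rewrite patchE; case: ifPn.
  by apply/eqP; rewrite eq_le !ge0_ae_le//; try (by move=> x; exact: p0);
    exact: ae_eq_sym.
move=> fg; rewrite integralE [RHS]integralE; congr (_ - _);
  apply: H => //; have [h1 h2] := (ae_eq_funeposneg mu D f g).1 fg; by [].
Qed.

Lemma Rintegral_ae_congr (D : set T) (f g : T -> R) : ae_eq mu D f g ->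
  (\int[mu]_(x in D) f x = \int[mu]_(x in D) g x)%R.
Proof.
move=> fg; congr fine; apply: integral_ae_congr.
by apply: filterS fg => x fgx Dx; rewrite fgx.
Qed.

End ae_eq_integral.

Section ae_integrable.
Context d (T : measurableType d) (R : realType).
Context (mu : {measure set T -> \bar R}) (D : set T).
Hypothesis mD : measurable D.
Hypothesis D_fin : (mu D < +oo)%E.
Implicit Types f g : T -> R.

(** Both notions carry a measurable representative because the measure need not be complete; for
    [lebesgue_rV], [aem] unfolds to the notion [ae_measurable] of the statement. *)
Definition aem f := exists2 g, measurable_fun D g & ae_eq mu D f g.
Definition aei f :=
  exists2 g, mu.-integrable D (EFin \o g) & ae_eq mu D f g.

Local Notation I f := (\int[mu]_(x in D) f x)%R.

Lemma measurable_aem f : measurable_fun D f -> aem f.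
Proof. by move=> mf; exists f => //; exact: ae_eq_refl. Qed.

Lemma aem_comp (h : R -> R) f : measurable_fun setT h -> aem f -> aem (h \o f).
Proof.
move=> mh [g mg fg]; exists (h \o g); first exact: measurableT_comp.
by apply: filterS fg => x fgx Dx /=; rewrite fgx.
Qed.

Lemma aem_comp2 (h : R -> R -> R) f1 f2 :
  (forall g1 g2, measurable_fun D g1 -> measurable_fun D g2 ->
     measurable_fun D (fun x => h (g1 x) (g2 x))) ->
  aem f1 -> aem f2 -> aem (fun x => h (f1 x) (f2 x)).
Proof.
move=> mh [g1 mg1 e1] [g2 mg2 e2]; exists (fun x => h (g1 x) (g2 x)).
  exact: mh.
by apply: filterS2 e1 e2 => x h1 h2 Dx /=; rewrite h1// h2.
Qed.

Lemma aemD f1 f2 : aem f1 -> aem f2 -> aem (fun x => f1 x + f2 x).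
Proof. by apply: (@aem_comp2 +%R) => *; exact: measurable_funD. Qed.
Lemma aemB f1 f2 : aem f1 -> aem f2 -> aem (fun x => f1 x - f2 x).
Proof. by apply: (@aem_comp2 (fun x y => x - y)) => *; exact: measurable_funB. Qed.
Lemma aemM f1 f2 : aem f1 -> aem f2 -> aem (fun x => f1 x * f2 x).
Proof. by apply: (@aem_comp2 *%R) => *; exact: measurable_funM. Qed.
Lemma aem_cst c : aem (fun=> c).
Proof. exact/measurable_aem/measurable_cst. Qed.
Lemma aem_sum (J : Type) (s : seq J) (f : J -> T -> R) :
  (forall j, aem (f j)) -> aem (fun x => \sum_(j <- s) f j x).
Proof.
move=> mf; elim: s => [|j s IH].
  by under eq_fun do rewrite big_nil; exact: aem_cst.
by under eq_fun do rewrite big_cons; exact: aemD.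
Qed.

Lemma aei_aem f : aei f -> aem f.
Proof.
move=> [g /integrableP[mg _] fg]; exists g => //; exact/measurable_EFinP.
Qed.

Lemma aeiP f : aei f <-> aem f /\ (\int[mu]_(x in D) `|f x|%:E < +oo)%E.
Proof.
split=> [[g ig fg]|[[g mg fg] foo]].
  split; first by apply: aei_aem; exists g.
  rewrite (@integral_ae_congr _ _ _ _ _ _ (fun x => `|g x|%:E)).
    by case/integrableP : ig.
  by apply: filterS fg => x fgx Dx; rewrite fgx.
exists g => //; apply/integrableP; split; first exact/measurable_EFinP.
rewrite (@integral_ae_congr _ _ _ _ _ _ (fun x => `|f x|%:E))//.
by apply: filterS fg => x fgx Dx /=; rewrite fgx.
Qed.

Lemma aei_normr f : aei f -> aei (fun x => `|f x|).
Proof.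
move=> /aeiP[mf foo]; apply/aeiP; split; first exact: (aem_comp (h := fun y => `|y|)).
by under eq_integral do rewrite normr_id.
Qed.

Lemma aeiD f1 f2 : aei f1 -> aei f2 -> aei (fun x => f1 x + f2 x).
Proof.
move=> [g1 i1 e1] [g2 i2 e2]; exists (fun x => g1 x + g2 x).
  exact: (integrableD mD i1 i2).
by apply: filterS2 e1 e2 => x h1 h2 Dx /=; rewrite h1// h2.
Qed.

Lemma aeiZ c f : aei f -> aei (fun x => c * f x).
Proof.
move=> [g ig fg]; exists (fun x => c * g x).
  by have := integrableZl mD c ig; apply: eq_integrable.
by apply: filterS fg => x fgx Dx /=; rewrite fgx.
Qed.

Lemma aeiB f1 f2 : aei f1 -> aei f2 -> aei (fun x => f1 x - f2 x).
Proof.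
move=> i1 i2; have := aeiD i1 (aeiZ (-1) i2).
by congr aei; apply/funext => x; rewrite mulN1r.
Qed.

Lemma aei_cst c : aei (fun=> c).
Proof.
exists (cst c); last exact: ae_eq_refl.
apply: measurable_bounded_integrable => //.
by exists `|c|; split => // M cM x _ /=; exact: ltW.
Qed.

Lemma aei_sum (J : Type) (s : seq J) (f : J -> T -> R) :
  (forall j, aei (f j)) -> aei (fun x => \sum_(j <- s) f j x).
Proof.
move=> mf; elim: s => [|j s IH].
  by under eq_fun do rewrite big_nil; exact: aei_cst.
by under eq_fun do rewrite big_cons; exact: aeiD.
Qed.

Lemma aei_le f g : aem f -> aei g -> (forall x, D x -> `|f x| <= g x) -> aei f.
Proof.
move=> mf /aeiP[[g' mg' gg'] goo] fg; apply/aeiP; split => //.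
have [f' mf' ff'] := mf; apply: le_lt_trans goo.
rewrite (@integral_ae_congr _ _ _ _ _ _ (fun x => `|f' x|%:E)); last first.
  by apply: filterS ff' => x h Dx; rewrite h.
rewrite [leRHS](@integral_ae_congr _ _ _ _ _ _ (fun x => `|g' x|%:E)); last first.
  by apply: filterS gg' => x h Dx; rewrite h.
apply: ae_ge0_le_integral => //.
- by apply/measurable_EFinP; exact: measurableT_comp.
- by apply/measurable_EFinP; exact: measurableT_comp.
apply: filterS2 ff' gg' => x h1 h2 Dx; rewrite lee_fin -h1// -h2//.
exact: le_trans (fg x Dx) (ler_norm _).
Qed.

Lemma intD f1 f2 : aei f1 -> aei f2 -> I (fun x => f1 x + f2 x) = I f1 + I f2.
Proof.
move=> [g1 i1 e1] [g2 i2 e2].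
rewrite (Rintegral_ae_congr e1) (Rintegral_ae_congr e2) -RintegralD//.
by apply: Rintegral_ae_congr; apply: filterS2 e1 e2 => x h1 h2 Dx; rewrite h1 ?h2.
Qed.

Lemma intZ c f : aei f -> I (fun x => c * f x) = c * I f.
Proof.
move=> [g ig fg]; rewrite (Rintegral_ae_congr fg) -RintegralZl//.
by apply: Rintegral_ae_congr; apply: filterS fg => x h Dx; rewrite h.
Qed.

Lemma intB f1 f2 : aei f1 -> aei f2 -> I (fun x => f1 x - f2 x) = I f1 - I f2.
Proof.
move=> i1 i2; rewrite -mulN1r -intZ// -intD//; last exact: aeiZ.
by congr Rintegral; apply/funext => x; rewrite mulN1r.
Qed.

Lemma int_cst c : I (fun=> c) = c * fine (mu D).
Proof. exact: Rintegral_cst. Qed.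

Lemma int_sum (J : Type) (s : seq J) (f : J -> T -> R) :
  (forall j, aei (f j)) ->
  I (fun x => \sum_(j <- s) f j x) = \sum_(j <- s) I (f j).
Proof.
move=> mf; elim: s => [|j s IH].
  by under eq_fun do rewrite big_nil; rewrite big_nil int_cst mul0r.
under eq_fun do rewrite big_cons; rewrite big_cons intD ?IH//.
exact: aei_sum.
Qed.

Lemma int_ae_le f g : aei f -> aei g -> (\forall x \ae mu, D x -> f x <= g x) ->
  I f <= I g.
Proof.
move=> [f' if' ff'] [g' ig' gg'] fg.
rewrite (Rintegral_ae_congr ff') (Rintegral_ae_congr gg').
(* The maximum equals [g'] almost everywhere and dominates [f'] everywhere, as the monotonicity of
   the integral requires. *)
have -> : I g' = I (fun x => Num.max (f' x) (g' x)).
  apply: Rintegral_ae_congr; apply: filterS3 ff' gg' fg => x h1 h2 h3 Dx.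
  by rewrite max_r// -h1// -h2// h3.
apply: le_Rintegral => // [|x _]; last by rewrite le_max lexx.
have iM : mu.-integrable D (EFin \o (fun x => `|f' x| + `|g' x|)).
  by have := integrableD mD (integrable_norm if') (integrable_norm ig').
apply: le_integrable iM => //.
  apply/measurable_EFinP; apply: measurable_maxr; apply/measurable_EFinP.
    by case/integrableP : if'.
  by case/integrableP : ig'.
move=> x Dx /=; rewrite lee_fin (ger0_norm (addr_ge0 _ _))//.
by case: (leP (f' x) (g' x)) => _; rewrite ?lerDl ?lerDr.
Qed.

Lemma int_le f g : aei f -> aei g -> (forall x, D x -> f x <= g x) -> I f <= I g.
Proof. by move=> *; apply: int_ae_le => //; exact: aeW. Qed.

Lemma int_norm_le f g : aei f -> aei g -> (forall x, D x -> `|f x| <= g x) ->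
  `|I f| <= I g.
Proof.
move=> fi gi fg; rewrite ler_norml; apply/andP; split.
  rewrite -mulN1r -intZ//; apply: int_le => //; first exact: aeiZ.
  by move=> x /fg; rewrite ler_norml mulN1r => /andP[].
by apply: int_le => // x /fg; rewrite ler_norml => /andP[].
Qed.

Lemma int_eq0 f : aei f -> (forall x, D x -> 0 <= f x) -> I f = 0 ->
  ae_eq mu D f (cst 0).
Proof.
move=> [g ig fg] f0; rewrite (Rintegral_ae_congr fg) => Ig0.
suff : ae_eq mu D g (cst 0) by exact: ae_eq_trans.
have : ae_eq mu D (EFin \o g) (cst 0%E).
  apply/ae_eq_integral_abs => //; first exact: (measurable_int mu).
  rewrite (@integral_ae_congr _ _ _ _ _ _ (EFin \o g)).
    have := integrable_fin_num mD ig; move: Ig0; rewrite /Rintegral.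
    by move=> + /fineK <- => /= ->.
  by apply: filterS fg => x h Dx /=; rewrite ger0_norm// -h// f0.
by apply: filterS => x h Dx; have [] := h Dx.
Qed.

End ae_integrable.

(** * Completeness of scalar L^p on a set of finite measure *)

Section lp_complete.
Context d (T : measurableType d) (R : realType).
Context (mu : {measure set T -> \bar R}) (D : set T) (p : R).
Hypothesis p1 : 1 < p.
Hypothesis mD : measurable D.
Hypothesis D_fin : (mu D < +oo)%E.

Local Notation I f := (\int[mu]_(x in D) f x)%R.
Local Notation aem := (aem mu D).
Local Notation aei := (aei mu D).

Let p0 : 0 < p. Proof. exact: lt_trans p1. Qed.

Lemma measurable_powR_comp (f : T -> R) : measurable_fun D f ->
  measurable_fun D (fun x => f x `^ p).
Proof. by move=> mf; apply: (measurableT_comp (measurable_powR p)). Qed.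

Lemma aem_powR (f : T -> R) : aem f -> aem (fun x => f x `^ p).
Proof. by move=> mf; apply: (aem_comp (h := fun y => y `^ p)). Qed.

Lemma aem_normr (f : T -> R) : aem f -> aem (fun x => `|f x|).
Proof. by move=> mf; apply: (aem_comp (h := fun y => `|y|)). Qed.

Lemma lp_abs_aei (f : T -> R) : aem f -> aei (fun x => `|f x| `^ p) -> aei f.
Proof.
move=> mf fp.
apply: (aei_le mD mf (g := fun x => 1 + 1^-1 `^ (p - 1) * `|f x| `^ p)).
  by apply: aeiD => //; [exact: aei_cst|exact: aeiZ].
by move=> x _; exact: powR_linear.
Qed.

Lemma cvg_abs_powR (u : nat -> R) (l : R) : u @ \oo --> l ->
  (fun k => `|u k| `^ p) @ \oo --> `|l| `^ p.
Proof.
move=> ul; have {}ul : (fun k => `|u k|) @ \oo --> `|l| by exact: cvg_norm.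
have [l0|l0] := eqVneq l 0; last first.
  have c : {for `|l|, continuous (fun y : R => y `^ p)}.
    apply/differentiable_continuous/derivable1_diffP.
    by apply: derivable_powR; rewrite in_itv/= andbT normr_gt0.
  exact: (cvg_comp _ _ ul c).
(* The differentiability argument covers positive bases only; at 0 the tolerance [e^(1/p)] is used
   directly. *)
rewrite l0 normr0 powR0 ?gt_eqF//; rewrite l0 normr0 in ul.
apply/cvgrPdist_lt => e e0; have ep : 0 < e `^ p^-1 by rewrite powR_gt0.
move/cvgrPdist_lt/(_ _ ep): ul; apply: filterS => k.
rewrite !sub0r !normrN normr_id (ger0_norm (powR_ge0 _ _)) => h.
have -> : e = (e `^ p^-1) `^ p by rewrite -powRrM mulVf ?gt_eqF// powRr1// ltW.
by apply: gt0_ltr_powR; rewrite // ?nnegrE// ltW.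
Qed.

(* An [L^p] sequence that is Cauchy at a geometric rate converges a.e., and
   Fatou's lemma identifies the a.e. limit as its [L^p] limit. *)
Lemma lp_complete : exists eps : nat -> R,
  [/\ forall k, 0 < eps k,
      forall e, 0 < e -> exists k0, forall k, (k0 <= k)%N -> eps k < e &
      forall f : nat -> T -> R, (forall k, aem (f k)) ->
        (forall k, aei (fun x => `|f k x| `^ p)) ->
        (forall k m, (k <= m)%N -> I (fun x => `|f k x - f m x| `^ p) < eps k) ->
        exists g, [/\ aem g, aei (fun x => `|g x| `^ p) &
          forall k, aei (fun x => `|f k x - g x| `^ p) /\
                    I (fun x => `|f k x - g x| `^ p) <= eps k]].
Proof.
pose dd (k : nat) : R := (2 ^ k.+1)%:R^-1.
have dd0 k : 0 < dd k by rewrite invr_gt0 ltr0n expn_gt0.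
have dd1 k : dd k <= 1 by rewrite invf_le1 ?ltr0n ?expn_gt0// ler1n expn_gt0.
have /choice[C CP] : forall k, exists C, 0 < C /\
    forall a : R, 0 <= a -> a <= dd k + C * a `^ p.
  move=> k; exists ((dd k)^-1 `^ (p - 1)); split; last by move=> a a0; exact: powR_linear.
  by rewrite powR_gt0// invr_gt0.
(* The bound [dd k / C k] makes consecutive differences at most [(fine (mu D) + 1) * dd k] in L^1,
   which is summable; the bound [dd k] forces the rate to tend to 0. *)
pose eps k := Num.min (dd k / C k) (dd k).
have eps0 k : 0 < eps k by rewrite lt_min dd0 divr_gt0//; case: (CP k).
exists eps; split => // [e e0|f mf fp fcau].
  have [k0 _ Hk0] : \forall k \near \oo, (k.+1%:R^-1 : R) < e.
    exact: (near_infty_natSinv_lt (PosNum e0)).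
  exists k0 => k k0k; apply: le_lt_trans (Hk0 _ k0k).
  rewrite ge_min; apply/orP; right; rewrite lef_pV2 ?posrE ?ltr0n ?expn_gt0//.
  by rewrite ler_nat ltnW// ltn_expl.
have /choice[g gP] : forall k, exists g, measurable_fun D g /\ ae_eq mu D (f k) g.
  by move=> k; have [g mg fg] := mf k; exists g.
have mg k : measurable_fun D (g k) by case: (gP k).
have fg k : ae_eq mu D (f k) (g k) by case: (gP k).
have aemg k : aem (g k) by exact: measurable_aem.
have gp k : aei (fun x => `|g k x| `^ p).
  have [u ui fu] := fp k; exists u => //; apply: filterS2 (fg k) fu => x h1 h2 Dx.
  by rewrite -h2// h1.
have powB (u v : T -> R) : aem u -> aem v -> aei (fun x => `|u x| `^ p) ->
    aei (fun x => `|v x| `^ p) -> aei (fun x => `|u x - v x| `^ p).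
  move=> mu' mv iu iv.
  apply: (aei_le mD _ (g := fun x => 2 `^ p * (`|u x| `^ p + `|v x| `^ p))).
  - by apply/aem_powR/aem_normr; exact: aemB.
  - by apply: aeiZ => //; exact: aeiD.
  move=> x _; rewrite ger0_norm ?powR_ge0//.
  apply: le_trans (powR_add_le p1 _ _) => //.
  by apply: powR_le => //; [exact: ltW|exact: ler_normB].
have gcau k m : (k <= m)%N -> I (fun x => `|g k x - g m x| `^ p) < eps k.
  move=> km; rewrite -(@Rintegral_ae_congr _ _ _ _ _ (fun x => `|f k x - f m x| `^ p)).
    exact: fcau.
  by apply: filterS2 (fg k) (fg m) => x h1 h2 Dx; rewrite h1// h2.
pose h k x := `|g k.+1 x - g k x|.
have mh k : measurable_fun D (h k).
  by apply: measurableT_comp => //; exact: measurable_funB.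
have h0 k x : 0 <= h k x by exact: normr_ge0.
have hi k : aei (h k).
  apply: lp_abs_aei; first exact: measurable_aem.
  under eq_fun do rewrite normr_id; exact: powB.
have hint k : (\int[mu]_(x in D) (h k x)%:E <= ((fine (mu D) + 1) * dd k)%:E)%E.
  have fin : (\int[mu]_(x in D) (h k x)%:E)%E \is a fin_num.
    have [u ui hu] := hi k; rewrite (@integral_ae_congr _ _ _ _ _ _ (EFin \o u)).
      exact: integrable_fin_num.
    by apply: filterS hu => x H Dx; rewrite H.
  rewrite -(fineK fin) lee_fin -/(Rintegral mu D (h k)).
  have [C0 HC] := CP k.
  apply: (@le_trans _ _ (I (fun x => dd k + C k * `|g k x - g k.+1 x| `^ p))).
    apply: int_le => //; first exact: hi.
      by apply: aeiD => //; [exact: aei_cst|apply: aeiZ => //; exact: powB].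
    by move=> x _; rewrite /h distrC; exact: HC.
  rewrite intD//; [|exact: aei_cst|by apply: aeiZ => //; exact: powB].
  rewrite intZ//; last exact: powB.
  rewrite int_cst// mulrDl mul1r mulrC lerD2l.
  rewrite mulrC -ler_pdivlMr//; apply: ltW; apply: lt_le_trans (gcau k k.+1 _) _ => //.
  by rewrite ge_min lexx.
pose S x := (\sum_(k <oo) (h k x)%:E)%E.
have mS : measurable_fun D S.
  apply: ge0_emeasurable_sum => [k x _ _|k _]; first by rewrite lee_fin.
  exact/measurable_EFinP.
have S0 x : (0 <= S x)%E by apply: nneseries_ge0 => k _ _; rewrite lee_fin.
have Sint : mu.-integrable D S.
  apply/integrableP; split => //; under eq_integral do rewrite gee0_abs//.
  rewrite integral_nneseries//; last 2 first.
  - by move=> k; exact/measurable_EFinP.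
  - by move=> *; rewrite lee_fin.
  have K0 : 0 <= fine (mu D) + 1 by rewrite addr_ge0// fine_ge0.
  apply: (@le_lt_trans _ _ (\sum_(k <oo) ((fine (mu D) + 1) / (2 ^ k.+1)%:R)%:E)%E).
    apply: lee_nneseries => [k _ _|k _]; last exact: hint.
    by apply: integral_ge0 => x _; rewrite lee_fin.
  apply: le_lt_trans (epsilon_trick0 xpredT K0) _; exact: ltry.
have gcvg : \forall x \ae mu, D x -> cvgn (fun k => g k x).
  have := integrable_ae mD Sint; apply: filterS => x Sx Dx.
  have {}Sx := Sx Dx.
  have : cvgn (series (telescope (fun k => g k x))).
    apply: normed_cvg; apply: nondecreasing_is_cvgn.
      by apply: nondecreasing_series => k _ _; exact: normr_ge0.
    exists (fine (S x)) => _ [n _ <-]; rewrite -lee_fin fineK//.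
    rewrite /series/= -sumEFin.
    apply: (nneseries_lim_ge n (u_ := fun k => (h k x)%:E)) => k _ _; rewrite lee_fin//.
  rewrite telescopeK => /cvg_ex[l gl]; apply/cvg_ex; exists (l + g 0%N x).
  rewrite (_ : (fun k => g k x) = (fun k => (g k x - g 0%N x) + g 0%N x)).
    by apply: cvgD => //; exact: cvg_cst.
  by apply/funext => k; rewrite subrK.
(* The upper limit is measurable on all of [D] and agrees with the limit where that exists; the
   default value of [fine] at infinity concerns a null set only. *)
pose G x := fine (limn_esup (fun k => (g k x)%:E)).
have mG : measurable_fun D G.
  apply: measurableT_comp; first exact: fine_measurable.
  by apply: measurable_fun_limn_esup => k; exact/measurable_EFinP.
have gG : \forall x \ae mu, D x -> g ^~ x @ \oo --> G x.
  apply: filterS gcvg => x gx Dx; have /cvg_ex[l gl] := gx Dx.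
  have : (fun k => (g k x)%:E) @ \oo --> l%:E.
    by apply: cvg_EFin; first exact: nearW.
  by move=> /cvg_limn_einf_sup[_ E]; rewrite /G E.
have aemG : aem G by exact: measurable_aem.
have fat k : (\int[mu]_(x in D) (`|g k x - G x| `^ p)%:E <= (eps k)%:E)%E.
  have mgm m : measurable_fun D (fun x => (`|g k x - g m x| `^ p)%:E).
    apply/measurable_EFinP/measurable_powR_comp; apply: measurableT_comp => //.
    exact: measurable_funB.
  have := @fatou _ _ _ mu D mD (fun m x => (`|g k x - g m x| `^ p)%:E) mgm
     (ltac:(by move=> m x _; rewrite lee_fin powR_ge0)).
  rewrite (@integral_ae_congr _ _ _ _ _ _ (fun x => (`|g k x - G x| `^ p)%:E)).
    move/le_trans; apply.
    rewrite limn_einf_lim; apply: lime_le; first exact: is_cvg_einfs.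
    apply: nearW => n; apply: ge_ereal_inf.
    (* The index has to lie in the tail from [n] and also be at least [k], where the Cauchy bound
       holds. *)
    exists (\int[mu]_(x in D) (`|g k x - g (maxn n k) x| `^ p)%:E)%E.
      by exists (maxn n k) => //=; exact: leq_maxl.
    have igm : aei (fun x => `|g k x - g (maxn n k) x| `^ p) by exact: powB.
    rewrite -[leLHS]fineK.
      by rewrite lee_fin; apply/ltW/gcau; exact: leq_maxr.
    have [u ui hu] := igm; rewrite (@integral_ae_congr _ _ _ _ _ _ (EFin \o u)).
      exact: integrable_fin_num.
    by apply: filterS hu => x H Dx; rewrite H.
  apply: filterS gG => x gx Dx /=.
  apply: (fst (cvg_limn_einf_sup _)); apply: cvg_EFin.
    by apply: nearW.
  apply: (@cvg_abs_powR (fun m => g k x - g m x)).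
  by apply: cvgB; [exact: cvg_cst|exact: gx].
have igG k : aei (fun x => `|g k x - G x| `^ p).
  apply/aeiP; split; first by apply/aem_powR/aem_normr; exact: aemB.
  under eq_integral do rewrite ger0_norm ?powR_ge0//.
  exact: le_lt_trans (fat k) (ltry _).
have Gp : aei (fun x => `|G x| `^ p).
  have := powB (fun x => g 0%N x) (fun x => g 0%N x - G x) (aemg _) (aemB (aemg _) aemG) (gp _) (igG _).
  by under eq_fun do rewrite opprB addrC subrK.
exists G; split => // k.
have e : ae_eq mu D (fun x => `|f k x - G x| `^ p) (fun x => `|g k x - G x| `^ p).
  by apply: filterS (fg k) => x h1 Dx; rewrite h1.
split.
  have [u ui hu] := igG k; exists u => //; exact: ae_eq_trans e hu.
rewrite (Rintegral_ae_congr e) -lee_fin /Rintegral fineK; first exact: fat.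
have [u ui hu] := igG k; rewrite (@integral_ae_congr _ _ _ _ _ _ (EFin \o u)).
  exact: integrable_fin_num.
by apply: filterS hu => x H Dx; rewrite H.
Qed.

End lp_complete.

(** * The Poincare inequality for test functions *)

Section poincare_line.
Context (R : realType) (p L : R) (g g' : R -> R).
Hypothesis p1 : 1 < p.
Hypothesis L0 : 0 < L.
Hypothesis dg : forall x : R, is_derive x (1 : R) g (g' x).
Hypothesis cg' : continuous g'.
Hypothesis g_supp : forall x, L <= `|x| -> g x = 0.
Local Notation leb := (@lebesgue_measure R).

Let p0 : 0 < p. Proof. exact: lt_trans p1. Qed.
Let D : set R := `[(- L), L]%classic.
Let mD : measurable D. Proof. exact: measurable_itv. Qed.
Let LL : - L < L. Proof. by rewrite gt0_cp. Qed.
Let D_val : (leb D = (2 * L)%:E)%E.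
Proof.
rewrite /D lebesgue_measure_itv/= lte_fin LL -EFinB; congr EFin; ring.
Qed.
Let D_fin : (leb D < +oo)%E. Proof. by rewrite D_val ltry. Qed.

Let cg : continuous g.
Proof.
by move=> x; apply/differentiable_continuous/derivable1_diffP; exact: ex_derive.
Qed.

Let mg'p : measurable_fun setT (fun x => `|g' x| `^ p).
Proof.
apply: (measurableT_comp (measurable_powR p)).
apply: measurableT_comp => //; exact: continuous_measurable_fun.
Qed.

Let cont_aei (D' : set R) (h : R -> R) : compact D' -> measurable D' ->
  continuous h -> aei leb D' h.
Proof.
move=> cD' mD' ch; exists h; last exact: ae_eq_refl.
apply: continuous_compact_integrable => //; exact: continuous_subspaceT.
Qed.

Let aei_g'p : aei leb D (fun x => `|g' x| `^ p).
Proof.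
have := @cont_aei D g' (@segment_compact _ _ _) mD cg'.
have [M gM] : exists M, forall x, D x -> `|g' x| <= M.
  have : compact (g' @` D).
    by apply: continuous_compact; [exact: continuous_subspaceT|exact: segment_compact].
  move=> /compact_bounded[M [_ HM]]; exists (M + 1) => x Dx.
  by apply: (HM (M + 1)); [rewrite ltrDl|exists x].
move=> _; have := @aei_le _ _ R leb D mD (fun x => `|g' x| `^ p) (fun=> M `^ p); apply.
- by apply/measurable_aem/measurable_funTS; exact: mg'p.
- exact: aei_cst.
- move=> x Dx; rewrite ger0_norm ?powR_ge0//.
  by apply: powR_le => //; [exact: ltW|exact: gM].
Qed.

Let J := (\int[leb]_(x in D) (`|g' x| `^ p))%R.

(** Integrating [g'] from [-L], where [g] vanishes, bounds [|g s|] by the L^1 norm of [g'];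
    [powR_linear] with an optimal parameter then gives the L^p norm. *)
Lemma poincare_line_pointwise s : `|g s| `^ p <= (2 * L + 1) `^ p * J.
Proof.
have J0 : 0 <= J by apply: Rintegral_ge0 => x _; exact: powR_ge0.
have [Ls|sL] := leP L `|s|.
  by rewrite g_supp// normr0 powR0 ?gt_eqF// mulr_ge0 ?powR_ge0.
move: sL; rewrite ltr_norml => /andP[Ls sL].
have ign : aei leb D (fun x => `|g' x|).
  apply: cont_aei => //; first exact: segment_compact.
  by move=> x; apply: cvg_norm; exact: cg'.
have gs : `|g s| <= (\int[leb]_(x in D) `|g' x|)%R.
  have FTC : (\int[leb]_(x in `[(- L)%R, s]) (g' x)%:E = (g s)%:E - (g (- L)%R)%:E)%E.
    apply: continuous_FTC2 => //; first exact: continuous_subspaceT.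
      split; first by move=> x _; exact: ex_derive.
      - by apply: cvg_at_right_filter; exact: cg.
      - by apply: cvg_at_left_filter; exact: cg.
    by move=> x _; rewrite derive1E derive_val.
  have -> : g s = (\int[leb]_(x in `[(- L), s]) g' x)%R.
    by rewrite /Rintegral FTC (g_supp (x := - L)) ?normrN ?ger0_norm ?(ltW L0)// sube0.
  have cs : compact `[(- L), s]%classic by exact: segment_compact.
  have ms : measurable `[(- L), s]%classic by exact: measurable_itv.
  apply: (@le_trans _ _ (\int[leb]_(x in `[(- L), s]) `|g' x|)%R).
    apply: le_normr_Rintegral => //.
    by apply: continuous_compact_integrable => //; exact: continuous_subspaceT.
  rewrite /Rintegral fine_le//.
  - apply: integrable_fin_num => //; apply: continuous_compact_integrable => //.
    by apply: continuous_subspaceT => x; apply: cvg_norm; exact: cg'.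
  - apply: integrable_fin_num => //; apply: continuous_compact_integrable => //.
      exact: segment_compact.
    by apply: continuous_subspaceT => x; apply: cvg_norm; exact: cg'.
  apply: ge0_subset_integral => //.
    apply/measurable_EFinP; apply: measurable_funTS; apply: measurableT_comp => //.
    exact: continuous_measurable_fun.
  by move=> x; rewrite /D /= !in_itv/= => /andP[-> /le_trans]; apply; exact: ltW.
have young (d : R) : 0 < d -> `|g s| <= d * (2 * L) + d^-1 `^ (p - 1) * J.
  move=> d0; apply: le_trans gs _.
  apply: (@le_trans _ _ (\int[leb]_(x in D) (d + d^-1 `^ (p - 1) * `|g' x| `^ p))%R).
    apply: int_le => //; first by apply: aeiD => //; [exact: aei_cst|exact: aeiZ].
    by move=> x _; exact: powR_linear.
  rewrite intD//; [|exact: aei_cst|exact: aeiZ].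
  rewrite int_cst// intZ// (_ : fine _ = 2 * L)//.
  exact: (congr1 fine D_val).
have [Jz|Jn] := eqVneq J 0.
  have -> : `|g s| = 0.
    apply/eqP; rewrite eq_le normr_ge0 andbT; apply/ler_addgt0Pr => e e0.
    have d0 : 0 < e / (2 * L) by rewrite divr_gt0// mulr_gt0.
    have := young _ d0; rewrite Jz mulr0 addr0 add0r divfK//.
    by rewrite gt_eqF// mulr_gt0.
  by rewrite powR0 ?gt_eqF// mulr_ge0 ?powR_ge0.
have Jp : 0 < J by rewrite lt_neqAle eq_sym Jn.
(* With [d = J^(1/p)] the last term of [young] equals [d], and [|g s| <= (2 * L + 1) * d]. For
   [J = 0] the parameter was sent to 0 instead. *)
pose d := J `^ p^-1; have d0 : 0 < d by rewrite powR_gt0.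
have dp : d `^ p = J by rewrite /d -powRrM mulVf ?gt_eqF// powRr1.
have dJ : d^-1 `^ (p - 1) * J = d.
  rewrite -{1}dp -(powR_sub1M p1 (ltW d0)) mulrA -powRM ?invr_ge0 ?(ltW d0)//.
  by rewrite mulVf ?gt_eqF// powR1 mul1r.
rewrite -[X in _ * X]dp -powRM ?addr_ge0 ?mulr_ge0 ?(ltW L0) ?(ltW d0)//.
apply: powR_le => //; first exact: ltW.
by have := young _ d0; rewrite dJ; lra.
Qed.

(** Stated over the whole line with extended real values, so that Tonelli's theorem can integrate it
    over the remaining coordinates. *)
Lemma poincare_line :
  (\int[leb]_x (`|g x| `^ p)%:E <=
   (2 * L * (2 * L + 1) `^ p)%:E * \int[leb]_x (`|g' x| `^ p)%:E)%E.
Proof.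
have J0 : 0 <= J by apply: Rintegral_ge0 => x _; exact: powR_ge0.
have mgp : measurable_fun setT (fun x => (`|g x| `^ p)%:E).
  apply/measurable_EFinP/(measurableT_comp (measurable_powR p)).
  by apply: measurableT_comp => //; exact: continuous_measurable_fun.
have -> : (\int[leb]_x (`|g x| `^ p)%:E = \int[leb]_(x in D) (`|g x| `^ p)%:E)%E.
  rewrite [RHS]integral_mkcond; apply: eq_integral => x _; rewrite patchE.
  case: ifPn => // xD; rewrite g_supp ?normr0 ?powR0 ?gt_eqF//.
  rewrite leNgt; apply/negP => xL; move/negP: xD; apply; rewrite inE /D/= in_itv/=.
  by move: xL; rewrite ltr_norml => /andP[/ltW -> /ltW ->].
apply: (@le_trans _ _ (\int[leb]_(x in D) ((2 * L + 1) `^ p * J)%:E)%E).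
  apply: ge0_le_integral => //.
  - exact: measurable_funTS.
  - by move=> x _; rewrite lee_fin poincare_line_pointwise.
rewrite integral_cst// [X in (_ * X <= _)%E](_ : _ = (2 * L)%:E) ?D_val// -EFinM mulrC mulrA [leLHS]EFinM.
apply: lee_wpmul2l; first by rewrite lee_fin !mulr_ge0 ?powR_ge0 ?(ltW L0).
have [u ui hu] := aei_g'p.
have fin : (\int[leb]_(x in D) (`|g' x| `^ p)%:E)%E \is a fin_num.
  rewrite (@integral_ae_congr _ _ _ _ _ _ (EFin \o u)).
    exact: integrable_fin_num.
  by apply: filterS hu => x H Dx; rewrite H.
rewrite /J /Rintegral fineK//; apply: ge0_subset_integral => //.
exact/measurable_EFinP.
Qed.

End poincare_line.

Lemma continuous_measurable_rV (R : realType) n (f : 'rV[R]_n -> R) :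
  continuous f -> measurable_fun setT f.
Proof.
move=> /continuousP cf; apply: (measurability _ (RGenOpens.measurableE R)).
move=> _ [_ [a [b ->] <-]]; rewrite setTI; apply: open_measurable_rV.
exact/cf/interval_open.
Qed.

Lemma tonelli_rV (R : realType) n (f : 'rV[R]_n.+1 -> \bar R) :
  measurable_fun setT f -> (forall x, (0 <= f x)%E) ->
  (\int[lebesgue_rV R n.+1]_x f x =
   \int[lebesgue_rV R n]_v \int[@lebesgue_measure R]_s f (rV_cons (s, v)))%E.
Proof.
move=> mf f0.
transitivity (\int[(@lebesgue_measure R \x lebesgue_rV R n)%E]_z f (rV_cons z))%E.
  by have := @ge0_integral_pushforward _ _ _ _ _ _ (@measurable_rV_cons R n)
    (@lebesgue_measure R \x lebesgue_rV R n)%E setT f measurableT mf (fun x _ => f0 x).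
rewrite (fubini_tonelli2 (fun z => f (rV_cons z)))//.
by apply: (measurableT_comp mf); exact: measurable_rV_cons.
Qed.

Section test_functions.
Context (R : realType) (n : nat) (Omega : set 'rV[R]_n).
Implicit Type phi : 'rV[R]_n -> R^o.

Lemma test_fun_continuous phi : test_fun Omega phi -> continuous phi.
Proof. by move=> [sphi _ _]; have [] := sphi [::]. Qed.

Lemma test_fun_derivable phi j x : test_fun Omega phi ->
  derivable phi x (delta_mx ord0 j).
Proof. by move=> [sphi _ _]; have [_] := sphi [::]; apply. Qed.

Lemma test_fun_partial_continuous phi j :
  test_fun Omega phi -> continuous (partial j phi).
Proof. by move=> [sphi _ _]; have [] := sphi [:: j]. Qed.

Lemma test_fun_out phi x : test_fun Omega phi -> ~ Omega x -> phi x = 0.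
Proof.
move=> [_ _ sub] nx; apply: contrapT => /eqP px; apply: nx; apply: sub.
exact: subset_closure.
Qed.

Lemma test_fun_partial_out phi j x : test_fun Omega phi -> ~ Omega x ->
  partial j phi x = 0.
Proof.
move=> [_ _ sub] nx; rewrite /partial.
have nc : ~ closure [set x | phi x != 0] x by move=> /sub.
have : \forall y \near x, phi y = (cst 0 : 'rV[R]_n -> R^o) y.
  have oC : open (~` closure [set x | phi x != 0]).
    by apply: closed_openC; exact: closed_closure.
  have := open_nbhs_nbhs (conj oC nc); apply: filterS => y ny.
  by apply: contrapT => /eqP py; apply: ny; exact: subset_closure.
by move=> /near_eq_derive ->; rewrite derive_cst.
Qed.

End test_functions.

Section poincare_test_fun.
Context (R : realType) (n : nat) (Omega : set 'rV[R]_n.+1) (p L : R).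
Hypothesis p1 : 1 < p.
Hypothesis L0 : 0 < L.
Hypothesis OmegaL : forall x, Omega x -> `|x ord0 ord0| < L.

Let p0 : 0 < p. Proof. exact: lt_trans p1. Qed.

Let rV_consD (s h : R) (v : 'rV[R]_n) :
  rV_cons (h + s, v) = h *: delta_mx ord0 ord0 + rV_cons (s, v).
Proof.
have c0 x w : rV_cons (x, w) ord0 ord0 = x :> R.
  by have /(congr1 fst) := rV_consK (x, w).
have cS x w i : rV_cons (x, w) ord0 (lift ord0 i) = w ord0 i :> R.
  by have /(congr1 snd)/rowP/(_ i) := rV_consK (x, w); rewrite /= mxE.
apply/rowP => j; case: (unliftP ord0 j) => [k|] ->;
  rewrite [RHS]mxE [X in _ = X + _]mxE [delta_mx _ _ _ _]mxE.
  by rewrite !cS eqxx/= mulr0 add0r.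
by rewrite !c0 !eqxx/= mulr1.
Qed.

Let rV_cons_continuous (v : 'rV[R]_n) :
  continuous (fun s : R => rV_cons (s, v) : 'rV[R]_n.+1).
Proof.
move=> s; rewrite (_ : (fun s : R => _) =
    fun s : R => s *: (delta_mx ord0 ord0 : 'rV[R]_n.+1) + rV_cons (0, v)).
  by apply: cvgD; [apply: cvgZr_tmp; exact: cvg_id|exact: cvg_cst].
by apply/funext => t; rewrite -rV_consD addr0.
Qed.

Lemma test_fun_slice (phi : 'rV[R]_n.+1 -> R^o) (v : 'rV[R]_n) (s : R) :
  test_fun Omega phi ->
  is_derive (s : R) (1 : R) (fun t : R => phi (rV_cons (t, v)))
    (partial ord0 phi (rV_cons (s, v))).
Proof.
move=> tphi; have d := test_fun_derivable (j := ord0) (x := rV_cons (s, v)) tphi.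
have e : (fun h : R => h^-1 *: (((fun t : R => phi (rV_cons (t, v))) \o shift s)
      (h *: (1 : R)) - phi (rV_cons (s, v)))) =
    (fun h : R => h^-1 *: ((phi \o shift (rV_cons (s, v))) (h *: delta_mx ord0 ord0)
      - phi (rV_cons (s, v)))).
  by apply/funext => h /=; rewrite -rV_consD /GRing.scale/= mulr1.
by apply: DeriveDef; rewrite /derivable /partial /derive e.
Qed.

Lemma poincare_test_fun (phi : 'rV[R]_n.+1 -> R^o) : test_fun Omega phi ->
  (\int[lebesgue_rV R n.+1]_x (`|phi x| `^ p)%:E <=
   (2 * L * (2 * L + 1) `^ p)%:E *
   \int[lebesgue_rV R n.+1]_x (`|partial ord0 phi x| `^ p)%:E)%E.
Proof.
move=> tphi; have cphi := test_fun_continuous tphi.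
have cdphi := test_fun_partial_continuous (j := ord0) tphi.
have mpow (f : 'rV[R]_n.+1 -> R^o) : continuous f ->
    measurable_fun setT (fun x => (`|f x| `^ p)%:E).
  move=> cf; apply/measurable_EFinP/(measurableT_comp (measurable_powR p)).
  by apply: measurableT_comp => //; exact: continuous_measurable_rV.
have mG (f : 'rV[R]_n.+1 -> R^o) : continuous f -> measurable_fun setT
    (fun v => \int[@lebesgue_measure R]_s (`|f (rV_cons (s, v))| `^ p)%:E)%E.
  move=> cf.
  apply: (@measurable_fun_fubini_tonelli_G _ _ _ _ _ (@lebesgue_measure R)
    (fun z => (`|f (rV_cons z)| `^ p)%:E)).
  - by apply: (measurableT_comp (mpow f cf)); exact: measurable_rV_cons.
  - by move=> z; rewrite lee_fin powR_ge0.
rewrite !tonelli_rV; do ?[exact: mpow|by move=> x; rewrite lee_fin powR_ge0].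
have K0 : 0 <= 2 * L * (2 * L + 1) `^ p by rewrite !mulr_ge0 ?powR_ge0 ?(ltW L0).
rewrite -ge0_integralZl_EFin//; last 2 first.
- by move=> v _; apply: integral_ge0 => s _; rewrite lee_fin powR_ge0.
- exact: mG.
apply: ge0_le_integral => //.
- by move=> v _; apply: integral_ge0 => s _; rewrite lee_fin powR_ge0.
- exact: mG.
- by apply: measurable_funeM; exact: mG.
move=> v _; apply: (poincare_line p1 L0) => [s|s|s Ls].
- exact: test_fun_slice.
- apply: (@continuous_comp _ _ _ (fun t : R => rV_cons (t, v) : 'rV[R]_n.+1)
    (partial ord0 phi)); [exact: rV_cons_continuous|exact: cdphi].
- apply: (test_fun_out tphi) => /OmegaL.
  have /(congr1 fst)/= -> := rV_consK (s, v).
  by rewrite ltNge Ls.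
Qed.

End poincare_test_fun.

(** * The spaces L^p and W^(1,p)_0 *)

Section lp_matrix_functions.
Context (R : realType) (n : nat) (Omega : set 'rV[R]_n) (p : R).
Hypothesis p1 : 1 < p.
Hypothesis mO : measurable Omega.
Hypothesis O_fin : (lebesgue_rV R n Omega < +oo)%E.

Local Notation leb := (@lebesgue_rV R n).
Local Notation I f := (\int[leb]_(x in Omega) f x)%R.
Local Notation aem := (aem leb Omega).
Local Notation aei := (aei leb Omega).

Let p0 : 0 < p. Proof. exact: lt_trans p1. Qed.

Section fixed_size.
Context (N m : nat).
Implicit Types f g : 'rV[R]_n -> 'M[R[i]]_(N, m).

Definition mxm f := forall k j, ae_measurableC Omega (fun x => f x k j).

Lemma mxmZD c f g : mxm f -> mxm g -> mxm (fun x => c *: f x + g x).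
Proof.
move=> mf mg k j; have [f1 f2] := mf k j; have [g1 g2] := mg k j.
have h (a b : R) (u v w : 'rV[R]_n -> R) : aem u -> aem v -> aem w ->
    aem (fun x => a * u x + b * v x + w x).
  by move=> mu mv mw; do 2?[apply: aemD => //]; apply: aemM => //; exact: aem_cst.
split.
  have := h (Re c) (- Im c) _ _ _ f1 f2 g1; congr aem; apply/funext => x.
  by rewrite !mxE Re_add Re_mul; ring.
have := h (Re c) (Im c) _ _ _ f2 f1 g2; congr aem; apply/funext => x.
by rewrite !mxE Im_add Im_mul.
Qed.

Lemma aem_frobC f : mxm f -> aem (fun x => frobC (f x)).
Proof.
move=> mf; apply: (aem_comp (h := @Num.sqrt R)
  (f := fun x => \sum_k \sum_j normc (f x k j) ^+ 2)).
  by apply: continuous_measurable_fun; exact: sqrt_continuous.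
apply: aem_sum => k; apply: aem_sum => j.
have [f1 f2] := mf k j.
under eq_fun do rewrite normc_sqr !expr2.
by apply: aemD; apply: aemM.
Qed.

Lemma aem_frobC_powR f : mxm f -> aem (fun x => frobC (f x) `^ p).
Proof. by move=> mf; apply: aem_powR => //; exact: aem_frobC. Qed.

Lemma LnormCE f : LnormC Omega p f =
  ((\int[leb]_(x in Omega) (frobC (f x) `^ p)%:E) `^ p^-1)%E.
Proof.
rewrite /LnormC unlock; congr (_ `^ _)%E; rewrite [RHS]integral_mkcond.
apply: eq_integral => x _; rewrite !patchE; case: ifPn => _ /=.
  by rewrite ger0_norm ?frobC_ge0// poweR_EFin.
by rewrite normr0 powR0// gt_eqF.
Qed.

Let aei_lty f : mxm f ->
  aei (fun x => frobC (f x) `^ p) <->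
  (\int[leb]_(x in Omega) (frobC (f x) `^ p)%:E < +oo)%E.
Proof.
have e : (\int[leb]_(x in Omega) `|frobC (f x) `^ p|%:E =
    \int[leb]_(x in Omega) (frobC (f x) `^ p)%:E)%E.
  by apply: eq_integral => x _; rewrite ger0_norm ?powR_ge0.
move=> mf; split; first by move=> /aeiP[_]; rewrite e.
by move=> oo; apply/aeiP; rewrite e; split => //; exact: aem_frobC_powR.
Qed.

Lemma aei_EFin (f : 'rV[R]_n -> R) : aei f ->
  (\int[leb]_(x in Omega) (f x)%:E)%E = (I f)%:E.
Proof.
move=> [u ui hu]; rewrite /Rintegral fineK//.
rewrite (@integral_ae_congr _ _ _ _ _ _ (EFin \o u)).
  exact: integrable_fin_num.
by apply: filterS hu => x H Dx; rewrite H.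
Qed.

Lemma in_LpP f :
  in_Lp Omega p f <-> mxm f /\ aei (fun x => frobC (f x) `^ p).
Proof.
rewrite /in_Lp LnormCE; split=> -[mf h]; split => //.
  by apply/(aei_lty mf); apply: lty_poweRy h; rewrite invr_eq0 gt_eqF.
by rewrite (aei_EFin h) poweR_EFin ltry.
Qed.

Lemma LnormC_lt f e : in_Lp Omega p f -> 0 < e ->
  (LnormC Omega p f < e%:E)%E <-> I (fun x => frobC (f x) `^ p) < e `^ p.
Proof.
move=> /in_LpP[mf fi] e0; rewrite LnormCE (aei_EFin fi) poweR_EFin lte_fin.
have J0 : 0 <= I (fun x => frobC (f x) `^ p).
  by apply: Rintegral_ge0 => x _; exact: powR_ge0.
have e' : (e `^ p) `^ p^-1 = e by rewrite -powRrM divff ?gt_eqF// powRr1// ltW.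
have J' : (I (fun x => frobC (f x) `^ p) `^ p^-1) `^ p = I (fun x => frobC (f x) `^ p).
  by rewrite -powRrM mulVf ?gt_eqF// powRr1.
split => h.
  by rewrite -J'; apply: gt0_ltr_powR; rewrite // ?nnegrE ?powR_ge0// ltW.
rewrite -e'; apply: gt0_ltr_powR; rewrite ?invr_gt0// ?nnegrE//.
exact: powR_ge0.
Qed.

Lemma frobC_powD (Y Z : 'M[R[i]]_(N, m)) :
  frobC (Y + Z) `^ p <= 2 `^ p * (frobC Y `^ p + frobC Z `^ p).
Proof.
apply: le_trans (powR_add_le p1 (frobC_ge0 _) (frobC_ge0 _)).
by apply: powR_le; rewrite ?(ltW p0)// ?frobC_ge0//; exact: frobC_triangle.
Qed.

Lemma in_LpZD c f g : in_Lp Omega p f -> in_Lp Omega p g ->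
  in_Lp Omega p (fun x => c *: f x + g x).
Proof.
move=> /in_LpP[mf fi] /in_LpP[mg gi]; apply/in_LpP; split; first exact: mxmZD.
apply: (aei_le mO _ (g := fun x =>
   2 `^ p * (normc c `^ p * frobC (f x) `^ p + frobC (g x) `^ p))).
- by apply: aem_frobC_powR; exact: mxmZD.
- by apply: aeiZ => //; apply: aeiD => //; exact: aeiZ.
move=> x _; rewrite ger0_norm ?powR_ge0//; apply: le_trans (frobC_powD _ _) _.
by rewrite frobCZ powRM ?normc_ge0 ?frobC_ge0.
Qed.

Lemma in_Lp_sub f g : in_Lp Omega p f -> in_Lp Omega p g ->
  in_Lp Omega p (fun x => f x - g x).
Proof.
move=> pf pg; have := in_LpZD (-1) pg pf; congr in_Lp; apply/funext => x.
by rewrite scaleN1r addrC.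
Qed.

Lemma in_Lp_aei f : in_Lp Omega p f -> aei (fun x => frobC (f x) `^ p).
Proof. by move=> /in_LpP[]. Qed.

Lemma in_Lp_mxm f : in_Lp Omega p f -> mxm f.
Proof. by move=> /in_LpP[]. Qed.

(** The p-th power of the norm is additive under the integral and involves no root; Minkowski's
    inequality is replaced by a triangle inequality with factor [2 ^ p]. *)
Definition Lpint f : R := I (fun x => frobC (f x) `^ p).

Lemma Lpint_ge0 f : 0 <= Lpint f.
Proof. by apply: Rintegral_ge0 => x _; exact: powR_ge0. Qed.

Lemma LpintD f g : in_Lp Omega p f -> in_Lp Omega p g ->
  Lpint (fun x => f x + g x) <= 2 `^ p * (Lpint f + Lpint g).
Proof.
move=> pf pg; have fi := in_Lp_aei pf; have gi := in_Lp_aei pg.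
rewrite /Lpint -intD// -intZ//; last exact: aeiD.
apply: (int_le mO).
- apply: in_Lp_aei; have := in_LpZD 1 pf pg; congr in_Lp.
  by apply/funext => x; rewrite scale1r.
- by apply: aeiZ => //; exact: aeiD.
- by move=> x _; exact: frobC_powD.
Qed.

Lemma LpintZ c f : in_Lp Omega p f ->
  Lpint (fun x => c *: f x) = normc c `^ p * Lpint f.
Proof.
move=> pf; rewrite /Lpint -intZ//; last exact: in_Lp_aei.
by apply: eq_Rintegral => x _; rewrite frobCZ powRM ?normc_ge0 ?frobC_ge0.
Qed.

Lemma Lpint_opp f : Lpint (fun x => - f x) = Lpint f.
Proof. by apply: eq_Rintegral => x _; rewrite frobCN. Qed.

Lemma LpintB f g : in_Lp Omega p f -> in_Lp Omega p g ->
  Lpint (fun x => f x - g x) <= 2 `^ p * (Lpint f + Lpint g).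
Proof.
move=> pf pg; rewrite -(Lpint_opp g); apply: LpintD => //.
have := in_LpZD (-1) pg (in_Lp_sub pg pg); congr in_Lp; apply/funext => x.
by rewrite scaleN1r subrr addr0.
Qed.

Lemma Lpint_eq0 f : in_Lp Omega p f -> Lpint f = 0 ->
  \forall x \ae leb, Omega x -> f x = 0.
Proof.
move=> pf /(int_eq0 mO (in_Lp_aei pf)) => /(_ (fun x _ => powR_ge0 _ _)).
apply: filterS => x h Ox; apply: frobC_eq0; apply: powR_eq0_eq0 (h Ox).
Qed.

End fixed_size.
End lp_matrix_functions.

(** * Linear combinations of test functions *)

Section test_function_combinations.
Context (R : realType) (n : nat) (Omega : set 'rV[R]_n).
Implicit Types phi psi : 'rV[R]_n -> R^o.

Lemma smooth_partial phi psi (a b : R) (s : seq 'I_n) :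
  smooth phi -> smooth psi ->
  foldr (@partial R n) (fun x => a *: phi x + b *: psi x) s =
  (fun x => a *: foldr (@partial R n) phi s x + b *: foldr (@partial R n) psi s x).
Proof.
move=> sf sg; elim: s => [//|j s IH] /=; rewrite IH; apply/funext => x.
have [_ /(_ j x) df] := sf s; have [_ /(_ j x) dg] := sg s.
rewrite /partial deriveD; [|exact: derivableZ..].
by rewrite (deriveZ a df) (deriveZ b dg).
Qed.

Lemma test_funZD phi psi (a b : R) :
  test_fun Omega phi -> test_fun Omega psi ->
  test_fun Omega (fun x => a *: phi x + b *: psi x).
Proof.
move=> [sf cf of_] [sg cg og].
have sub : closure [set x | a *: phi x + b *: psi x != 0] `<=`
    closure [set x | phi x != 0] `|` closure [set x | psi x != 0].
  rewrite -closureU; apply: closure_subset => x /= h.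
  have [f0|f0] := eqVneq (phi x) 0; [right|by left].
  by apply: contra h => /eqP g0; rewrite f0 g0 !scaler0 addr0.
split.
- move=> s /=; rewrite smooth_partial//; have [cfs dfs] := sf s.
  have [cgs dgs] := sg s; split.
    by move=> x; exact: (cvgD (cvgZ (cvg_cst a) (cfs x)) (cvgZ (cvg_cst b) (cgs x))).
  by move=> j x; apply: derivableD; apply: derivableZ; [exact: dfs|exact: dgs].
- apply: (subclosed_compact _ (compactU cf cg) sub); exact: closed_closure.
- by move=> x /sub[/of_|/og].
Qed.

Lemma test_fun0 : test_fun Omega (fun=> 0).
Proof.
have e s : foldr (@partial R n) (fun=> 0) s = (fun=> 0).
  by elim: s => [//|j s /= ->]; apply/funext => x; rewrite /partial derive_cst.
split.
- by move=> s /=; rewrite e; split => [x|j x]; [exact: cst_continuous|exact: derivable_cst].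
- rewrite (_ : [set _ | _] = set0) ?closure0; first exact: compact0.
  by apply/seteqP; split => x //=; rewrite eqxx.
- by rewrite (_ : [set _ | _] = set0) ?closure0//;
    apply/seteqP; split => x //=; rewrite eqxx.
Qed.

Lemma partial_lin phi psi (a b : R) j x : test_fun Omega phi ->
  test_fun Omega psi ->
  partial j (fun x => a *: phi x + b *: psi x) x =
  a * partial j phi x + b * partial j psi x.
Proof. by move=> [sf _ _] [sg _ _]; exact: (congr1 (@^~ x) (smooth_partial a b [:: j] sf sg)). Qed.

Context (N : nat).
Implicit Types u v : 'rV[R]_n -> 'cV[R[i]]_N.

(** A complex combination is unfolded into nested real ones, the shape to which [test_funZD] and
    [partial_lin] apply. *)
Let ReZD c u v k : (fun x => Re ((c *: u x + v x) k ord0)) =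
  (fun x => 1 *: ((Re c *: Re (u x k ord0) + (- Im c) *: Im (u x k ord0)) : R^o)
            + 1 *: (Re (v x k ord0) : R^o)).
Proof.
apply/funext => x; rewrite !mxE Re_add Re_mul !scale1r.
by rewrite /GRing.scale/= mulNr.
Qed.

Let ImZD c u v k : (fun x => Im ((c *: u x + v x) k ord0)) =
  (fun x => 1 *: ((Im c *: Re (u x k ord0) + Re c *: Im (u x k ord0)) : R^o)
            + 1 *: (Im (v x k ord0) : R^o)).
Proof.
apply/funext => x; rewrite !mxE Im_add Im_mul !scale1r.
by rewrite /GRing.scale/= [X in X + _ = _]addrC.
Qed.

Lemma test_funCZD c u v : test_funC Omega u -> test_funC Omega v ->
  test_funC Omega (fun x => c *: u x + v x).
Proof.
move=> tu tv k; have [u1 u2] := tu k; have [v1 v2] := tv k.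
by rewrite ReZD ImZD; split; apply: test_funZD => //; exact: test_funZD.
Qed.

Lemma jacobianCZD c u v x : test_funC Omega u -> test_funC Omega v ->
  jacobianC (fun x => c *: u x + v x) x = c *: jacobianC u x + jacobianC v x.
Proof.
move=> tu tv; apply/matrixP => k j; rewrite !mxE; have [u1 u2] := tu k.
have [v1 v2] := tv k; rewrite ReZD ImZD !partial_lin//; try exact: test_funZD.
apply/eqP; rewrite eq_complex Re_add Im_add Re_mul Im_mul /=.
by apply/andP; split; apply/eqP; ring.
Qed.

Lemma test_funC0 : test_funC Omega (fun=> 0 : 'cV[R[i]]_N).
Proof.
move=> k; rewrite (_ : (fun x => Re _) = fun=> 0); last by apply/funext => x; rewrite mxE.
rewrite (_ : (fun x => Im _) = fun=> 0); last by apply/funext => x; rewrite mxE.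
by split; exact: test_fun0.
Qed.

Lemma jacobianC0 (x : 'rV[R]_n) : jacobianC (fun=> 0 : 'cV[R[i]]_N) x = 0.
Proof.
apply/matrixP => k j; rewrite mxE [RHS]mxE /partial.
by rewrite (derive_cst (Re ((0 : 'cV[R[i]]_N) k ord0) : R^o))
  (derive_cst (Im ((0 : 'cV[R[i]]_N) k ord0) : R^o)).
Qed.

End test_function_combinations.

Lemma bounded_set_coord (R : realType) n (A : set 'rV[R]_n) : bounded_set A ->
  exists2 L, 0 < L & forall x, A x -> forall i, `|x ord0 i| < L.
Proof.
move=> [M [_ HM]]; exists (`|M| + 2); first by rewrite ltr_wpDl.
move=> x Ax i; apply: (@le_lt_trans _ _ (`|M| + 1)); last by rewrite ltrD2l ltr1n.
have MM : M < `|M| + 1 by rewrite ltr_pwDr// ler_norm.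
apply: le_trans (HM _ MM x Ax); rewrite [leRHS]/Num.norm /= mx_normrE.
by apply/bigmax_geP; right => /=; exists (ord0, i).
Qed.

Lemma bounded_lebesgue_rV_fin (R : realType) n (A : set 'rV[R]_n) :
  measurable A -> bounded_set A -> (lebesgue_rV R n A < +oo)%E.
Proof.
move=> mA /bounded_set_coord[L L0 HL].
pose B := [set x : 'rV[R]_n | forall i, - L < x ord0 i <= L].
have mB : measurable B.
  rewrite (_ : B = \bigcap_(i in [set: 'I_n])
      ((fun x : 'rV[R]_n => x ord0 i) @^-1` `]- L, L])).
    apply: fin_bigcap_measurable => // i _.
    by rewrite -[X in measurable X]setTI; apply: measurable_coor.
  apply/seteqP; split => x /= h i; first by move=> _ /=; rewrite in_itv; exact: h.
  by have := h i Logic.I; rewrite /= in_itv.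
apply: (@le_lt_trans _ _ (lebesgue_rV R n B)).
  apply: le_measure; rewrite ?inE// => x Ax i.
  by have := HL x Ax i; rewrite ltr_norml => /andP[-> /ltW].
rewrite lebesgue_rV_box ?ltry// => i.
by rewrite (@le_trans _ _ 0)// ?oppr_le0 ltW.
Qed.

(** * Linear structure of W^(1,p)_0 *)

Section sobolev_zero.
Context (R : realType) (n N : nat) (Omega : set 'rV[R]_n) (p : R).
Hypothesis p1 : 1 < p.
Hypothesis oO : open Omega.
Hypothesis bO : bounded_set Omega.

Local Notation leb := (@lebesgue_rV R n).
Local Notation I f := (\int[leb]_(x in Omega) f x)%R.
Local Notation aem := (aem leb Omega).
Local Notation aei := (aei leb Omega).
Local Notation Lpint := (Lpint Omega p).
Implicit Types (u v : 'rV[R]_n -> 'cV[R[i]]_N) (Du Dv : 'rV[R]_n -> 'M[R[i]]_(N, n)).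

Let p0 : 0 < p. Proof. exact: lt_trans p1. Qed.

Lemma measurable_Omega : measurable Omega.
Proof. exact: open_measurable_rV. Qed.
Let mO := measurable_Omega.
Let O_fin : (leb Omega < +oo)%E.
Proof. exact: bounded_lebesgue_rV_fin. Qed.

Lemma continuous_bounded (f : 'rV[R]_n -> R) : continuous f ->
  exists2 M, 0 <= M & forall x, Omega x -> `|f x| <= M.
Proof.
move=> cf.
have [L L0 HL] := bounded_set_coord bO.
pose K := [set x : 'rV[R]_n | forall i, `[- L, L]%classic (x ord0 i)].
have cK : compact K by apply: (@rV_compact _ _ (fun=> `[- L, L]%classic)) => i; exact: segment_compact.
have : compact (f @` K).
  by apply: continuous_compact => //; exact: continuous_subspaceT.
move=> /compact_bounded[M [_ HM]]; exists (`|M| + 1); first by rewrite addr_ge0.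
move=> x Ox; apply: (HM (`|M| + 1)); first by rewrite ltr_pwDr// ler_norm.
exists x => // i; rewrite /= in_itv/=.
by have := HL x Ox i; rewrite ltr_norml => /andP[/ltW -> /ltW ->].
Qed.

Lemma continuous_aem (f : 'rV[R]_n -> R) : continuous f -> aem f.
Proof.
move=> cf; apply: measurable_aem; apply: measurable_funTS.
exact: continuous_measurable_rV.
Qed.

Lemma aei_continuousM (f w : 'rV[R]_n -> R) : aei f -> continuous w ->
  aei (fun x => f x * w x).
Proof.
move=> fi cw; have [M M0 HM] := continuous_bounded cw.
apply: (aei_le mO _ (g := fun x => M * `|f x|)).
- by apply: aemM; [exact: aei_aem|exact: continuous_aem].
- by apply: aeiZ => //; exact: aei_normr.
- by move=> x Ox; rewrite normrM mulrC ler_wpM2r// HM.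
Qed.

Lemma entry_Re_le m (Y : 'M[R[i]]_(N, m)) k j : `|Re (Y k j)| <= frobC Y.
Proof. exact: le_trans (Re_le_normc _) (normc_le_frobC _ _ _). Qed.
Lemma entry_Im_le m (Y : 'M[R[i]]_(N, m)) k j : `|Im (Y k j)| <= frobC Y.
Proof. exact: le_trans (Im_le_normc _) (normc_le_frobC _ _ _). Qed.

Lemma in_Lp_entry m (f : 'rV[R]_n -> 'M[R[i]]_(N, m)) k j :
  in_Lp Omega p f -> aei (fun x => Re (f x k j)) /\ aei (fun x => Im (f x k j)).
Proof.
move=> /(in_LpP p1 mO)[mf fi]; have [m1 m2] := mf k j.
split; apply: (lp_abs_aei p1 mO O_fin) => //.
  apply: (aei_le mO _ fi); first by apply: aem_powR; exact: aem_normr.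
  move=> x _; rewrite ger0_norm ?powR_ge0//.
  by apply: powR_le => //; [exact: ltW|exact: entry_Re_le].
apply: (aei_le mO _ fi); first by apply: aem_powR; exact: aem_normr.
move=> x _; rewrite ger0_norm ?powR_ge0//.
by apply: powR_le => //; [exact: ltW|exact: entry_Im_le].
Qed.

Definition weak_jacobian_real (u : 'rV[R]_n -> 'cV[R[i]]_N)
    (Du : 'rV[R]_n -> 'M[R[i]]_(N, n)) : Prop :=
  forall k j phi, test_fun Omega phi ->
    I (fun x => Re (u x k ord0) * partial j phi x) =
      - I (fun x => Re (Du x k j) * phi x) /\
    I (fun x => Im (u x k ord0) * partial j phi x) =
      - I (fun x => Im (Du x k j) * phi x).

Lemma weak_jacobianP u Du : weak_jacobian Omega u Du <-> weak_jacobian_real u Du.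
Proof.
have h (f : 'rV[R]_n -> R[i]) (w : 'rV[R]_n -> R) :
    integralC Omega (fun x => f x * (w x)%:C%C) =
    (I (fun x => Re (f x) * w x) +i* I (fun x => Im (f x) * w x))%C.
  rewrite /integralC; congr (_ +i* _)%C; apply: eq_Rintegral => x _.
    by rewrite Re_mul/= mulr0 subr0.
  by rewrite Im_mul/= mulr0 add0r.
split=> H k j phi tphi; have := H k j phi tphi; rewrite !h.
  by move=> [-> ->].
by move=> [-> ->].
Qed.

Lemma weak_jacobianZD c u Du v Dv :
  in_Lp Omega p u -> in_Lp Omega p Du -> in_Lp Omega p v -> in_Lp Omega p Dv ->
  weak_jacobian Omega u Du -> weak_jacobian Omega v Dv ->
  weak_jacobian Omega (fun x => c *: u x + v x) (fun x => c *: Du x + Dv x).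
Proof.
move=> pu pDu pv pDv /weak_jacobianP wu /weak_jacobianP wv.
apply/weak_jacobianP => k j phi tphi.
have cphi := test_fun_continuous tphi.
have cdphi := test_fun_partial_continuous (j := j) tphi.
have [u1 u2] := in_Lp_entry k ord0 pu; have [v1 v2] := in_Lp_entry k ord0 pv.
have [du1 du2] := in_Lp_entry k j pDu; have [dv1 dv2] := in_Lp_entry k j pDv.
have [eu1 eu2] := wu k j phi tphi; have [ev1 ev2] := wv k j phi tphi.
have lin (a b : R) (f g h w : 'rV[R]_n -> R) : aei f -> aei g -> aei h ->
    continuous w -> I (fun x => (a * f x + b * g x + h x) * w x) =
    a * I (fun x => f x * w x) + b * I (fun x => g x * w x) + I (fun x => h x * w x).
  move=> fi gi hi cw.
  have fw := aei_continuousM fi cw; have gw := aei_continuousM gi cw.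
  have hw := aei_continuousM hi cw.
  rewrite -!intZ// -!intD//; do ?[exact: aeiZ|by apply: aeiD => //; exact: aeiZ].
  by apply: eq_Rintegral => x _; ring.
split.
  rewrite (@eq_Rintegral _ _ _ _ _ (fun x =>
    (Re c * Re (u x k ord0) + (- Im c) * Im (u x k ord0) + Re (v x k ord0))
      * partial j phi x)); last first.
    by move=> x _; rewrite !mxE Re_add Re_mul mulNr.
  rewrite [in RHS](@eq_Rintegral _ _ _ _ _ (fun x =>
    (Re c * Re (Du x k j) + (- Im c) * Im (Du x k j) + Re (Dv x k j)) * phi x));
    last by move=> x _; rewrite !mxE Re_add Re_mul mulNr.
  by rewrite !lin// eu1 eu2 ev1; ring.
rewrite (@eq_Rintegral _ _ _ _ _ (fun x =>
  (Im c * Re (u x k ord0) + Re c * Im (u x k ord0) + Im (v x k ord0))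
    * partial j phi x)); last first.
  by move=> x _; rewrite !mxE Im_add Im_mul [X in X + _]addrC.
rewrite [in RHS](@eq_Rintegral _ _ _ _ _ (fun x =>
  (Im c * Re (Du x k j) + Re c * Im (Du x k j) + Im (Dv x k j)) * phi x));
  last by move=> x _; rewrite !mxE Im_add Im_mul [X in X + _]addrC.
by rewrite !lin// eu1 eu2 ev2; ring.
Qed.

Lemma test_funC_in_Lp u : test_funC Omega u ->
  in_Lp Omega p u /\ in_Lp Omega p (jacobianC u).
Proof.
have bdd m (f : 'rV[R]_n -> 'M[R[i]]_(N, m)) :
    (forall k j, continuous (fun x => Re (f x k j)) /\
                 continuous (fun x => Im (f x k j))) -> in_Lp Omega p f.
  move=> cf.
  have mf : mxm Omega f.
    by move=> k j; have [c1 c2] := cf k j; split; exact: continuous_aem.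
  apply/(in_LpP p1 mO); split => //.
  have /choice[M HM] : forall k, exists M, forall j x, Omega x ->
      `|Re (f x k j)| + `|Im (f x k j)| <= M.
    move=> k.
    have /choice[M HM] : forall j, exists M, forall x, Omega x ->
        `|Re (f x k j)| + `|Im (f x k j)| <= M.
      move=> j; have [c1 c2] := cf k j; have [M1 _ H1] := continuous_bounded c1.
      have [M2 _ H2] := continuous_bounded c2; exists (M1 + M2) => x Ox.
      by rewrite lerD// ?H1// H2.
    exists (\sum_j `|M j|) => j x Ox; apply: le_trans (HM j x Ox) _.
    apply: le_trans (ler_norm _) _; rewrite (bigD1 j)//= lerDl.
    by apply: sumr_ge0.
  pose B := \sum_(k < N) \sum_(j < m) M k.
  have fB x : Omega x -> frobC (f x) <= B.
    move=> Ox; apply: le_trans (frobC_le_sum _) _.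
    by apply: ler_sum => k _; apply: ler_sum => j _; exact: HM.
  apply: (aei_le mO _ (g := fun=> B `^ p)).
  - by apply: aem_frobC_powR.
  - exact: aei_cst.
  - move=> x Ox; rewrite ger0_norm ?powR_ge0//.
    by apply: powR_le; rewrite ?frobC_ge0 ?fB// ltW.
move=> tu; split; apply: bdd => k j.
  rewrite ord1; have [u1 u2] := tu k.
  by split; [exact: (test_fun_continuous u1)|exact: (test_fun_continuous u2)].
have [u1 u2] := tu k; split.
  rewrite (_ : (fun x => _) = partial j (fun x => Re (u x k ord0))).
    exact: (test_fun_partial_continuous u1).
  by apply/funext => x; rewrite mxE.
rewrite (_ : (fun x => _) = partial j (fun x => Im (u x k ord0))).
  exact: (test_fun_partial_continuous u2).
by apply/funext => x; rewrite mxE.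
Qed.

Lemma in_W1p0P u Du : in_W1p0 Omega p u Du <-> in_W1p Omega p u Du /\
  forall e : R, 0 < e -> exists2 psi, test_funC Omega psi &
    Lpint (fun x => u x - psi x) < e /\ Lpint (fun x => Du x - jacobianC psi x) < e.
Proof.
split=> -[W H]; split => //; have [pu pDu _] := W.
  move=> e e0; have ep : 0 < e `^ p^-1 by rewrite powR_gt0.
  have [psi tpsi lt] := H _ ep; exists psi => //.
  have [pp pDp] := test_funC_in_Lp tpsi.
  have ee : e = (e `^ p^-1) `^ p by rewrite -powRrM mulVf ?gt_eqF// powRr1// ltW.
  have pd := in_Lp_sub p1 mO pu pp; have pDd := in_Lp_sub p1 mO pDu pDp.
  split; rewrite ee.
    apply: (LnormC_lt p1 mO pd ep).1; apply: le_lt_trans lt.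
    by rewrite /W1p_norm leeDl// Lnorm_ge0.
  apply: (LnormC_lt p1 mO pDd ep).1; apply: le_lt_trans lt.
  by rewrite /W1p_norm leeDr// Lnorm_ge0.
move=> e e0; have e2 : 0 < e / 2 by rewrite divr_gt0.
have ep : 0 < (e / 2) `^ p by rewrite powR_gt0.
have [psi tpsi [h1 h2]] := H _ ep; exists psi => //.
have [pp pDp] := test_funC_in_Lp tpsi.
have -> : e%:E = ((e / 2)%:E + (e / 2)%:E)%E by rewrite -EFinD -splitr.
have pd := in_Lp_sub p1 mO pu pp; have pDd := in_Lp_sub p1 mO pDu pDp.
exact: lteD ((LnormC_lt p1 mO pd e2).2 h1) ((LnormC_lt p1 mO pDd e2).2 h2).
Qed.

Lemma in_W1p0ZD c u Du v Dv : in_W1p0 Omega p u Du -> in_W1p0 Omega p v Dv ->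
  in_W1p0 Omega p (fun x => c *: u x + v x) (fun x => c *: Du x + Dv x).
Proof.
move=> /in_W1p0P[[pu pDu wu] Hu] /in_W1p0P[[pv pDv wv] Hv]; apply/in_W1p0P; split.
  by split; [exact: in_LpZD|exact: in_LpZD|exact: weak_jacobianZD].
move=> e e0; pose K := 2 `^ p * (normc c `^ p + 1).
have K0 : 0 < K by rewrite mulr_gt0 ?powR_gt0// ltr_wpDl// powR_ge0.
have [psi tpsi [h1 h2]] := Hu _ (divr_gt0 e0 K0).
have [psi' tpsi' [h3 h4]] := Hv _ (divr_gt0 e0 K0).
exists (fun x => c *: psi x + psi' x); first exact: test_funCZD.
have [pp pDp] := test_funC_in_Lp tpsi; have [pp' pDp'] := test_funC_in_Lp tpsi'.
have est m (f g f' g' : 'rV[R]_n -> 'M[R[i]]_(N, m)) : in_Lp Omega p f ->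
    in_Lp Omega p g -> in_Lp Omega p f' -> in_Lp Omega p g' ->
    Lpint (fun x => f x - g x) < e / K -> Lpint (fun x => f' x - g' x) < e / K ->
    Lpint (fun x => c *: f x + f' x - (c *: g x + g' x)) < e.
  move=> pf pg pf' pg' hf hg.
  have pfg := in_Lp_sub p1 mO pf pg; have pfg' := in_Lp_sub p1 mO pf' pg'.
  have pZ : in_Lp Omega p (fun x => c *: (f x - g x)).
    have := in_LpZD p1 mO c pfg (in_Lp_sub p1 mO pf pf); congr in_Lp.
    by apply/funext => x; rewrite subrr addr0.
  rewrite (_ : (fun x => _) = (fun x => c *: (f x - g x) + (f' x - g' x))); last first.
    by apply/funext => x; rewrite scalerBr opprD addrACA.
  apply: le_lt_trans (LpintD p1 mO pZ pfg') _; rewrite LpintZ//.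
  have -> : e = 2 `^ p * (normc c `^ p * (e / K) + e / K).
    by rewrite -{2}[e / K]mul1r -mulrDl mulrA -/K mulrC divfK// gt_eqF.
  rewrite ltr_pM2l ?powR_gt0//; apply: ler_ltD hg.
  exact: ler_wpM2l (powR_ge0 _ _) _ _ (ltW hf).
split; first exact: (est _ u psi v psi' pu pp pv pp' h1 h3).
rewrite (_ : (fun x => _) = fun x => c *: Du x + Dv x -
    (c *: jacobianC psi x + jacobianC psi' x)); last first.
  by apply/funext => x; rewrite (jacobianCZD c x tpsi tpsi').
exact: (est _ Du _ Dv _ pDu pDp pDv pDp' h2 h4).
Qed.

Lemma in_W1p0_0 : in_W1p0 Omega p (fun=> 0 : 'cV[R[i]]_N) (fun=> 0).
Proof.
have t0 := @test_funC0 R n Omega N; have [p0' pD0] := test_funC_in_Lp t0.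
have e0 : jacobianC (fun=> 0 : 'cV[R[i]]_N) = (fun=> 0) :> ('rV[R]_n -> 'M[R[i]]_(N, n)).
  by apply/funext => x; exact: jacobianC0.
rewrite e0 in pD0; apply/in_W1p0P; split.
  split => //; apply/weak_jacobianP => k j phi _.
  have z (w : 'rV[R]_n -> R) (A : 'M[R[i]]_(N, n)) (B : 'cV[R[i]]_N) : A = 0 -> B = 0 ->
      (I (fun x => Re (B k ord0) * w x) = 0 /\ I (fun x => Im (B k ord0) * w x) = 0) /\
      (I (fun x => Re (A k j) * w x) = 0 /\ I (fun x => Im (A k j) * w x) = 0).
    move=> -> ->; have zz : I (fun x => 0 * w x) = 0.
      by under eq_Rintegral do rewrite mul0r; rewrite int_cst// mul0r.
    by rewrite !mxE.
  have [_ [h1 h2]] := z phi 0 0 erefl erefl.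
  have [[h3 h4] _] := z (partial j phi) 0 0 erefl erefl.
  by rewrite h1 h2 h3 h4 oppr0.
move=> e egt0; exists (fun=> 0) => //.
have m0 m : Lpint (fun x => (0 : 'M[R[i]]_(N, m)) - 0) = 0.
  rewrite /Lpint; under eq_Rintegral do rewrite subrr frobC0 powR0 ?gt_eqF//.
  by rewrite int_cst// mul0r.
by rewrite e0 !m0.
Qed.

End sobolev_zero.

(** * Reduction of matrix-valued L^p functions to real entries *)

Section entrywise.
Context (R : realType) (n : nat) (Omega : set 'rV[R]_n) (p : R).
Hypothesis p1 : 1 < p.
Hypothesis mO : measurable Omega.
Hypothesis O_fin : (lebesgue_rV R n Omega < +oo)%E.
Context (N m : nat).
Implicit Types f : 'rV[R]_n -> 'M[R[i]]_(N, m).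

Local Notation leb := (@lebesgue_rV R n).
Local Notation I f := (\int[leb]_(x in Omega) f x)%R.
Local Notation aem := (aem leb Omega).
Local Notation aei := (aei leb Omega).

Let p0 : 0 < p. Proof. exact: lt_trans p1. Qed.

Lemma frobC_powR_le_sum : exists2 C, 0 <= C & forall Y : 'M[R[i]]_(N, m),
  frobC Y `^ p <=
    C * \sum_k \sum_j (`|Re (Y k j)| `^ p + `|Im (Y k j)| `^ p).
Proof.
have [C1 C10 H1] := @powR_sum_le _ _ p1 _ (index_enum 'I_N).
have [C2 C20 H2] := @powR_sum_le _ _ p1 _ (index_enum 'I_m).
exists (C1 * (C2 * 2 `^ p)) => [|Y]; first by rewrite !mulr_ge0 ?powR_ge0.
apply: le_trans (powR_le (ltW p0) (frobC_ge0 _) (frobC_le_sum Y)) _.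
apply: le_trans (H1 _ _) _.
  by move=> k; apply: sumr_ge0 => j _; rewrite addr_ge0.
rewrite -mulrA ler_wpM2l// mulr_sumr; apply: ler_sum => k _.
apply: le_trans (H2 _ _) _; first by move=> j; rewrite addr_ge0.
rewrite -mulrA ler_wpM2l// mulr_sumr; apply: ler_sum => j _.
exact: powR_add_le.
Qed.

Let ReIm_powR_le (Y : 'M[R[i]]_(N, m)) k j :
  `|Re (Y k j)| `^ p <= frobC Y `^ p /\ `|Im (Y k j)| `^ p <= frobC Y `^ p.
Proof.
by split; apply: powR_le; rewrite ?(ltW p0)//; [exact: entry_Re_le|exact: entry_Im_le].
Qed.

Lemma aei_entry f k j : in_Lp Omega p f ->
  aei (fun x => `|Re (f x k j)| `^ p) /\ aei (fun x => `|Im (f x k j)| `^ p).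
Proof.
move=> /(in_LpP p1 mO)[mf fi]; have [m1 m2] := mf k j.
split; apply: (aei_le mO _ fi).
- by apply: aem_powR; exact: aem_normr.
- by move=> x _; rewrite ger0_norm ?powR_ge0//; have [] := ReIm_powR_le (f x) k j.
- by apply: aem_powR; exact: aem_normr.
- by move=> x _; rewrite ger0_norm ?powR_ge0//; have [] := ReIm_powR_le (f x) k j.
Qed.

Lemma int_entry_le f k j : in_Lp Omega p f ->
  I (fun x => `|Re (f x k j)| `^ p) <= Lpint Omega p f /\
  I (fun x => `|Im (f x k j)| `^ p) <= Lpint Omega p f.
Proof.
move=> pf; have [h1 h2] := aei_entry k j pf; have fi := in_Lp_aei p1 mO pf.
by split; apply: int_le => // x _; have [] := ReIm_powR_le (f x) k j.
Qed.

Lemma in_Lp_of_entries f :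
  (forall k j, [/\ aem (fun x => Re (f x k j)), aem (fun x => Im (f x k j)),
     aei (fun x => `|Re (f x k j)| `^ p) & aei (fun x => `|Im (f x k j)| `^ p)]) ->
  in_Lp Omega p f.
Proof.
move=> H; have mf : mxm Omega f by move=> k j; have [h1 h2 _ _] := H k j.
have [C C0 HC] := frobC_powR_le_sum; apply/(in_LpP p1 mO); split => //.
apply: (aei_le mO _ (g := fun x => C *
   \sum_k \sum_j (`|Re (f x k j)| `^ p + `|Im (f x k j)| `^ p))).
- exact: aem_frobC_powR.
- apply: aeiZ => //; apply: aei_sum => // k; apply: aei_sum => // j.
  by have [_ _ h1 h2] := H k j; exact: aeiD.
- by move=> x _; rewrite ger0_norm ?powR_ge0.
Qed.

Lemma Lpint_le_entries : exists2 C, 0 <= C & forall f, in_Lp Omega p f ->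
  Lpint Omega p f <= C * \sum_k \sum_j (I (fun x => `|Re (f x k j)| `^ p) +
                                        I (fun x => `|Im (f x k j)| `^ p)).
Proof.
have [C C0 HC] := frobC_powR_le_sum; exists C => // f pf.
have ai k j : aei (fun x => `|Re (f x k j)| `^ p + `|Im (f x k j)| `^ p).
  by have [h1 h2] := aei_entry k j pf; exact: aeiD.
have ais k : aei (fun x => \sum_j (`|Re (f x k j)| `^ p + `|Im (f x k j)| `^ p)).
  exact: aei_sum.
apply: (@le_trans _ _ (I (fun x => C *
   \sum_k \sum_j (`|Re (f x k j)| `^ p + `|Im (f x k j)| `^ p)))).
  apply: int_le => //; first exact: in_Lp_aei.
  by apply: aeiZ => //; exact: aei_sum.
rewrite intZ//; last exact: aei_sum.
rewrite int_sum// ler_wpM2l// le_eqVlt; apply/orP; left; apply/eqP.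
apply: eq_bigr => k _; rewrite int_sum//; apply: eq_bigr => j _.
by have [h1 h2] := aei_entry k j pf; rewrite intD.
Qed.

End entrywise.

(** * The Poincare inequality on W^(1,p)_0 *)

Section poincare.
Context (R : realType) (n N : nat) (Omega : set 'rV[R]_n.+1) (p : R).
Hypothesis p1 : 1 < p.
Hypothesis oO : open Omega.
Hypothesis bO : bounded_set Omega.
Implicit Types (u : 'rV[R]_n.+1 -> 'cV[R[i]]_N) (Du : 'rV[R]_n.+1 -> 'M[R[i]]_(N, n.+1)).

Local Notation leb := (@lebesgue_rV R n.+1).
Local Notation I f := (\int[leb]_(x in Omega) f x)%R.
Local Notation aei := (aei leb Omega).

Let p0 : 0 < p. Proof. exact: lt_trans p1. Qed.
Let mO : measurable Omega. Proof. exact: measurable_Omega. Qed.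
Let O_fin : (leb Omega < +oo)%E. Proof. exact: bounded_lebesgue_rV_fin. Qed.

Let continuous_aei_powR (f : 'rV[R]_n.+1 -> R) : continuous f ->
  aei (fun x => `|f x| `^ p).
Proof.
move=> cf; have [M M0 HM] := continuous_bounded bO cf.
apply: (aei_le mO _ (g := fun=> M `^ p)).
- by apply: aem_powR; apply: aem_normr; exact: continuous_aem.
- exact: aei_cst.
- by move=> x Ox; rewrite ger0_norm ?powR_ge0// powR_le// ?HM// ltW.
Qed.

Lemma poincare_scalar : exists2 K, 0 <= K & forall phi : 'rV[R]_n.+1 -> R^o,
  test_fun Omega phi ->
  I (fun x => `|phi x| `^ p) <= K * I (fun x => `|partial ord0 phi x| `^ p).
Proof.
have [L L0 HL] := bounded_set_coord bO.
exists (2 * L * (2 * L + 1) `^ p); first by rewrite !mulr_ge0 ?powR_ge0 ?(ltW L0).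
move=> phi tphi; rewrite -lee_fin EFinM.
have cphi := test_fun_continuous tphi.
have cdphi := test_fun_partial_continuous (j := ord0) tphi.
(* A test function and its partial derivative vanish off [Omega], so integrals over [Omega] and over
   the whole space agree. *)
have h (f : 'rV[R]_n.+1 -> R) : continuous f -> (forall x, ~ Omega x -> f x = 0) ->
    ((I (fun x => `|f x| `^ p))%:E = \int[leb]_x (`|f x| `^ p)%:E)%E.
  move=> cf f0; rewrite -aei_EFin//; last exact: continuous_aei_powR.
  rewrite integral_mkcond; apply: eq_integral => x _; rewrite patchE.
  case: ifPn => // /negP; rewrite inE => nx.
  by rewrite f0// normr0 powR0// gt_eqF.
rewrite (h phi cphi (fun x => @test_fun_out _ _ _ phi x tphi)).
rewrite (h _ cdphi (fun x => @test_fun_partial_out _ _ _ phi ord0 x tphi)).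
by apply: (poincare_test_fun p1 L0 _ tphi) => x Ox; exact: HL.
Qed.

Lemma poincare_test_funC : exists2 K, 0 <= K & forall psi, test_funC Omega psi ->
  Lpint Omega p psi <= K * Lpint Omega p (jacobianC psi : _ -> 'M[R[i]]_(N, n.+1)).
Proof.
have [K K0 HK] := poincare_scalar.
have [C C0 HC] := Lpint_le_entries p1 mO O_fin N 1.
exists (C * \sum_(k < N) \sum_(j < 1) (K + K)).
  by rewrite mulr_ge0// sumr_ge0// => k _; rewrite sumr_ge0// => j _; rewrite addr_ge0.
move=> psi tpsi; have [pp pDp] := test_funC_in_Lp p1 oO bO tpsi.
apply: le_trans (HC _ pp) _; rewrite -mulrA ler_wpM2l// mulr_suml.
apply: ler_sum => k _; rewrite mulr_suml; apply: ler_sum => j _.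
rewrite ord1 mulrDl; have [t1 t2] := tpsi k.
have [d1 d2] := int_entry_le p1 mO k ord0 pDp.
have e1 : I (fun x => `|partial ord0 (fun y => Re (psi y k ord0)) x| `^ p) <=
    Lpint Omega p (jacobianC psi : _ -> 'M[R[i]]_(N, n.+1)).
  apply: le_trans _ d1; rewrite le_eqVlt; apply/orP; left; apply/eqP.
  by apply: eq_Rintegral => x _; rewrite mxE.
have e2 : I (fun x => `|partial ord0 (fun y => Im (psi y k ord0)) x| `^ p) <=
    Lpint Omega p (jacobianC psi : _ -> 'M[R[i]]_(N, n.+1)).
  apply: le_trans _ d2; rewrite le_eqVlt; apply/orP; left; apply/eqP.
  by apply: eq_Rintegral => x _; rewrite mxE.
have a1 := le_trans (HK _ t1) (ler_wpM2l K0 e1).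
have a2 := le_trans (HK _ t2) (ler_wpM2l K0 e2).
exact: lerD a1 a2.
Qed.

Lemma poincare_W1p0 : exists2 K, 0 < K & forall u Du, in_W1p0 Omega p u Du ->
  Lpint Omega p u <= K * Lpint Omega p Du.
Proof.
have [K K0 HK] := poincare_test_funC.
have t0 : 0 < 2 `^ p :> R by rewrite powR_gt0.
exists (2 `^ p * (K * 2 `^ p) + 1); first by rewrite ltr_wpDl// !mulr_ge0// ltW.
move=> u Du /(in_W1p0P p1 oO bO)[[pu pDu _] H].
have D0 := Lpint_ge0 Omega p Du.
apply: (@le_trans _ _ (2 `^ p * (K * 2 `^ p) * Lpint Omega p Du)); last first.
  by rewrite ler_wpM2r// lerDl.
apply/ler_addgt0Pr => e e0.
(* Two triangle inequalities around [poincare_test_funC] multiply the approximation error by exactly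
   [B]. *)
pose B := 2 `^ p * (1 + K * 2 `^ p); have B0 : 0 < B.
  by rewrite mulr_gt0// ltr_pwDl// mulr_ge0// ltW.
have [psi tpsi [h1 h2]] := H _ (divr_gt0 e0 B0).
have [pp pDp] := test_funC_in_Lp p1 oO bO tpsi.
have pd := in_Lp_sub p1 mO pu pp; have pDd := in_Lp_sub p1 mO pDu pDp.
have e1 : Lpint Omega p u <= 2 `^ p * (Lpint Omega p (fun x => u x - psi x) + Lpint Omega p psi).
  rewrite [X in Lpint _ _ X <= _](_ : u = fun x => (u x - psi x) + psi x).
    exact: LpintD.
  by apply/funext => x; rewrite subrK.
have e2 : Lpint Omega p (jacobianC psi : _ -> 'M[R[i]]_(N, n.+1)) <=
    2 `^ p * (Lpint Omega p (fun x => Du x - jacobianC psi x) + Lpint Omega p Du).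
  rewrite [X in Lpint _ _ X <= _](_ : _ = fun x => Du x - (Du x - jacobianC psi x)).
    by rewrite [X in 2 `^ p * X]addrC; exact: LpintB.
  by apply/funext => x; rewrite subKr.
have e3 := HK _ tpsi.
set a := Lpint Omega p (fun x => u x - psi x) in h1 e1.
set b := Lpint Omega p (fun x => Du x - _) in h2 e2.
have h1' := ltW h1; have h2' := ltW h2.
have arith (c a' b' q q' z x y : R) : 0 <= c -> z <= c * (a' + q) -> q <= K * q' ->
    q' <= c * (b' + y) -> a' <= x -> b' <= x -> z <= c * (x + K * (c * (x + y))).
  move=> c0 h3 h4 h5 h6 h7; apply: le_trans h3 _; apply: ler_wpM2l => //.
  apply: lerD => //; apply: le_trans h4 _; apply: ler_wpM2l => //.
  by apply: le_trans h5 _; apply: ler_wpM2l => //; rewrite lerD2r.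
apply: le_trans (arith _ _ _ _ _ _ _ _ (ltW t0) e1 e3 e2 h1' h2') _.
rewrite le_eqVlt; apply/orP; left; apply/eqP.
rewrite -[X in _ = _ + X](divfK (lt0r_neq0 B0)).
by set x := e / B; rewrite /B; ring.
Qed.

End poincare.

(** * Completeness of matrix-valued L^p *)

Section lp_matrix_complete.
Context (R : realType) (n : nat) (Omega : set 'rV[R]_n) (p : R).
Hypothesis p1 : 1 < p.
Hypothesis mO : measurable Omega.
Hypothesis O_fin : (lebesgue_rV R n Omega < +oo)%E.

Local Notation leb := (@lebesgue_rV R n).
Local Notation I f := (\int[leb]_(x in Omega) f x)%R.
Local Notation aem := (aem leb Omega).
Local Notation aei := (aei leb Omega).

(** The rate [eps] is chosen before the matrix size, so that one rate serves for functions and for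
    their Jacobians. *)
Lemma lp_matrix_complete : exists eps : nat -> R,
  [/\ forall k, 0 < eps k,
      forall e, 0 < e -> exists k0, forall k, (k0 <= k)%N -> eps k < e &
      forall N m, exists2 C, 0 <= C &
        forall f : nat -> 'rV[R]_n -> 'M[R[i]]_(N, m),
        (forall k, in_Lp Omega p (f k)) ->
        (forall k l, (k <= l)%N ->
           Lpint Omega p (fun x => f k x - f l x) < eps k) ->
        exists2 g, in_Lp Omega p g &
          forall k, Lpint Omega p (fun x => f k x - g x) <= C * eps k].
Proof.
have [eps [eps0 eps_cvg compl]] := lp_complete p1 mO O_fin.
exists eps; split => // N m.
have [C C0 HC] := Lpint_le_entries p1 mO O_fin N m.
exists (C * \sum_(k < N) \sum_(j < m) 2).
  by apply: mulr_ge0 => //; apply: sumr_ge0 => k _; apply: sumr_ge0.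
move=> f pf fcau.
have pd k l : in_Lp Omega p (fun x => f k x - f l x) by exact: in_Lp_sub.
have [/= gr grP] : {gr : 'I_N -> 'I_m -> 'rV[R]_n -> R | forall i j,
    [/\ aem (gr i j), aei (fun x => `|gr i j x| `^ p) & forall k,
      aei (fun x => `|Re (f k x i j) - gr i j x| `^ p) /\
      I (fun x => `|Re (f k x i j) - gr i j x| `^ p) <= eps k]}.
  apply/cid; have /choice[gr grP] : forall ij : 'I_N * 'I_m, exists g : 'rV[R]_n -> R,
    [/\ aem g, aei (fun x => `|g x| `^ p) & forall k,
      aei (fun x => `|Re (f k x ij.1 ij.2) - g x| `^ p) /\
      I (fun x => `|Re (f k x ij.1 ij.2) - g x| `^ p) <= eps k].
    move=> [i j]; apply: (compl (fun k x => Re (f k x i j))) => [k|k|k l kl].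
    - by have [] := in_Lp_mxm p1 mO (pf k) i j.
    - by have [] := aei_entry p1 mO i j (pf k).
    - have [h _] := int_entry_le p1 mO i j (pd k l).
      apply: le_lt_trans (fcau k l kl); apply: le_trans _ h.
      rewrite le_eqVlt; apply/orP; left; apply/eqP; apply: eq_Rintegral => x _.
      by rewrite !mxE Re_sub.
  by exists (fun i j => gr (i, j)) => i j; exact: (grP (i, j)).
have [/= gi giP] : {gi : 'I_N -> 'I_m -> 'rV[R]_n -> R | forall i j,
    [/\ aem (gi i j), aei (fun x => `|gi i j x| `^ p) & forall k,
      aei (fun x => `|Im (f k x i j) - gi i j x| `^ p) /\
      I (fun x => `|Im (f k x i j) - gi i j x| `^ p) <= eps k]}.
  apply/cid; have /choice[gi giP] : forall ij : 'I_N * 'I_m, exists g : 'rV[R]_n -> R,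
    [/\ aem g, aei (fun x => `|g x| `^ p) & forall k,
      aei (fun x => `|Im (f k x ij.1 ij.2) - g x| `^ p) /\
      I (fun x => `|Im (f k x ij.1 ij.2) - g x| `^ p) <= eps k].
    move=> [i j]; apply: (compl (fun k x => Im (f k x i j))) => [k|k|k l kl].
    - by have [] := in_Lp_mxm p1 mO (pf k) i j.
    - by have [] := aei_entry p1 mO i j (pf k).
    - have [_ h] := int_entry_le p1 mO i j (pd k l).
      apply: le_lt_trans (fcau k l kl); apply: le_trans _ h.
      rewrite le_eqVlt; apply/orP; left; apply/eqP; apply: eq_Rintegral => x _.
      by rewrite !mxE Im_sub.
  by exists (fun i j => gi (i, j)) => i j; exact: (giP (i, j)).
pose g x : 'M[R[i]]_(N, m) := \matrix_(i, j) (gr i j x +i* gi i j x)%C.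
have gE x i j : Re (g x i j) = gr i j x /\ Im (g x i j) = gi i j x by rewrite mxE.
have pg : in_Lp Omega p g.
  apply: (in_Lp_of_entries p1 mO O_fin) => i j.
  have er : (fun x => Re (g x i j)) = gr i j by apply/funext => x; case: (gE x i j).
  have ei : (fun x => Im (g x i j)) = gi i j by apply/funext => x; case: (gE x i j).
  have erp : (fun x => `|Re (g x i j)| `^ p) = fun x => `|gr i j x| `^ p.
    by apply/funext => x; have [-> _] := gE x i j.
  have eip : (fun x => `|Im (g x i j)| `^ p) = fun x => `|gi i j x| `^ p.
    by apply/funext => x; have [_ ->] := gE x i j.
  by rewrite er ei erp eip; have [? ? _] := grP i j; have [? ? _] := giP i j.
exists g => // k; apply: le_trans (HC _ (in_Lp_sub p1 mO (pf k) pg)) _.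
rewrite -mulrA ler_wpM2l// mulr_suml; apply: ler_sum => i _.
rewrite mulr_suml; apply: ler_sum => j _; rewrite mulr_natl mulr2n.
have [_ _ /(_ k)[_ h1]] := grP i j; have [_ _ /(_ k)[_ h2]] := giP i j.
apply: lerD.
  apply: le_trans _ h1; rewrite le_eqVlt; apply/orP; left; apply/eqP.
  apply: eq_Rintegral => x _; have [<- _] := gE x i j.
  by rewrite [X in Re X]mxE [X in Re (_ + X)]mxE Re_sub.
apply: le_trans _ h2; rewrite le_eqVlt; apply/orP; left; apply/eqP.
apply: eq_Rintegral => x _; have [_ <-] := gE x i j.
by rewrite [X in Im X]mxE [X in Im (_ + X)]mxE Im_sub.
Qed.

Lemma frobC_int_small N m (e : R) : 0 < e -> exists2 d, 0 < d &
  forall f : 'rV[R]_n -> 'M[R[i]]_(N, m), in_Lp Omega p f -> Lpint Omega p f < d ->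
    aei (fun x => frobC (f x)) /\ I (fun x => frobC (f x)) < e.
Proof.
move=> e0; pose M := fine (leb Omega) + 1.
have M0 : 0 < M by rewrite ltr_pwDr// fine_ge0.
pose c := e / 2 / M; have c0 : 0 < c by rewrite !divr_gt0.
pose C := c^-1 `^ (p - 1); have C0 : 0 < C by rewrite powR_gt0// invr_gt0.
exists (e / 2 / C) => [|f pf fd]; first by rewrite !divr_gt0.
have fi := in_Lp_aei p1 mO pf; have mf := in_Lp_mxm p1 mO pf.
have gi : aei (fun x => c + C * frobC (f x) `^ p).
  by apply: (aeiD mO); [exact: aei_cst|exact: (aeiZ mO)].
have le x : frobC (f x) <= c + C * frobC (f x) `^ p.
  by apply: (powR_linear p1) => //; exact: frobC_ge0.
have fa : aei (fun x => frobC (f x)).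
  apply: (aei_le mO (aem_frobC mf) gi) => x _.
  by rewrite ger0_norm ?frobC_ge0.
split => //; apply: le_lt_trans (int_le mO fa gi (fun x _ => le x)) _.
rewrite (intD mO); [|exact: aei_cst|exact: (aeiZ mO)].
rewrite (int_cst _ mO) (intZ mO _ fi).
have h1 : C * Lpint Omega p f < e / 2 by rewrite mulrC -ltr_pdivlMr.
have h2 : c * fine (leb Omega) <= e / 2.
  apply: (@le_trans _ _ (c * M)); last by rewrite /c divfK// gt_eqF.
  by rewrite ler_wpM2l ?(ltW c0)// lerDl.
rewrite [e in X in _ < X]splitr; exact: ler_ltD h2 h1.
Qed.

End lp_matrix_complete.

(** * Completeness of W^(1,p)_0 with respect to the gradient *)

Section W1p0_complete.
Context (R : realType) (n N : nat) (Omega : set 'rV[R]_n.+1) (p : R).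
Hypothesis p1 : 1 < p.
Hypothesis oO : open Omega.
Hypothesis bO : bounded_set Omega.
Implicit Types (u : 'rV[R]_n.+1 -> 'cV[R[i]]_N) (Du : 'rV[R]_n.+1 -> 'M[R[i]]_(N, n.+1)).

Local Notation leb := (@lebesgue_rV R n.+1).
Local Notation I f := (\int[leb]_(x in Omega) f x)%R.
Local Notation aei := (aei leb Omega).

Let p0 : 0 < p. Proof. exact: lt_trans p1. Qed.
Let mO : measurable Omega. Proof. exact: measurable_Omega. Qed.
Let O_fin : (leb Omega < +oo)%E. Proof. exact: bounded_lebesgue_rV_fin. Qed.

Lemma entry_pairing_small m (i : 'I_N) (j : 'I_m) (w : 'rV[R]_n.+1 -> R) (e : R) :
  continuous w -> 0 < e -> exists2 d, 0 < d &
  forall f g : 'rV[R]_n.+1 -> 'M[R[i]]_(N, m), in_Lp Omega p f -> in_Lp Omega p g ->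
    Lpint Omega p (fun x => f x - g x) < d ->
    `|I (fun x => Re (f x i j) * w x) - I (fun x => Re (g x i j) * w x)| < e /\
    `|I (fun x => Im (f x i j) * w x) - I (fun x => Im (g x i j) * w x)| < e.
Proof.
move=> cw e0; have [M M0 HM] := continuous_bounded bO cw.
have M1 : 0 < M + 1 by rewrite ltr_wpDl.
have [d d0 Hd] := frobC_int_small p1 mO O_fin N m (divr_gt0 e0 M1).
exists d => // f g pf pg fgd.
have [fga fgI] := Hd _ (in_Lp_sub p1 mO pf pg) fgd.
have [f1 f2] := in_Lp_entry p1 oO bO i j pf; have [g1 g2] := in_Lp_entry p1 oO bO i j pg.
have key (F G : 'rV[R]_n.+1 -> R) : aei F -> aei G ->
    (forall x, `|F x - G x| <= frobC (f x - g x)) ->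
    `|I (fun x => F x * w x) - I (fun x => G x * w x)| < e.
  move=> Fi Gi FG; have Fw := aei_continuousM oO bO Fi cw.
  have Gw := aei_continuousM oO bO Gi cw.
  rewrite -(intB mO Fw Gw).
  have wi : aei (fun x => (M + 1) * frobC (f x - g x)) by exact: (aeiZ mO).
  apply: (@le_lt_trans _ _ (I (fun x => (M + 1) * frobC (f x - g x)))).
    apply: (int_norm_le mO (aeiB mO Fw Gw) wi) => x Ox.
    rewrite -mulrBl normrM mulrC; apply: ler_pM => //.
    by apply: le_trans (HM x Ox) _; rewrite lerDl.
  by rewrite (intZ mO _ fga) mulrC -ltr_pdivlMr.
split; apply: key => // x.
  apply: le_trans _ (entry_Re_le (f x - g x) i j).
  by rewrite !mxE Re_sub.
apply: le_trans _ (entry_Im_le (f x - g x) i j).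
by rewrite !mxE Im_sub.
Qed.

Definition Lpcvg m (f : nat -> 'rV[R]_n.+1 -> 'M[R[i]]_(N, m))
    (g : 'rV[R]_n.+1 -> 'M[R[i]]_(N, m)) : Prop :=
  forall e, 0 < e -> exists k0, forall k, (k0 <= k)%N ->
    Lpint Omega p (fun x => f k x - g x) < e.

(** Test functions and their derivatives are bounded on [Omega], so both sides of the defining
    identity are continuous under L^p convergence. *)
Lemma weak_jacobian_closed (u_ : nat -> 'rV[R]_n.+1 -> 'cV[R[i]]_N)
    (Du_ : nat -> 'rV[R]_n.+1 -> 'M[R[i]]_(N, n.+1)) u Du :
  (forall k, in_W1p Omega p (u_ k) (Du_ k)) ->
  in_Lp Omega p u -> in_Lp Omega p Du -> Lpcvg u_ u -> Lpcvg Du_ Du ->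
  weak_jacobian Omega u Du.
Proof.
move=> W pu pDu ucvg Ducvg; apply/weak_jacobianP => i j phi tphi.
have cphi := test_fun_continuous tphi.
have cdphi := test_fun_partial_continuous (j := j) tphi.
have small e : 0 < e ->
    `|I (fun x => Re (u x i ord0) * partial j phi x) + I (fun x => Re (Du x i j) * phi x)| < e /\
    `|I (fun x => Im (u x i ord0) * partial j phi x) + I (fun x => Im (Du x i j) * phi x)| < e.
  move=> e0; have e2 : 0 < e / 2 by rewrite divr_gt0.
  have [d1 d10 H1] := entry_pairing_small i (ord0 : 'I_1) cdphi e2.
  have [d2 d20 H2] := entry_pairing_small i j cphi e2.
  have [k1 Hk1] := ucvg _ d10; have [k2 Hk2] := Ducvg _ d20.
  pose k := maxn k1 k2; have [pk pDk /weak_jacobianP wk] := W k.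
  have [r1 i1] := H1 _ _ pk pu (Hk1 k (leq_maxl _ _)).
  have [r2 i2] := H2 _ _ pDk pDu (Hk2 k (leq_maxr _ _)).
  have [wr wi] := wk i j phi tphi.
  have tri (a b c d : R) : a = - c -> `|a - b| < e / 2 -> `|c - d| < e / 2 ->
      `|b + d| < e.
    by move=> ->; rewrite !ltr_norml => /andP[? ?] /andP[? ?]; lra.
  by split; [exact: tri wr r1 r2|exact: tri wi i1 i2].
have z (a b : R) : (forall e, 0 < e -> `|a + b| < e) -> a = - b.
  move=> h; apply/eqP; rewrite -addr_eq0 -normr_le0; apply/ler_addgt0Pr => e e0.
  by rewrite add0r; apply/ltW/h.
by split; apply: z => e /small[].
Qed.

(** Only the Jacobians are assumed Cauchy: the Poincare inequality for the differences [u_k - u_l]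
    makes the functions Cauchy as well. *)
Lemma W1p0_complete : exists eps : nat -> R,
  [/\ forall k, 0 < eps k,
      forall e, 0 < e -> exists k0, forall k, (k0 <= k)%N -> eps k < e &
      forall (u_ : nat -> 'rV[R]_n.+1 -> 'cV[R[i]]_N)
             (Du_ : nat -> 'rV[R]_n.+1 -> 'M[R[i]]_(N, n.+1)),
        (forall k, in_W1p0 Omega p (u_ k) (Du_ k)) ->
        (forall k l, (k <= l)%N -> Lpint Omega p (fun x => Du_ k x - Du_ l x) < eps k) ->
        exists u Du, in_W1p0 Omega p u Du /\ Lpcvg Du_ Du].
Proof.
have [eps [eps0 eps_cvg compl]] := lp_matrix_complete p1 mO O_fin.
have [K K0 HK] := poincare_W1p0 N p1 oO bO.
have K1 : 0 < K + 1 by rewrite ltr_wpDl// ltW.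
(* Dividing by [K + 1] leaves the rate [eps] for the Jacobians and, after multiplication by [K], for
   the functions. *)
exists (fun k => eps k / (K + 1)); split.
- by move=> k; rewrite divr_gt0.
- move=> e e0; have [k0 Hk0] := eps_cvg _ (mulr_gt0 e0 K1).
  by exists k0 => k /Hk0 h; rewrite ltr_pdivrMr.
move=> u_ Du_ W cau.
have pu k : in_Lp Omega p (u_ k) by have [[]] := W k.
have pDu k : in_Lp Omega p (Du_ k) by have [[]] := W k.
have Dcau k l : (k <= l)%N -> Lpint Omega p (fun x => Du_ k x - Du_ l x) < eps k.
  move=> kl; apply: lt_le_trans (cau k l kl) _.
  by rewrite ler_pdivrMr// ler_peMr ?(ltW (eps0 k))// lerDr ltW.
have ucau k l : (k <= l)%N -> Lpint Omega p (fun x => u_ k x - u_ l x) < eps k.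
  move=> kl; have := in_W1p0ZD p1 oO bO (-1) (W l) (W k).
  rewrite (_ : (fun x => -1 *: u_ l x + u_ k x) = fun x => u_ k x - u_ l x); last first.
    by apply/funext => x; rewrite scaleN1r addrC.
  rewrite (_ : (fun x => -1 *: Du_ l x + Du_ k x) = fun x => Du_ k x - Du_ l x); last first.
    by apply/funext => x; rewrite scaleN1r addrC.
  move=> /HK h; apply: le_lt_trans h _.
  have := cau k l kl; rewrite ltr_pdivlMr//.
  have := Lpint_ge0 Omega p (fun x => Du_ k x - Du_ l x).
  by move: (Lpint _ _ _) => a a0 h; apply: le_lt_trans h; rewrite mulrDr mulrC lerDl mulr1.
have cvg m (f : nat -> 'rV[R]_n.+1 -> 'M[R[i]]_(N, m)) g C : 0 <= C ->
    (forall k, Lpint Omega p (fun x => f k x - g x) <= C * eps k) -> Lpcvg f g.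
  move=> C0 H e e0; have C1 : 0 < C + 1 by rewrite ltr_wpDl.
  have [k0 Hk0] := eps_cvg _ (divr_gt0 e0 C1); exists k0 => k /Hk0 h.
  apply: le_lt_trans (H k) _; move: h; rewrite ltr_pdivlMr// => h.
  apply: le_lt_trans _ h; rewrite mulrC mulrDr mulr1 lerDl; exact: ltW.
have [Cu Cu0 Hu] := compl N 1%N; have [u upu uH] := Hu u_ pu ucau.
have [CD CD0 HD] := compl N n.+1; have [Du upDu DuH] := HD Du_ pDu Dcau.
have ucvg := cvg _ u_ u Cu Cu0 uH; have Ducvg := cvg _ Du_ Du CD CD0 DuH.
exists u, Du; split => //; apply/(in_W1p0P p1 oO bO); split.
  by split => //; apply: (weak_jacobian_closed _ upu upDu ucvg Ducvg) => k; case: (W k).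
move=> e e0; have t0 : 0 < 2 `^ p :> R by rewrite powR_gt0.
have e1 : 0 < e / (2 `^ p * 2) by rewrite divr_gt0// mulr_gt0.
have [k1 Hk1] := ucvg _ e1; have [k2 Hk2] := Ducvg _ e1.
pose k := maxn k1 k2; have [_ /(_ _ e1)[psi tpsi [h1 h2]]] := (in_W1p0P p1 oO bO _ _).1 (W k).
exists psi => //; have [pp pDp] := test_funC_in_Lp p1 oO bO tpsi.
have tri m (f g h : 'rV[R]_n.+1 -> 'M[R[i]]_(N, m)) : in_Lp Omega p f ->
    in_Lp Omega p g -> in_Lp Omega p h ->
    Lpint Omega p (fun x => f x - g x) < e / (2 `^ p * 2) ->
    Lpint Omega p (fun x => f x - h x) < e / (2 `^ p * 2) ->
    Lpint Omega p (fun x => g x - h x) < e.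
  move=> pf pg ph fg fh.
  have pgf := in_Lp_sub p1 mO pf pg; have pfh := in_Lp_sub p1 mO pf ph.
  rewrite (_ : (fun x => g x - h x) = fun x => (f x - h x) - (f x - g x)); last first.
    by apply/funext => x; rewrite opprB [RHS]addrC subrKA.
  apply: le_lt_trans (LpintB p1 mO pfh pgf) _.
  move: fg fh; move: (Lpint _ _ _) (Lpint _ _ _) => a b ha hb.
  rewrite mulrC -ltr_pdivlMr//.
  have -> : e / 2 `^ p = e / (2 `^ p * 2) + e / (2 `^ p * 2).
    by field; rewrite gt_eqF.
  exact: ltrD.
split; first exact: (tri _ (u_ k) u psi (pu k) upu pp (Hk1 k (leq_maxl _ _)) h1).
exact: (tri _ (Du_ k) Du _ (pDu k) upDu pDp (Hk2 k (leq_maxr _ _)) h2).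
Qed.

End W1p0_complete.

(** * The weak formulation *)

Section pairing.
Context (R : realType) (n : nat) (Omega : set 'rV[R]_n) (p mu : R).
Hypothesis p1 : 1 < p.
Hypothesis mu01 : 0 <= mu <= 1.
Hypothesis mO : measurable Omega.
Hypothesis O_fin : (lebesgue_rV R n Omega < +oo)%E.
Context (N m : nat).
Implicit Types y z F : 'rV[R]_n -> 'M[R[i]]_(N, m).

Local Notation leb := (@lebesgue_rV R n).
Local Notation I f := (\int[leb]_(x in Omega) f x)%R.
Local Notation aem := (aem leb Omega).
Local Notation aei := (aei leb Omega).
Local Notation Lp := (in_Lp Omega p).
Local Notation E y := (I (fun x => eng p mu (y x))).

Let p0 : 0 < p. Proof. exact: lt_trans p1. Qed.

Lemma aem_powRq (q : R) (f : 'rV[R]_n -> R) : aem f -> aem (fun x => f x `^ q).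
Proof.
by move=> mf; exact: (aem_comp (h := fun s => s `^ q) (measurable_powR q) mf).
Qed.

Lemma mxm_scale (f : 'rV[R]_n -> R) y : aem f -> mxm Omega y ->
  mxm Omega (fun x => (f x)%:C%C *: y x).
Proof.
move=> mf my k j; have [y1 y2] := my k j; split.
  rewrite (_ : (fun x => _) = fun x => f x * Re (y x k j)); first exact: aemM.
  by apply/funext => x; rewrite mxE Re_mul/= mul0r subr0.
rewrite (_ : (fun x => _) = fun x => f x * Im (y x k j)); first exact: aemM.
by apply/funext => x; rewrite mxE Im_mul/= mul0r addr0.
Qed.

Lemma mxm_VmapC y : mxm Omega y -> mxm Omega (fun x => VmapC p mu (y x)).
Proof.
move=> my; apply: (mxm_scale _ my); apply: aem_powRq; apply: aemD; first exact: aem_cst.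
have e : (fun x => frobC (y x) ^+ 2) = fun x => frobC (y x) * frobC (y x) by [].
by rewrite e; apply: aemM; exact: (aem_frobC my).
Qed.

Lemma mxm_pmapC y : mxm Omega y -> mxm Omega (fun x => pmapC p (y x)).
Proof. by move=> my; apply: (mxm_scale _ my); apply: aem_powRq; exact: (aem_frobC my). Qed.

Lemma aem_Re_mul (b c : 'rV[R]_n -> R[i]) : ae_measurableC Omega b ->
  ae_measurableC Omega c -> aem (fun x => Re (b x * c x)).
Proof.
move=> [b1 b2] [c1 c2].
rewrite (_ : (fun x => _) = fun x => Re (b x) * Re (c x) - Im (b x) * Im (c x)).
  by apply: aemB; exact: aemM.
by apply/funext => x; rewrite Re_mul.
Qed.

Lemma ae_measurableC_mxdotC y z : mxm Omega y -> mxm Omega z ->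
  ae_measurableC Omega (fun x => mxdotC (y x) (z x)).
Proof.
move=> my mz; split.
  rewrite (_ : (fun x => _) = fun x => \sum_k \sum_j
      (Re (y x k j) * Re (z x k j) + Im (y x k j) * Im (z x k j))).
    apply: aem_sum => k; apply: aem_sum => j; have [y1 y2] := my k j.
    by have [z1 z2] := mz k j; apply: aemD; exact: aemM.
  apply/funext => x; rewrite Re_sum; apply: eq_bigr => k _; rewrite Re_sum.
  by apply: eq_bigr => j _; rewrite Re_mul Re_conjc Im_conjc mulrN opprK.
rewrite (_ : (fun x => _) = fun x => \sum_k \sum_j
    (Im (y x k j) * Re (z x k j) - Re (y x k j) * Im (z x k j))).
  apply: aem_sum => k; apply: aem_sum => j; have [y1 y2] := my k j.
  by have [z1 z2] := mz k j; apply: aemB; exact: aemM.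
apply/funext => x; rewrite Im_sum; apply: eq_bigr => k _; rewrite Im_sum.
by apply: eq_bigr => j _; rewrite Im_mul Re_conjc Im_conjc mulrN addrC.
Qed.

Lemma aei_eng y : Lp y -> aei (fun x => eng p mu (y x)).
Proof.
move=> py; have yi := in_Lp_aei p1 mO py; have my := in_Lp_mxm p1 mO py.
have gi : aei (fun x => 2 `^ p * (1 + frobC (y x) `^ p)).
  by apply: (aeiZ mO); apply: (aeiD mO) yi; exact: aei_cst.
apply: (aei_le mO _ gi).
  apply: aem_powRq.
  have ms : aem (fun x => mu ^+ 2 + frobC (y x) * frobC (y x)).
    by apply: aemD; [exact: aem_cst|apply: aemM; exact: (aem_frobC my)].
  apply: (aem_comp (h := @Num.sqrt R) _ ms).
  by apply: continuous_measurable_fun; exact: sqrt_continuous.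
by move=> x _; rewrite ger0_norm ?eng_ge0//; exact: eng_le.
Qed.

Lemma int_eng_ge0 y : 0 <= E y.
Proof. by apply: Rintegral_ge0 => x _; exact: eng_ge0. Qed.

Lemma Lpint_le_eng y : Lp y -> Lpint Omega p y <= E y.
Proof.
move=> py; apply: (int_le mO (in_Lp_aei p1 mO py) (aei_eng py)) => x _.
exact: frobC_powR_le_eng.
Qed.

(** The coefficient stays free: [a] gives the operator, the constant 1 the differential of the
    energy. *)
Definition pairV (b : 'rV[R]_n -> R[i]) y z : R :=
  I (fun x => Re (b x * mxdotC (VmapC p mu (y x)) (z x))).

Definition pairF F z : R := I (fun x => Re (mxdotC (pmapC p (F x)) (z x))).

Section bounded_coefficient.
Context (b : 'rV[R]_n -> R[i]) (M : R).
Hypothesis mb : ae_measurableC Omega b.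
Hypothesis bM : forall x, Omega x -> normc (b x) <= M.
Hypothesis M0 : 0 < M.

Let pairV_le x (Y Z : 'M[R[i]]_(N, m)) : Omega x ->
  `|Re (b x * mxdotC Y Z)| <= M * (frobC Y * frobC Z).
Proof.
move=> Ox; apply: le_trans (Re_mulmxdotC_le (b x) Y Z) _.
by apply: ler_wpM2r; [rewrite mulr_ge0 ?frobC_ge0|exact: bM].
Qed.

Let aem_pairV y z : mxm Omega y -> mxm Omega z ->
  aem (fun x => Re (b x * mxdotC (y x) (z x))).
Proof. by move=> my mz; apply: aem_Re_mul => //; exact: ae_measurableC_mxdotC. Qed.

Let young y z (e C : R) : (forall s t : R, 0 <= s -> 0 <= t ->
     s `^ (p - 1) * t <= e * s `^ p + C * t `^ p) ->
  forall x, Omega x -> `|Re (b x * mxdotC (VmapC p mu (y x)) (z x))| <=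
    M * (e * eng p mu (y x) + C * frobC (z x) `^ p).
Proof.
move=> H x Ox; apply: le_trans (pairV_le _ _ Ox) _.
apply: ler_wpM2l; first exact: ltW.
apply: le_trans _ (H _ _ (bra_ge0 mu _) (frobC_ge0 _)).
by apply: ler_wpM2r; [exact: frobC_ge0|exact: frobC_VmapC_le].
Qed.

Let aei_young y z (e C : R) : Lp y -> Lp z ->
  aei (fun x => M * (e * eng p mu (y x) + C * frobC (z x) `^ p)).
Proof.
move=> py pz; apply: (aeiZ mO); apply: (aeiD mO); apply: (aeiZ mO).
  exact: aei_eng.
exact: in_Lp_aei.
Qed.

Lemma aei_pairV y z : Lp y -> Lp z ->
  aei (fun x => Re (b x * mxdotC (VmapC p mu (y x)) (z x))).
Proof.
move=> py pz; have [C C0 HC] := powR_young p1 (@ltr01 R).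
have my := in_Lp_mxm p1 mO py; have mz := in_Lp_mxm p1 mO pz.
apply: (aei_le mO _ (aei_young 1 C py pz)).
  exact: (aem_pairV (mxm_VmapC my) mz).
exact: (@young y z 1 C HC).
Qed.

Lemma pairVD y z1 z2 : Lp y -> Lp z1 -> Lp z2 ->
  pairV b y (fun x => z1 x + z2 x) = pairV b y z1 + pairV b y z2.
Proof.
move=> py pz1 pz2; rewrite /pairV -(intD mO (aei_pairV py pz1) (aei_pairV py pz2)).
by apply: eq_Rintegral => x _; rewrite mxdotCDr mulrDr Re_add.
Qed.

Lemma pairVZ y z (t : R) : Lp y -> Lp z ->
  pairV b y (fun x => t%:C%C *: z x) = t * pairV b y z.
Proof.
move=> py pz; rewrite /pairV -(intZ mO _ (aei_pairV py pz)).
apply: eq_Rintegral => x _; rewrite mxdotCZr conjc_real mulrCA.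
by rewrite [in LHS]Re_mul/= mul0r subr0.
Qed.

Lemma pairV_continuous y (e : R) : Lp y -> 0 < e -> exists2 d, 0 < d &
  forall z, Lp z -> Lpint Omega p z < d -> `|pairV b y z| < e.
Proof.
move=> py e0; have E0 := int_eng_ge0 y; pose D := E y + 1.
have D0 : 0 < D by rewrite ltr_wpDl.
have e'0 : 0 < e / M / 2 / D by rewrite !divr_gt0.
have [C C0 HC] := powR_young p1 e'0.
exists (e / M / 2 / C) => [|z pz zd]; first by rewrite !divr_gt0.
apply: le_lt_trans (int_norm_le mO (aei_pairV py pz) (aei_young _ C py pz) (@young y z _ C HC)) _.
have yi := aei_eng py; have zi := in_Lp_aei p1 mO pz.
rewrite (intZ mO _ (aeiD mO (aeiZ mO _ yi) (aeiZ mO _ zi))).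
rewrite (intD mO (aeiZ mO _ yi) (aeiZ mO _ zi)) (intZ mO _ yi) (intZ mO _ zi).
rewrite mulrC -ltr_pdivlMr// [ltRHS]splitr; apply: ler_ltD.
  rewrite mulrAC ler_pdivrMr//; apply: ler_wpM2l; last by rewrite lerDl.
  by rewrite !divr_ge0// ltW.
by rewrite mulrC -ltr_pdivlMr.
Qed.

Lemma pairV_sub y1 y2 z : Lp y1 -> Lp y2 -> Lp z ->
  aei (fun x => Re (b x * mxdotC (VmapC p mu (y1 x) - VmapC p mu (y2 x)) (z x))) /\
  pairV b y1 z - pairV b y2 z =
  I (fun x => Re (b x * mxdotC (VmapC p mu (y1 x) - VmapC p mu (y2 x)) (z x))).
Proof.
move=> py1 py2 pz; have a1 := aei_pairV py1 pz; have a2 := aei_pairV py2 pz.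
have e : (fun x => Re (b x * mxdotC (VmapC p mu (y1 x) - VmapC p mu (y2 x)) (z x))) =
    fun x => Re (b x * mxdotC (VmapC p mu (y1 x)) (z x)) -
             Re (b x * mxdotC (VmapC p mu (y2 x)) (z x)).
  by apply/funext => x; rewrite mxdotCDl mxdotCNl mulrDr mulrN Re_add Re_opp.
rewrite e; split; first exact: (aeiB mO a1 a2).
by rewrite /pairV -(intB mO a1 a2).
Qed.

Context (N' n' : nat) (c1 c2 : R).
Hypothesis N0 : (0 < N')%N.
Hypothesis n0 : (0 < n')%N.
Hypothesis Vb : V_bounds N' n' p mu c1 c2.
Hypothesis c1_gt0 : 0 < c1.
Hypothesis c2_gt0 : 0 < c2.

Lemma pairV_hemicontinuous y z (e : R) : Lp y -> Lp z -> 0 < e ->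
  exists2 d, 0 < d & forall t : R, 0 < t -> t < d ->
    `|pairV b (fun x => y x + t%:C%C *: z x) z - pairV b y z| < e.
Proof.
move=> py pz e0; have E0 := int_eng_ge0 y; have L0 := Lpint_ge0 Omega p z.
pose S := E y + Lpint Omega p z + 1; have S0 : 0 < S by rewrite ltr_wpDl// addr_ge0.
have SE : E y + Lpint Omega p z <= S by rewrite /S lerDl.
have SL : Lpint Omega p z <= S by apply: le_trans SE; rewrite lerDr; exact: E0.
pose r := e / M / 2; have r0 : 0 < r by rewrite !divr_gt0.
have [C C0 HC] := VmapC_hemicontinuous N m p1 N0 n0 Vb c1_gt0 c2_gt0
  (divr_gt0 r0 S0).
have q0 : 0 < p - 1 by rewrite subr_gt0.
have rC : 0 < r / (C * S) by rewrite divr_gt0// mulr_gt0.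
(* The bound 1 is the range of the pointwise estimate; the other makes [C * t^(p-1) * S] smaller
   than [r], half of the allowed error after division by [M]. *)
exists (Num.min 1 ((r / (C * S)) `^ (p - 1)^-1)).
  by rewrite lt_min ltr01 powR_gt0.
move=> t t0; rewrite lt_min => /andP[t1 tr].
have tq : t `^ (p - 1) < r / (C * S).
  have -> : r / (C * S) = ((r / (C * S)) `^ (p - 1)^-1) `^ (p - 1).
    by rewrite -powRrM mulVf ?gt_eqF// powRr1// ltW.
  by apply: gt0_ltr_powR => //; rewrite nnegrE ?powR_ge0// ltW.
have pyt : Lp (fun x => y x + t%:C%C *: z x).
  have := in_LpZD p1 mO t%:C%C pz py; congr in_Lp; apply/funext => x.
  by rewrite addrC.
have [di ->] := pairV_sub pyt py pz.
have yi := aei_eng py; have zi := in_Lp_aei p1 mO pz.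
have yzi := aeiD mO yi zi.
have bi : aei (fun x => M * (r / S * (eng p mu (y x) + frobC (z x) `^ p) +
    C * (t `^ (p - 1)) * frobC (z x) `^ p)).
  exact: (aeiZ mO _ (aeiD mO (aeiZ mO _ yzi) (aeiZ mO _ zi))).
have bd x : Omega x -> `|Re (b x * mxdotC (VmapC p mu (y x + t%:C%C *: z x) -
    VmapC p mu (y x)) (z x))| <=
    M * (r / S * (eng p mu (y x) + frobC (z x) `^ p) +
    C * (t `^ (p - 1)) * frobC (z x) `^ p).
  move=> Ox; apply: le_trans (pairV_le _ _ Ox) _.
  apply: ler_wpM2l; first exact: ltW.
  by rewrite -[C * _ * _]mulrA; exact: HC.
apply: le_lt_trans (int_norm_le mO di bi bd) _.
rewrite (intZ mO _ (aeiD mO (aeiZ mO _ yzi) (aeiZ mO _ zi))).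
rewrite (intD mO (aeiZ mO _ yzi) (aeiZ mO _ zi)) (intZ mO _ yzi) (intZ mO _ zi).
rewrite (intD mO yi zi) -/(Lpint Omega p z).
rewrite mulrC -ltr_pdivlMr// [ltRHS]splitr -/r; apply: ler_ltD.
  rewrite mulrAC ler_pdivrMr//; apply: ler_wpM2l; first exact: (ltW r0).
  exact: SE.
apply: (@le_lt_trans _ _ (C * t `^ (p - 1) * S)).
  apply: ler_wpM2l SL; exact: mulr_ge0 (ltW C0) (powR_ge0 _ _).
by rewrite mulrAC mulrC -ltr_pdivlMr// mulr_gt0.
Qed.

Section sector.
Context (gamma : R).
Hypothesis gamma0 : 0 < gamma.
Hypothesis sector : \forall x \ae leb, Omega x ->
  gamma < Re (b x) - Num.sqrt ((c2 / c1) ^+ 2 - 1) * `|Im (b x)|.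

Let W y z x := wgt2 p mu (frobC (y x)) (frobC (z x)) * frobC (y x - z x) ^+ 2.

Let W_ge0 y z x : 0 <= W y z x.
Proof. by rewrite mulr_ge0 ?wgt2_ge0// sqr_ge0. Qed.

Let sectorW y z : \forall x \ae leb, Omega x ->
  gamma * c1 * W y z x <=
    Re (b x * mxdotC (VmapC p mu (y x) - VmapC p mu (z x)) (y x - z x)).
Proof.
apply: filterS sector => x bx Ox.
exact: (VmapC_sector N0 n0 Vb c1_gt0 c2_gt0 (y x) (z x) gamma0 (bx Ox)).
Qed.

Lemma pairV_monotone y z : Lp y -> Lp z ->
  0 <= pairV b y (fun x => y x - z x) - pairV b z (fun x => y x - z x).
Proof.
move=> py pz; have [di ->] := pairV_sub py pz (in_Lp_sub p1 mO py pz).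
have z0 : I (fun=> 0) = 0 by rewrite (int_cst _ mO) mul0r.
rewrite -[X in X <= _]z0; apply: (int_ae_le mO (aei_cst mO O_fin 0) di).
apply: filterS (sectorW y z) => x h Ox; apply: le_trans (h Ox).
exact: mulr_ge0 (ltW (mulr_gt0 gamma0 c1_gt0)) (W_ge0 y z x).
Qed.

(** Strong monotonicity up to a small multiple of the energies. With coefficient 1 it yields uniform
    convexity on sublevel sets, with [a] it yields uniqueness. *)
Lemma pairV_strong (d : R) : 0 < d -> exists2 C, 0 < C &
  forall y z, Lp y -> Lp z -> Lpint Omega p (fun x => y x - z x) <=
    d * (E y + E z) +
    C * (pairV b y (fun x => y x - z x) - pairV b z (fun x => y x - z x)).
Proof.
move=> d0; have [C C0 HC] := frobC_sub_powR_le mu N m p1 d0.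
have gc0 : 0 < gamma * c1 by rewrite mulr_gt0.
exists (C / (gamma * c1)) => [|y z py pz]; first by rewrite divr_gt0.
have pd := in_Lp_sub p1 mO py pz.
have [di ->] := pairV_sub py pz pd.
have yi := aei_eng py; have zi := aei_eng pz; have yzi := aeiD mO yi zi.
rewrite -(intD mO yi zi) -(intZ mO _ yzi) -(intZ mO _ di).
rewrite -(intD mO (aeiZ mO _ yzi) (aeiZ mO _ di)).
apply: (int_ae_le mO (in_Lp_aei p1 mO pd) (aeiD mO (aeiZ mO _ yzi) (aeiZ mO _ di))).
apply: filterS (sectorW y z) => x h Ox; apply: le_trans (HC (y x) (z x)) _.
rewrite lerD2l -mulrA; apply: ler_wpM2l; first exact: ltW.
by rewrite [leRHS]mulrC ler_pdivlMr// mulrC; exact: h.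
Qed.

Lemma pairV_coercive y : Lp y ->
  gamma * (2^-1 * E y - 2 `^ p * fine (leb Omega)) <= pairV b y y.
Proof.
move=> py; have yi := aei_eng py; have hi := aeiZ mO 2^-1 yi.
have ci := aei_cst mO O_fin (2 `^ p).
rewrite -(int_cst _ mO) -(intZ mO _ yi) -(intB mO hi ci).
rewrite -(intZ mO _ (aeiB mO hi ci)).
apply: (int_ae_le mO (aeiZ mO _ (aeiB mO hi ci)) (aei_pairV py py)).
apply: filterS sector => x h Ox.
apply: (VmapC_coercive p1 mu01); first exact: ltW.
apply/ltW/(lt_le_trans (h Ox)); rewrite gerBl.
by rewrite mulr_ge0 ?sqrtr_ge0.
Qed.

End sector.
End bounded_coefficient.

Lemma ae_measurableC_cst (c : R[i]) : ae_measurableC Omega (fun=> c).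
Proof. by split; exact: aem_cst. Qed.

Lemma int_eng_tangent y z : Lp y -> Lp z ->
  E y / p + pairV (fun=> 1) y (fun x => z x - y x) <= E z / p.
Proof.
move=> py pz; have yi := aei_eng py; have zi := aei_eng pz.
have n1 x : Omega x -> normc (1 : R[i]) <= 1 by rewrite Normc.normc1.
have di := aei_pairV (ae_measurableC_cst 1) n1 ltr01 py (in_Lp_sub p1 mO pz py).
have yi' := aeiZ mO p^-1 yi; have zi' := aeiZ mO p^-1 zi.
have ey : I (fun x => p^-1 * eng p mu (y x)) = E y / p.
  by rewrite mulrC; exact: (intZ mO _ yi).
have ez : I (fun x => p^-1 * eng p mu (z x)) = E z / p.
  by rewrite mulrC; exact: (intZ mO _ zi).
have eyd := etrans (intD mO yi' di) (congr1 (+%R^~ _) ey).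
have le_of_eq (s t : R) : s = t -> s <= t by move=> ->.
apply: le_trans (le_of_eq _ _ (esym eyd)) (le_trans _ (le_of_eq _ _ ez)).
apply: (int_le mO (aeiD mO yi' di) zi') => x _.
by rewrite mul1r mulrC [p^-1 * eng p mu (z x)]mulrC; exact: eng_tangent.
Qed.

Section datum.
Context (F : 'rV[R]_n -> 'M[R[i]]_(N, m)).
Hypothesis pF : Lp F.

Let pairF_le z x :
  `|Re (mxdotC (pmapC p (F x)) (z x))| <= frobC (F x) `^ (p - 1) * frobC (z x).
Proof.
rewrite -(frobC_pmapC p1); apply: le_trans (Re_le_normc _) _; exact: mxdotC_le.
Qed.

Lemma aei_pairF z : Lp z -> aei (fun x => Re (mxdotC (pmapC p (F x)) (z x))).
Proof.
move=> pz; have [C C0 HC] := powR_young p1 (@ltr01 R).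
have mF := in_Lp_mxm p1 mO pF; have mz := in_Lp_mxm p1 mO pz.
have Fi := in_Lp_aei p1 mO pF; have zi := in_Lp_aei p1 mO pz.
have [mR _] := ae_measurableC_mxdotC (mxm_pmapC mF) mz.
apply: (aei_le mO mR (aeiD mO (aeiZ mO 1 Fi) (aeiZ mO C zi))) => x _.
apply: le_trans (pairF_le z x) _; apply: HC; exact: frobC_ge0.
Qed.

Lemma pairFD z1 z2 : Lp z1 -> Lp z2 ->
  pairF F (fun x => z1 x + z2 x) = pairF F z1 + pairF F z2.
Proof.
move=> pz1 pz2; rewrite /pairF -(intD mO (aei_pairF pz1) (aei_pairF pz2)).
by apply: eq_Rintegral => x _; rewrite mxdotCDr Re_add.
Qed.

Lemma pairFZ z (t : R) : Lp z ->
  pairF F (fun x => t%:C%C *: z x) = t * pairF F z.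
Proof.
move=> pz; rewrite /pairF -(intZ mO _ (aei_pairF pz)).
apply: eq_Rintegral => x _; rewrite mxdotCZr conjc_real.
by rewrite [in LHS]Re_mul/= mul0r subr0.
Qed.

Lemma pairF_bound (e C : R) z : Lp z ->
  (forall s t : R, 0 <= s -> 0 <= t -> s `^ (p - 1) * t <= e * s `^ p + C * t `^ p) ->
  `|pairF F z| <= e * Lpint Omega p F + C * Lpint Omega p z.
Proof.
move=> pz H; have Fi := in_Lp_aei p1 mO pF; have zi := in_Lp_aei p1 mO pz.
rewrite /Lpint -(intZ mO _ Fi) -(intZ mO _ zi) -(intD mO (aeiZ mO _ Fi) (aeiZ mO _ zi)).
apply: (int_norm_le mO (aei_pairF pz) (aeiD mO (aeiZ mO _ Fi) (aeiZ mO _ zi))) => x _.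
apply: le_trans (pairF_le z x) _; apply: H; exact: frobC_ge0.
Qed.

Lemma pairF_continuous (e : R) : 0 < e -> exists2 d, 0 < d &
  forall z, Lp z -> Lpint Omega p z < d -> `|pairF F z| < e.
Proof.
move=> e0; have F0 := Lpint_ge0 Omega p F; pose D := Lpint Omega p F + 1.
have D0 : 0 < D by rewrite ltr_wpDl.
have e'0 : 0 < e / 2 / D by rewrite !divr_gt0.
have [C C0 HC] := powR_young p1 e'0.
exists (e / 2 / C) => [|z pz zd]; first by rewrite !divr_gt0.
apply: le_lt_trans (pairF_bound pz HC) _.
rewrite [ltRHS]splitr; apply: ler_ltD; last by rewrite mulrC -ltr_pdivlMr.
rewrite mulrAC ler_pdivrMr//; apply: ler_wpM2l; last by rewrite lerDl.
by rewrite !divr_ge0// ltW.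
Qed.

End datum.
End pairing.

(** * Existence and uniqueness of the weak solution *)

Section solution.
Context (R : realType) (p : R) (n N : nat) (mu c1 c2 : R).
Context (Omega : set 'rV[R]_n.+1) (F : 'rV[R]_n.+1 -> 'M[R[i]]_(N, n.+1)).
Context (a : 'rV[R]_n.+1 -> R[i]) (gamma M : R).
Hypothesis p1 : 1 < p.
Hypothesis N0 : (0 < N)%N.
Hypothesis mu01 : 0 <= mu <= 1.
Hypothesis c1_gt0 : 0 < c1.
Hypothesis c2_gt0 : 0 < c2.
Hypothesis Vb : V_bounds N n.+1 p mu c1 c2.
Hypothesis oO : open Omega.
Hypothesis bO : bounded_set Omega.
Hypothesis pF : in_Lp Omega p F.
Hypothesis ma : ae_measurableC Omega a.
Hypothesis aM : forall x, Omega x -> normc (a x) <= M.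
Hypothesis M0 : 0 < M.
Hypothesis gamma0 : 0 < gamma.

Local Notation leb := (@lebesgue_rV R n.+1).
Local Notation I f := (\int[leb]_(x in Omega) f x)%R.
Local Notation Lp := (in_Lp Omega p).
Local Notation E y := (I (fun x => eng p mu (y x))).

Hypothesis sector : \forall x \ae leb, Omega x ->
  gamma < Re (a x) - Num.sqrt ((c2 / c1) ^+ 2 - 1) * `|Im (a x)|.

Let p0 : 0 < p. Proof. exact: lt_trans p1. Qed.
Let mO : measurable Omega. Proof. exact: measurable_Omega. Qed.
Let O_fin : (leb Omega < +oo)%E. Proof. exact: bounded_lebesgue_rV_fin. Qed.
Let n0 : (0 < n.+1)%N. Proof. by []. Qed.

(** A function is carried together with a weak Jacobian, and representatives are not identified up
    to null sets. The ambient space is thus a plain function module, and the Jacobian of a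
    combination is the combination of Jacobians. *)
Let T : lmodType R[i] :=
  (('rV[R]_n.+1 -> 'cV[R[i]]_N) * ('rV[R]_n.+1 -> 'M[R[i]]_(N, n.+1)))%type.
Let X : set T := [set z | in_W1p0 Omega p z.1 z.2].

Let XLp (z : T) : X z -> Lp z.2. Proof. by move=> [[]]. Qed.

Let X_subspace : real_subspace X.
Proof.
have XZD (c : R[i]) (z w : T) : X z -> X w -> X (c *: z + w).
  by move=> Xz Xw; exact: (in_W1p0ZD p1 oO bO c Xz Xw).
have X0 : X 0 by exact: (in_W1p0_0 N p1 oO bO).
split => // [x y Xx Xy|t x Xx].
  by rewrite -[x]scale1r; exact: XZD.
by rewrite /rscale -[_ *: _]addr0; exact: XZD.
Qed.

Let B (y z : T) : R := pairV Omega p mu a y.2 z.2 - pairF Omega p F z.2.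
Let G (y z : T) : R := pairV Omega p mu (fun=> 1) y.2 z.2.
(** All forms depend on the Jacobian alone, so closeness is measured there; the Poincare inequality
    recovers the function. *)
Let rho (z : T) : R := Lpint Omega p z.2.
Let Psi (z : T) : R := E z.2 / p.

Let one_le x : Omega x -> normc (1 : R[i]) <= 1.
Proof. by rewrite Normc.normc1. Qed.
Let m1 : ae_measurableC Omega (fun=> 1).
Proof. exact: ae_measurableC_cst. Qed.

Let pairV_linear (b : 'rV[R]_n.+1 -> R[i]) (M' : R) (y : T) :
  ae_measurableC Omega b -> (forall x, Omega x -> normc (b x) <= M') -> 0 < M' ->
  X y -> linear_on X (fun z : T => pairV Omega p mu b y.2 z.2).
Proof.
move=> mb bM M'0 Xy; split=> [z w Xz Xw|t z Xz].
  exact: (pairVD p1 mu01 mO O_fin mb bM M'0 (XLp Xy) (XLp Xz) (XLp Xw)).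
exact: (pairVZ p1 mu01 mO O_fin mb bM M'0 t (XLp Xy) (XLp Xz)).
Qed.

Let B_linear y : X y -> linear_on X (B y).
Proof.
move=> Xy; have [VD VZ] := pairV_linear ma aM M0 Xy.
split=> [z w Xz Xw|t z Xz]; rewrite /B.
  have := VD _ _ Xz Xw; have := pairFD p1 mO pF (XLp Xz) (XLp Xw).
  by move=> /= -> ->; ring.
have := VZ t _ Xz; have := pairFZ p1 mO pF t (XLp Xz).
by move=> /= -> ->; ring.
Qed.

Let X_sub x y : X x -> X y -> X (x - y).
Proof.
move=> Xx Xy; rewrite -[- y]scaleN1r addrC.
exact: (in_W1p0ZD p1 oO bO (-1) Xy Xx).
Qed.

Let pairV_continuous_at0 (b : 'rV[R]_n.+1 -> R[i]) (M' : R) (y : T) :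
  ae_measurableC Omega b -> (forall x, Omega x -> normc (b x) <= M') -> 0 < M' ->
  X y -> continuous_at0 X rho (fun z : T => pairV Omega p mu b y.2 z.2).
Proof.
move=> mb bM M'0 Xy e e0.
have [d d0 hd] := pairV_continuous p1 mu01 mO O_fin mb bM M'0 (XLp Xy) e0.
by exists d => [|z Xz zd]; [exact: d0|exact: (hd _ (XLp Xz) zd)].
Qed.

Let B_continuous y : X y -> continuous_at0 X rho (B y).
Proof.
move=> Xy e e0; have e20 : 0 < e / 2 by rewrite divr_gt0.
have [d d0 hd] := pairV_continuous_at0 ma aM M0 Xy e20.
have [d' d'0 hd'] := pairF_continuous p1 mO pF e20.
exists (Num.min d d') => [|z Xz]; first by rewrite lt_min d0.
rewrite lt_min => /andP[zd zd']; rewrite [ltRHS]splitr.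
apply: le_lt_trans (ler_normB _ _) _.
by apply: ltrD; [exact: (hd _ Xz zd)|exact: (hd' _ (XLp Xz) zd')].
Qed.

Let B_monotone x y : X x -> X y -> 0 <= B x (x - y) - B y (x - y).
Proof.
move=> Xx Xy; have := pairV_monotone p1 mu01 mO O_fin ma aM M0 N0 n0 Vb
  c1_gt0 c2_gt0 gamma0 sector (XLp Xx) (XLp Xy).
rewrite /B; set u := pairV _ _ _ _ _ _; set v := pairV _ _ _ _ _ _ => h.
by rewrite opprB addrA subrK.
Qed.

Let B_hemicontinuous x z : X x -> X z -> forall e, 0 < e ->
  exists2 d, 0 < d & forall t, 0 < t -> t < d -> `|B (x + rscale t z) z - B x z| < e.
Proof.
move=> Xx Xz e e0.
have [d d0 hd] := pairV_hemicontinuous p1 mu01 mO O_fin ma aM M0 N0 n0 Vb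
  c1_gt0 c2_gt0 (XLp Xx) (XLp Xz) e0.
exists d => [|t t0 td]; first exact: d0.
have := hd t t0 td; rewrite /B.
set u := pairV _ _ _ _ _ _; set v := pairV _ _ _ _ _ _ => h.
by rewrite opprB addrA subrK.
Qed.

Let B_coercive : exists M1, forall x, X x -> B x x <= 0 -> Psi x < M1.
Proof.
(* Coercivity yields [gamma / 2] times the energy. Young's inequality for the datum gives back a
   quarter of [gamma], and the remaining quarter explains the factor 4; the final [+ 1] makes the
   bound strict. *)
have g40 : 0 < gamma / 4 by rewrite divr_gt0.
have arith (V P e l f m C : R) : gamma * (2^-1 * e - m) <= V -> V <= P ->
    P <= C * f + gamma / 4 * l -> gamma / 4 * l <= gamma / 4 * e ->
    gamma * e <= 4 * (gamma * m + C * f) by lra.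
have [C C0 HC] := powR_young' p1 g40.
exists (4 * (2 `^ p * fine (leb Omega) + C / gamma * Lpint Omega p F) / p + 1).
move=> x Xx; rewrite /B subr_le0 => Bx.
have h1 := pairV_coercive p1 mu01 mO O_fin ma aM M0 gamma0 sector (XLp Xx).
have h2 := pairF_bound p1 mO pF (XLp Xx) HC.
have h3 := Lpint_le_eng p1 mu01 mO O_fin (XLp Xx).
have h4 := le_trans (ler_norm _) h2.
have h5 : gamma / 4 * Lpint Omega p x.2 <= gamma / 4 * E x.2.
  exact: (ler_wpM2l (ltW g40) h3).
rewrite ltr_pwDr// /Psi ler_pM2r ?invr_gt0//.
rewrite -(ler_pM2l gamma0).
rewrite (_ : gamma * (4 * _) =
  4 * (gamma * (2 `^ p * fine (leb Omega)) + C * Lpint Omega p F)); last first.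
  by field; rewrite gt_eqF.
exact: (arith _ _ _ _ _ _ _ h1 Bx h4 h5).
Qed.

Let Psi_ge0 x : X x -> 0 <= Psi x.
Proof. by move=> Xx; rewrite divr_ge0// ?(ltW p0)// int_eng_ge0. Qed.

(** The sector condition is strict, so the coefficient 1 satisfies it with a constant below 1. *)
Let one_sector : \forall x \ae leb, Omega x ->
  2^-1 < Re (1 : R[i]) - Num.sqrt ((c2 / c1) ^+ 2 - 1) * `|Im (1 : R[i])|.
Proof.
by apply: aeW => x _ /=; rewrite normr0 mulr0 subr0 invf_lt1// ltr1n.
Qed.

Let G_gradient x y : X x -> X y -> Psi x + G x (y - x) <= Psi y.
Proof.
by move=> Xx Xy; exact: (int_eng_tangent p1 mu01 mO O_fin (XLp Xx) (XLp Xy)).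
Qed.

Let G_strongly_monotone (K e : R) : 0 < e -> exists2 d, 0 < d & forall x y : T,
  X x -> X y -> Psi x <= K -> Psi y <= K ->
  G x (x - y) - G y (x - y) < d -> rho (rscale 2 (x - y)) < e.
Proof.
move=> e0; have t0 : 0 < 2 `^ p :> R by rewrite powR_gt0.
(* On the sublevel set [D] bounds [2 ^ p] times the sum of the two energies, where [2 ^ p] comes
   from the factor 2 inside [rho]. *)
pose D := 2 `^ p * (2 * (`|K| + 1) * p).
have D0 : 0 < D by rewrite !mulr_gt0// ltr_wpDl.
have de0 : 0 < e / 2 / D by rewrite !divr_gt0.
have half0 : 0 < 2^-1 :> R by rewrite invr_gt0.
have [C C0 HC] := pairV_strong p1 mu01 mO O_fin N n.+1 m1 one_le ltr01 N0 n0 Vb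
  c1_gt0 c2_gt0 half0 one_sector de0.
exists (e / 2 / (2 `^ p * C)) => [|x y Xx Xy xK yK Gd].
  by rewrite !divr_gt0 ?mulr_gt0.
have h1 := HC _ _ (XLp Xx) (XLp Xy).
rewrite /rho (_ : (rscale 2 (x - y)).2 = fun r => (2 : R)%:C%C *: (x.2 r - y.2 r))//.
rewrite (LpintZ p1 mO _ (in_Lp_sub p1 mO (XLp Xx) (XLp Xy))) normc_real.
rewrite [`|2|]ger0_norm//.
have h2 z : Psi z <= K -> E z.2 <= (`|K| + 1) * p.
  rewrite /Psi ler_pdivrMr// => h; apply: le_trans h _.
  by rewrite ler_pM2r// ler_wpDr// ler_norm.
have h3 := h2 _ xK; have h4 := h2 _ yK.
rewrite -ltr_pdivlMl//; apply: le_lt_trans h1 _.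
rewrite [e in ltRHS]splitr [ltRHS]mulrDr; apply: ler_ltD.
  rewrite /D; set Q := 2 * _ * p.
  have Q0 : 0 < Q by rewrite !mulr_gt0// ltr_wpDl.
  rewrite (_ : _ / (_ * Q) = (2 `^ p)^-1 * (e / 2) / Q); last first.
    by field; rewrite !gt_eqF.
  rewrite mulrAC ler_pdivrMr//; apply: ler_wpM2l.
    by rewrite mulr_ge0 ?invr_ge0 ?(ltW t0)// divr_ge0// (ltW e0).
  rewrite /Q -mulrA mulr_natl mulr2n; exact: (lerD h3 h4).
move: Gd; rewrite /G ltr_pdivlMr ?mulr_gt0// => Gd.
rewrite ltr_pdivlMl// mulrA mulrC; exact: Gd.
Qed.

Let solvable : exists2 x : T, X x &
  forall z, X z -> pairV Omega p mu a x.2 z.2 = pairF Omega p F z.2.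
Proof.
have [eps [eps0 eps_cvg compl]] := W1p0_complete N p1 oO bO.
have [|x Xx Bx] := browder_minty (eps := eps) X_subspace B_linear B_continuous
  B_monotone B_hemicontinuous B_coercive Psi_ge0
  (fun y => pairV_linear m1 one_le ltr01)
  (fun y => pairV_continuous_at0 m1 one_le ltr01)
  G_gradient G_strongly_monotone eps0 eps_cvg.
  move=> x_ Xx_ x_cauchy.
  have [u [Du [Xu cu]]] := compl (fun k => (x_ k).1) (fun k => (x_ k).2) Xx_ x_cauchy.
  by exists (u, Du).
by exists x => // z Xz; apply/eqP; rewrite -subr_eq0; apply/eqP; exact: (Bx z Xz).
Qed.

(* Testing with [i phi] turns real parts into imaginary parts. *)
Let weak_equationP Du : Lp Du ->
  (forall phi Dphi, in_W1p0 Omega p phi Dphi ->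
    integralC Omega (fun x => a x * mxdotC (VmapC p mu (Du x)) (Dphi x)) =
    integralC Omega (fun x => mxdotC (pmapC p (F x)) (Dphi x))) <->
  (forall z, X z -> pairV Omega p mu a Du z.2 = pairF Omega p F z.2).
Proof.
move=> pDu; split=> [H [phi Dphi] Xz|H phi Dphi W]; first by have [] := H _ _ Xz.
pose c : R[i] := (0 +i* 1)%C.
have Re_c (w : R[i]) : Re (c^*%C * w) = Im w.
  by case: w => w1 w2 /=; rewrite mul0r sub0r mulN1r opprK.
have Xc : X (c *: ((phi, Dphi) : T) + 0).
  exact: (in_W1p0ZD p1 oO bO c W (in_W1p0_0 N p1 oO bO)).
move: (H (phi, Dphi) W) (H _ Xc); rewrite addr0 /pairV /pairF /integralC => -> e.
congr (_ +i* _)%C.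
transitivity (I (fun x => Re (a x * mxdotC (VmapC p mu (Du x)) (c *: Dphi x)))).
  by apply: eq_Rintegral => x _; rewrite mxdotCZr mulrCA Re_c.
by rewrite [LHS]e; apply: eq_Rintegral => x _ /=; rewrite mxdotCZr Re_c.
Qed.

Lemma weak_solution_exists_unique : exists2 u, weak_solution Omega p mu a F u &
  forall v, weak_solution Omega p mu a F v -> ae_eq leb Omega v u.
Proof.
have [[u Du] /= Xu Hu] := solvable.
exists u => [|v [Dv Xv Hv]].
  by exists Du => //; apply/(weak_equationP (XLp Xu)).
have pDu : Lp Du := XLp Xu; have pDv : Lp Dv by exact: (@XLp (v, Dv) Xv).
move: Hv; rewrite (weak_equationP pDv) => Hv.
pose w : T := ((u, Du) : T) - (v, Dv).
have Xw : X w by exact: (X_sub Xu (Xv : X (v, Dv))).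
have [K K0 HK] := poincare_W1p0 N p1 oO bO.
(* Both equations tested with the difference cancel the monotone term of [pairV_strong], leaving an
   arbitrarily small multiple of fixed energies. *)
have Dw0 : Lpint Omega p w.2 = 0.
  apply/eqP; rewrite eq_le Lpint_ge0 andbT; apply/ler_addgt0Pr => e e0.
  rewrite add0r; pose D := E Du + E Dv + 1.
  have D0 : 0 < D by rewrite ltr_wpDl// addr_ge0// int_eng_ge0.
  have [C C0 HC] := pairV_strong p1 mu01 mO O_fin N n.+1 ma aM M0 N0 n0 Vb
    c1_gt0 c2_gt0 gamma0 sector (divr_gt0 e0 D0).
  have := HC _ _ pDu pDv; rewrite (Hu _ Xw) (Hv _ Xw) subrr mulr0 addr0 => h.
  apply: le_trans h _; rewrite mulrAC ler_pdivrMr//; apply: ler_wpM2l; first exact: ltW.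
  by rewrite lerDl.
have w0 : Lpint Omega p w.1 = 0.
  apply/eqP; rewrite eq_le Lpint_ge0 andbT.
  by apply: le_trans (HK _ _ Xw) _; rewrite Dw0 mulr0.
have [[pw _ _] _] := Xw.
apply: filterS (Lpint_eq0 p1 mO pw w0) => x h Ox.
by have /eqP := h Ox; rewrite subr_eq0 => /eqP.
Qed.

End solution.

Theorem theorem1p3 (R : realType) (p : R) (n N : nat) (mu c1 c2 : R)
    (Omega : set 'rV[R]_n) (F : 'rV[R]_n -> 'M[R[i]]_(N, n))
    (a : 'rV[R]_n -> R[i]) (gamma0 gamma1 gamma2 : R) :
  1 < p -> (2 <= n)%N -> (1 <= N)%N -> 0 <= mu <= 1 ->
  0 < c1 -> 0 < c2 -> V_bounds N n p mu c1 c2 ->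
  open Omega -> bounded_set Omega ->
  in_Lp Omega p F ->
  ae_measurableC Omega a ->
  (exists M : R, forall x, Omega x -> Normc.normc (a x) <= M) ->
  0 < gamma0 -> 0 < gamma1 -> 0 < gamma2 ->
  let c0 := Num.sqrt ((c2 / c1) ^+ 2 - 1) in
  (\forall x \ae (@lebesgue_rV R n), Omega x ->
    gamma1 <= Normc.normc (a x) <= gamma2 /\
    gamma0 < complex.Re (a x) - c0 * `|complex.Im (a x)|) ->
  exists2 u : 'rV[R]_n -> 'cV[R[i]]_N,
    weak_solution Omega p mu a F u &
    forall v : 'rV[R]_n -> 'cV[R[i]]_N, weak_solution Omega p mu a F v ->
      ae_eq (@lebesgue_rV R n) Omega v u.
Proof.
(* A successor dimension exhibits the first coordinate, along which the Poincare inequality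
   integrates. *)
case: n => // n in Omega F a * => p1 _ N0 mu01 c1_gt0 c2_gt0 Vb oO bO pF ma [M aM].
move=> gamma0_gt0 _ _ c0 Ha.
have aM' x : Omega x -> normc (a x) <= `|M| + 1.
  by move=> /aM h; apply: le_trans h _; rewrite ler_wpDr// ler_norm.
have M'0 : 0 < `|M| + 1 by rewrite ltr_wpDl.
apply: (weak_solution_exists_unique p1 N0 mu01 c1_gt0 c2_gt0 Vb oO bO pF ma aM' M'0
  gamma0_gt0).
by apply: filterS Ha => x h Ox; have [] := h Ox.
Qed.
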